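(* Let $n\ge2$, $k\in\mathbb{Z}_{\ge1}$, and let $\Gamma=([n],w)$ be a weighted hypergraph. Then the three operators \[ {\cal L}(\Gamma,\mathcal{KMP}_k),\qquad {\cal L}_{\mathrm{TorInv}}(\Gamma,S_{k,k}),\qquad {\cal L}_{\mathrm{TorInv}}\Big(\Gamma,\bigoplus_{j=0}^{k}\rho_{(j,0,\ldots,0,-j)}\Big) \] are conjugate to each other (equal up to a linear isomorphism between the underlying spaces).
   Context: A weighted hypergraph $\Gamma=([n],w)$ assigns a weight $w_B$ to every $B\subseteq[n]$. $\mathrm{U}_B\le\mathrm{U}(n)$ is the subgroup of unitaries coinciding with the identity outside the minor indexed by $B$, with Haar probability measure $\mu_B$; for a finite-dimensional representation $\rho$, ${\cal L}(\Gamma,\rho)=\sum_Bw_B[I-\int_{\mathrm{U}_B}\rho(A)d\mu_B(A)]$. $T_n$ is the diagonal subgroup of $\mathrm{U}(n)$, $\mathrm{TorInv}(\rho)$ the subspace of vectors fixed by $\rho(T_n)$ (it is ${\cal L}(\Gamma,\rho)$-invariant), and ${\cal L}_{\mathrm{TorInv}}(\Gamma,\rho)$ the restriction of ${\cal L}(\Gamma,\rho)$ to it. With $V=\mathbb{C}^n$ the standard representation $A\mapsto A$ and $V^*$ its dual, $S_{k,m}=\mathrm{Sym}^k(V)\otimes\mathrm{Sym}^m(V^* )$. $\rho_\mu$ is the irreducible representation of highest weight $\mu$ ($\rho_{(0,\ldots,0)}$ trivial). Discrete KMP: let $\binom{[n]}{k}\!\!\binom{}{}$ denote the set of multisets of size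 $k$ with elements in $[n]$ (functions $f\colon[n]\to\mathbb{Z}_{\ge0}$ with $\sum f=k$), and ${\cal MS}(n,k)$ the complex vector space with basis $\{\delta_f\}$ indexed by these multisets. For $B\subseteq[n]$, ${\cal N}_B$ is the linear operator sending $\delta_f$ to the uniform average of $\delta_g$ over all multisets $g$ of size $k$ with $g(j)=f(j)$ for all $j\notin B$. Then ${\cal L}(\Gamma,\mathcal{KMP}_k)=\sum_{B\subseteq[n]}w_B(I-{\cal N}_B)$. *)

(* Defs.v *)
(* R : realType, complex numbers R[i]
   (mathcomp-real-closed).  Matrices/operators on finite-dimensional spaces are
   represented as functions  I -> I -> R[i]  over a finite index type I
   (column convention: (L v) x = \sum_y L x y * v y). *)
From HB Require Import structures.
From mathcomp Require Import all_boot all_order all_algebra.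
From mathcomp Require Import all_classical all_reals all_analysis.
From mathcomp Require Import complex.

Set Implicit Arguments.
Unset Strict Implicit.
Unset Printing Implicit Defensive.

Import Order.TTheory GRing.Theory Num.Theory.
Local Open Scope ring_scope.
Local Open Scope classical_set_scope.

(* The space of complex n x n matrices, with the Borel sigma-algebra   *)
(* (generated by real and imaginary parts of the entries).             *)
Definition Mx (R : realType) (n : nat) := 'M[R[i]]_n.
HB.instance Definition _ (R : realType) n := Choice.on (Mx R n).
HB.instance Definition _ (R : realType) n := isPointed.Build (Mx R n) 0.

Definition mx_gen (R : realType) (n : nat) : set (set (Mx R n)) :=
  [set E | exists (i j : 'I_n) (A : set R), measurable A /\
     (E = [set X : Mx R n | A (complex.Re ((X : 'M[R[i]]_n) i j))] \/
      E = [set X : Mx R n | A (complex.Im ((X : 'M[R[i]]_n) i j))])].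

Definition MxMeas (R : realType) (n : nat) := g_sigma_algebraType (@mx_gen R n).

Section Defs.
Variable R : realType.
Local Notation C := (R[i]).

Definition unitary n (A : 'M[C]_n) : Prop := A *m (map_mx Num.conj A)^T = 1%:M.

Definition UB n (B : {set 'I_n}) : set (MxMeas R n) :=
  [set A : MxMeas R n | unitary (A : 'M[C]_n) /\
     forall i j : 'I_n, (i \notin B) || (j \notin B) -> (A : 'M[C]_n) i j = (i == j)%:R].

Definition is_torus_elt n (t : 'I_n -> C) : Prop := forall i, `|t i| = 1.
Definition tor n (t : 'I_n -> C) : 'M[C]_n := diag_mx (\row_i t i).

Definition haar_prob n (G : set (MxMeas R n)) (mu : probability (MxMeas R n) R) : Prop :=
  mu G = 1%E /\
  forall A : 'M[C]_n, G A -> forall E : set (MxMeas R n), measurable E ->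
     mu ((fun X : MxMeas R n => (A *m (X : 'M[C]_n) : MxMeas R n)) @^-1` E) = mu E.

Definition cint n (mu : probability (MxMeas R n) R) (D : set (MxMeas R n))
    (f : MxMeas R n -> C) : C :=
  Complex (Rintegral mu D (fun X => complex.Re (f X)))
          (Rintegral mu D (fun X => complex.Im (f X))).

Definition opapply (I : finType) (L : I -> I -> C) (v : I -> C) : I -> C :=
  fun x => \sum_y L x y * v y.

Definition lin_subspace (I : finType) (W : set (I -> C)) : Prop :=
  W (fun _ => 0) /\ forall a u v, W u -> W v -> W (fun x => a * u x + v x).

Definition conj_on (I J : finType) (W : set (I -> C)) (L : I -> I -> C)
    (W' : set (J -> C)) (L' : J -> J -> C) : Prop :=
  exists Phi : (I -> C) -> (J -> C),
  [/\ forall a u v, Phi (fun x => a * u x + v x) = (fun y => a * Phi u y + Phi v y),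
      forall u, W u -> W' (Phi u),
      forall u v, W u -> W v -> Phi u = Phi v -> u = v,
      forall v, W' v -> exists2 u, W u & Phi u = v &
      forall u, W u -> Phi (opapply L u) = opapply L' (Phi u)].

(* Finite-dimensional representations of U(n), given by their matrices *)
(* rho A : I -> I -> C (defined on all matrices; only unitary A matter).*)
Definition is_rep n (I : finType) (rho : 'M[C]_n -> I -> I -> C) : Prop :=
  [/\ forall x y, rho 1%:M x y = (x == y)%:R,
      forall A B, unitary A -> unitary B -> forall x z,
        rho (A *m B) x z = \sum_y rho A x y * rho B y z &
      forall x y, measurable_fun [set X : MxMeas R n | unitary (X : 'M[C]_n)] (fun X : MxMeas R n => complex.Re (rho X x y))
               /\ measurable_fun [set X : MxMeas R n | unitary (X : 'M[C]_n)] (fun X : MxMeas R n => complex.Im (rho X x y))].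

Definition irreducible n (I : finType) (rho : 'M[C]_n -> I -> I -> C) : Prop :=
  (0 < #|I|)%N /\
  forall W : set (I -> C), lin_subspace W ->
    (forall A, unitary A -> forall v, W v -> W (opapply (rho A) v)) ->
    (forall v, W v -> v = (fun _ => 0)) \/ (forall v, W v).

Definition is_weight n (I : finType) (rho : 'M[C]_n -> I -> I -> C) (lam : 'I_n -> int) : Prop :=
  exists v : I -> C, v <> (fun _ => 0) /\
    forall t, is_torus_elt t ->
      opapply (rho (tor t)) v = (fun x => (\prod_i t i ^ lam i) * v x).

(* dominance order: mu - lam is a N-combination of the positive roots
   e_i - e_{i+1}, i.e. mu - lam = \sum_{m < n-1} c_m (e_m - e_{m+1}) *)
Definition dominated n (lam mu : 'I_n -> int) : Prop :=
  exists c : nat -> nat, c n.-1 = 0%N /\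
    forall i : 'I_n, mu i - lam i = (c i)%:Z - (if val i is i'.+1 then c i' else 0%N)%:Z.

Definition highest_weight n (I : finType) (rho : 'M[C]_n -> I -> I -> C) (mu : 'I_n -> int) : Prop :=
  is_weight rho mu /\ forall lam, is_weight rho lam -> dominated lam mu.

Definition irrep_of_hw n (I : finType) (rho : 'M[C]_n -> I -> I -> C) (mu : 'I_n -> int) : Prop :=
  [/\ is_rep rho, irreducible rho & highest_weight rho mu].

Definition dsum n (J : finType) (d : J -> nat)
    (rho : forall j, 'M[C]_n -> 'I_(d j) -> 'I_(d j) -> C)
    : 'M[C]_n -> {j : J & 'I_(d j)} -> {j : J & 'I_(d j)} -> C :=
  fun A x y => if tag x == tag y then rho (tag x) A (tagged x) (tagged_as x y) else 0.

Definition TorInv n (I : finType) (rho : 'M[C]_n -> I -> I -> C) : set (I -> C) :=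
  [set v | forall t, is_torus_elt t -> opapply (rho (tor t)) v = v].

Definition Lop n (I : finType) (w : {set 'I_n} -> R)
    (mu : {set 'I_n} -> probability (MxMeas R n) R)
    (rho : 'M[C]_n -> I -> I -> C) : I -> I -> C :=
  fun x y => \sum_(B : {set 'I_n})
     real_complex R (w B) * ((x == y)%:R - cint (mu B) (UB B) (fun A => rho A x y)).

Definition msetk (n k : nat) := {f : {ffun 'I_n -> 'I_k.+1} | \sum_i (f i : nat) == k}.

Definition tcontent n k (t : k.-tuple 'I_n) (f : msetk n k) : bool :=
  [forall i, (val f i : nat) == count_mem i t].

(* matrix of Sym^k(M) in the monomial basis e^f (f a multiset):
   M.e^f = prod_p (M e_{s_p}) = sum_g symk M g f e^g, s a word of tcontent f *)
Definition symk n k (M : 'M[C]_n) : msetk n k -> msetk n k -> C :=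
  fun g f =>
  match [pick s : k.-tuple 'I_n | tcontent s f] with
  | Some s => \sum_(t : k.-tuple 'I_n | tcontent t g) \prod_(p < k) M (tnth t p) (tnth s p)
  | None => 0
  end.

(* S_{k,m} = Sym^k(V) (x) Sym^m(V dual), V dual acted on by (A^{-1})^T *)
Definition Skm n k m (A : 'M[C]_n) :
    (msetk n k * msetk n m)%type -> (msetk n k * msetk n m)%type -> C :=
  fun x y => @symk n k A x.1 y.1 * @symk n m (invmx A)^T x.2 y.2.

Definition NB n k (B : {set 'I_n}) : msetk n k -> msetk n k -> C :=
  fun g f =>
  let S := finset (fun h : msetk n k => [forall j, (j \notin B) ==> (val h j == val f j)]) in
  if g \in S then (#|S|%:R)^-1 else 0.

Definition LKMP n (w : {set 'I_n} -> R) k : msetk n k -> msetk n k -> C :=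
  fun g f => \sum_(B : {set 'I_n}) real_complex R (w B) * ((g == f)%:R - @NB n k B g f).

Definition hw_j n (j : nat) : 'I_n -> int :=
  fun i => if val i == 0%N then j%:Z else if val i == n.-1 then - j%:Z else 0.

End Defs.

(* Main.v *)
(* Vectors of S_{k,k} fixed by the torus are supported on the diagonal f = g, and averaging over
   U_B maps the diagonal to itself.  By invariance, this average (suitably scaled) commutes with
   Sym^k A for A in U_B; as some A in U_B has all its entries in B nonzero, it is constant on
   multisets agreeing off B, which is the KMP update.

   For the decomposition of S_{k,k} it suffices to find, for j <= k, a nonzero intertwiner L_j from
   rho_j to S_{k,k}: by Schur's lemma the sum of the L_j is then injective.  Regular functions are
   dense, so an irreducible rho_j has regular matrix coefficients and extends to GL_n.  There, by
   Gaussian elimination, its highest weight forces A_11^j ((A^-1)_nn)^j to be a coefficient.  It is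
   also a matrix coefficient of S_{k,k}, read off from the vector
   X_1^j Y_n^j (sum_i X_i Y_i)^(k-j), so averaging S_{k,k} against rho_j gives L_j.  For
   surjectivity, the vectors invariant under U(1) x U(n-1) in the image are
   k+1 independent functions of one multiplicity in {0, ..., k}; hence they span the
   monomial X_1^k Y_1^k, whose orbit spans S_{k,k}. *)
Require Import Defs.
From HB Require Import structures.
From mathcomp Require Import all_boot all_order all_algebra.
From mathcomp Require Import all_classical all_reals all_analysis.
From mathcomp Require Import perm measurable_realfun.
From mathcomp Require Import complex ring lra zify.
Set Implicit Arguments.
Unset Strict Implicit.
Unset Printing Implicit Defensive.
Import Order.TTheory GRing.Theory Num.Theory numFieldNormedType.Exports.
Local Open Scope ring_scope.
Local Open Scope classical_set_scope.

(** * Zariski density of the unitary group *)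

(** [is_rep] provides measurable coefficients on unitary matrices, not continuity, and [haar_prob]
    provides left invariance. Boundedness, hence integrability, of a representation is therefore
    proved first, by intersecting two sets of measure above 1/2. No invariant inner product is
    introduced: duals are handled through covectors, and averages have the form of an integral of
    sigma(X) E rho(X^-1), where replacing X by A X moves A from one side to the other by left
    invariance alone. Weights see only the torus. To reach GL_n, a regular function is restricted to
    a rational curve and shown to vanish at infinitely many parameters; circles, rotations and
    transvections are traded for one another in this way. Weight spaces are isolated with the
    circles U_B, B = {i}, so the torus needs no measure of its own. There is no dimension count at
    the end: the independence of the k+1 spherical functions, one for each rho_j, is deduced from
    the injectivity of the sum of the L_j. *)

Section InfiniteSets.
Variable R : realType.
Local Notation C := R[i].

(* Equivalently, S is infinite. *)
Definition zdense (S : C -> Prop) := forall p : {poly C}, p != 0 -> exists2 z, S z & p.[z] != 0.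

Lemma zdense_seq (u : nat -> C) (S : C -> Prop) :
  injective u -> (forall m, S (u m)) -> zdense S.
Proof.
move=> inju Su p p0.
have [/existsP[m /= pm]|/existsPn h] := boolP [exists m : 'I_(size p), p.[u m] != 0].
  by exists (u m).
have := @max_poly_roots _ p [seq u (val m) | m <- enum 'I_(size p)] p0.
rewrite size_map size_enum_ord ltnn => h'; suff: false by [].
apply: h'.
  by apply/allP => _ /mapP[m _ ->]; have := h m; rewrite negbK rootE.
rewrite map_inj_uniq ?enum_uniq // => m1 m2 /inju; exact: val_inj.
Qed.

Lemma zdense_sub (S T : C -> Prop) : (forall z, S z -> T z) -> zdense S -> zdense T.
Proof. by move=> ST dS p /dS[z /ST Tz pz]; exists z. Qed.

Lemma zdense_nroot (S : C -> Prop) (q : {poly C}) :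
  q != 0 -> zdense S -> zdense (fun z => S z /\ q.[z] != 0).
Proof.
move=> q0 dS p p0; have [z Sz] := dS (q * p) (mulf_neq0 q0 p0).
by rewrite hornerM mulf_eq0 negb_or => /andP[qz pz]; exists z.
Qed.

Lemma zdense_real : zdense (fun z => exists r : R, z = r%:C%C).
Proof.
apply: (@zdense_seq (fun m => (m%:R : R)%:C%C)) => [m1 m2 /complexI /eqP|m].
  by rewrite eqr_nat => /eqP.
by exists m%:R.
Qed.

Lemma zdense_setT : zdense (fun _ => True).
Proof. exact: zdense_sub zdense_real. Qed.

Lemma normc1P (z : C) : `|z| = 1 <-> z * Num.conj z = 1.
Proof.
rewrite -normCK; split=> [->|/eqP]; first by rewrite expr1n.
by rewrite sqrp_eq1 // => /eqP.
Qed.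

Lemma norm_onecircle (a b : R) : a ^+ 2 + b ^+ 2 = 1 -> `|(Complex a b : C)| = 1.
Proof. by move=> h; apply/eqP; rewrite -sqrp_eq1 // -add_Re2_Im2 /= h. Qed.

Lemma zdense_circle : zdense (fun z => `|z| = 1).
Proof.
(* Rational parametrization of the circle at integer slopes; the real part is 2/(1+m^2) - 1, which
   determines the natural number m. *)
pose u (m : nat) : C := Complex ((1 - m%:R ^+ 2) / (1 + m%:R ^+ 2)) (2 * m%:R / (1 + m%:R ^+ 2)).
have h (m : nat) : (1 + m%:R ^+ 2 : R) != 0 by rewrite gt_eqF // ltr_pwDl // sqr_ge0.
apply: (@zdense_seq u) => [m1 m2 [e1 e2]|m].
  have k (m : nat) : (1 - m%:R ^+ 2) / (1 + m%:R ^+ 2) = 2 / (1 + m%:R ^+ 2) - 1 :> R.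
    by field; exact: h.
  have two0 : (2 : R) != 0 by rewrite pnatr_eq0.
  have e' : (1 + m1%:R ^+ 2)^-1 = (1 + m2%:R ^+ 2)^-1 :> R.
    by move: e1; rewrite !k => /addIr /(mulfI two0).
  by move/invr_inj/addrI: e'; rewrite -!natrX => /eqP; rewrite eqr_nat eqn_exp2r // => /eqP.
by apply: norm_onecircle; field; exact: h.
Qed.

Lemma zdense_polyP (S : C -> Prop) (p : {poly C}) :
  zdense S -> (forall z, S z -> p.[z] = 0) -> p = 0.
Proof.
move=> dS h; apply/eqP; apply: contraT => /dS[z /h ->]; by rewrite eqxx.
Qed.

Lemma unit_neq0 (z : C) : `|z| = 1 -> z != 0.
Proof. by move=> h; rewrite -normr_eq0 h oner_eq0. Qed.

(* Nothing is asked of h at the roots of q, where inverses take junk values. *)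
Definition ratfun (q : {poly C}) (h : C -> C) :=
  exists P : {poly C}, exists k : nat, forall z, q.[z] != 0 -> h z * q.[z] ^+ k = P.[z].

Lemma ratfunD q h1 h2 : ratfun q h1 -> ratfun q h2 -> ratfun q (fun z => h1 z + h2 z).
Proof.
move=> [P1 [k1 e1]] [P2 [k2 e2]]; exists (P1 * q ^+ k2 + P2 * q ^+ k1), (k1 + k2)%N => z qz.
rewrite hornerD !hornerM !horner_exp -e1 // -e2 // exprD; ring.
Qed.

Lemma ratfunM q h1 h2 : ratfun q h1 -> ratfun q h2 -> ratfun q (fun z => h1 z * h2 z).
Proof.
move=> [P1 [k1 e1]] [P2 [k2 e2]]; exists (P1 * P2), (k1 + k2)%N => z qz.
rewrite hornerM -e1 // -e2 // exprD; ring.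
Qed.

Lemma ratfun_poly q (p : {poly C}) : ratfun q (fun z => p.[z]).
Proof. by exists p, 0%N => z _; rewrite expr0 mulr1. Qed.

Lemma ratfun_c q c : ratfun q (fun=> c).
Proof. by exists c%:P, 0%N => z _; rewrite expr0 mulr1 hornerC. Qed.

Lemma ratfun_id q : ratfun q (fun z => z).
Proof. by exists 'X, 0%N => z _; rewrite expr0 mulr1 hornerX. Qed.

Lemma ratfunV q : ratfun q (fun z => q.[z]^-1).
Proof. by exists 1, 1%N => z qz; rewrite expr1 mulVf // hornerC. Qed.

Lemma eq_ratfun q h1 h2 : (forall z, q.[z] != 0 -> h1 z = h2 z) -> ratfun q h1 -> ratfun q h2.
Proof. by move=> e [P [k h]]; exists P, k => z qz; rewrite -e // h. Qed.

(** Clearing denominators leaves a polynomial that vanishes on [S] minus the finitely many roots of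
    [q], hence everywhere. *)
Lemma ratfun_eq0 q h (S : C -> Prop) : ratfun q h -> zdense S ->
  (forall z, S z -> q.[z] != 0 -> h z = 0) -> forall z, q.[z] != 0 -> h z = 0.
Proof.
move=> [P [k hP]] dS h0 z qz.
have q0 : q != 0 by apply: contraNneq qz => ->; rewrite horner0.
have P0 : P = 0.
  apply: (zdense_polyP (zdense_nroot q0 dS)) => w [Sw qw].
  by rewrite -hP // h0 // mul0r.
apply/eqP; have /eqP := hP z qz; rewrite P0 horner0 mulf_eq0 expf_eq0 (negPf qz) andbF orbF //.
Qed.

End InfiniteSets.

Section MatrixFacts.
Variable R : realType.
Local Notation C := R[i].
Variable n : nat.
Implicit Types A B : 'M[C]_n.

Lemma invmx_eq A B : A *m B = 1%:M -> A \in unitmx /\ invmx A = B.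
Proof.
move=> AB; have [uA _] := mulmx1_unit AB; split=> //.
by rewrite -[invmx A]mulmx1 -AB mulmxA mulVmx // mul1mx.
Qed.

Lemma invmx_mul A B : A \in unitmx -> B \in unitmx -> invmx (A *m B) = invmx B *m invmx A.
Proof.
move=> uA uB; suff /invmx_eq[_ ->] : A *m B *m (invmx B *m invmx A) = 1%:M by [].
by rewrite mulmxA mulmxK // mulmxV.
Qed.

Lemma unitary_unit A : unitary A -> A \in unitmx.
Proof. by case/invmx_eq. Qed.

Lemma unitary_inv A : unitary A -> invmx A = (map_mx Num.conj A)^T.
Proof. by case/invmx_eq. Qed.

Lemma unitary_mul A B : unitary A -> unitary B -> unitary (A *m B).
Proof.
move=> uA uB; rewrite /unitary map_mxM trmx_mul mulmxA -(mulmxA A) uB mulmx1; exact: uA.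
Qed.

Lemma unitary1 : unitary (1%:M : 'M[C]_n).
Proof. by rewrite /unitary map_mx1 trmx1 mulmx1. Qed.

Lemma unitaryV A : unitary A -> unitary (invmx A).
Proof.
move=> uA; rewrite /unitary (unitary_inv uA).
rewrite -map_trmx trmxK -map_mx_comp [X in _ *m X](_ : _ = A); last first.
  by apply/matrixP => i j; rewrite !mxE /= conjCK.
by rewrite -(unitary_inv uA) mulVmx // unitary_unit.
Qed.

Lemma tor_entry (t : 'I_n -> C) i j : tor t i j = t i *+ (i == j).
Proof. by rewrite /tor mxE mxE. Qed.

Lemma mul_tor (s t : 'I_n -> C) : tor s *m tor t = tor (fun i => s i * t i).
Proof. by rewrite /tor mulmx_diag; congr diag_mx; apply/rowP => i; rewrite !mxE. Qed.

Lemma tor1 : tor (fun _ : 'I_n => 1 : C) = 1%:M.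
Proof. by apply/matrixP => i j; rewrite tor_entry mxE. Qed.

Lemma tor_inv (t : 'I_n -> C) : (forall i, t i != 0) ->
  tor t \in unitmx /\ invmx (tor t) = tor (fun i => (t i)^-1).
Proof.
move=> t0; apply: invmx_eq; rewrite mul_tor -tor1; congr tor.
by apply/funext => i; rewrite divff.
Qed.

Lemma tor_unitary (t : 'I_n -> C) : is_torus_elt t -> unitary (tor t).
Proof.
move=> ht; rewrite /unitary.
have -> : (map_mx Num.conj (tor t))^T = tor (fun i => Num.conj (t i)).
  by apply/matrixP => i j; rewrite 2!mxE !tor_entry eq_sym; case: eqP => [->|]; rewrite ?rmorph0.
rewrite mul_tor -tor1; congr tor; apply/funext => i; exact/normc1P.
Qed.

Definition elem (x : C) (p q : 'I_n) : 'M[C]_n := 1%:M + x *: delta_mx p q.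

Lemma elem_mulE x p q A i j : (elem x p q *m A) i j = A i j + (i == p)%:R * x * A q j.
Proof.
rewrite /elem mulmxDl mul1mx -scalemxAl !mxE; congr (_ + _).
rewrite (bigD1 q) //= big1 ?addr0 => [|l /negPf lq]; rewrite mxE ?eqxx ?lq ?andbF ?mul0r //.
by rewrite andbT; ring.
Qed.

Lemma mul_elemE x p q A i j : (A *m elem x p q) i j = A i j + A i p * x * (j == q)%:R.
Proof.
rewrite /elem mulmxDr mulmx1 -scalemxAr !mxE; congr (_ + _).
rewrite (bigD1 p) //= big1 ?addr0 => [|l /negPf lp]; rewrite mxE ?eqxx ?lp ?mulr0 //=.
by ring.
Qed.

Lemma elemK x p q : p != q -> elem x p q *m elem (- x) p q = 1%:M.
Proof.
move=> /negPf pq; apply/matrixP => i j; rewrite elem_mulE /elem !mxE.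
rewrite [q == p]eq_sym pq andFb mulr0 addr0.
rewrite [q == j]eq_sym; case: (i == p) => /=; ring.
Qed.

Lemma elem_inv x p q : p != q -> elem x p q \in unitmx /\ invmx (elem x p q) = elem (- x) p q.
Proof. by move=> /(elemK x)/invmx_eq. Qed.

End MatrixFacts.

(** * Regular functions on GL_n and their restriction to rational curves *)

Section RegularFunctions.
Variable R : realType.
Local Notation C := R[i].

(* Regular functions on GL_n: by regular_ext, values at singular matrices are irrelevant. *)
Inductive regular n : ('M[C]_n -> C) -> Prop :=
| regular_c c : regular (fun=> c)
| regular_entry i j : regular (fun A => A i j)
| regular_inv i j : regular (fun A => invmx A i j)
| regularD F G : regular F -> regular G -> regular (fun A => F A + G A)
| regularM F G : regular F -> regular G -> regular (fun A => F A * G A)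
| regular_ext F G : (forall A, A \in unitmx -> F A = G A) -> regular F -> regular G.

Variable n : nat.
Implicit Types (A B : 'M[C]_n) (F G : 'M[C]_n -> C).

Lemma regularZ c F : regular F -> regular (fun A => c * F A).
Proof. by move=> rF; apply: regularM => //; apply: regular_c. Qed.

Lemma regularB F G : regular F -> regular G -> regular (fun A => F A - G A).
Proof.
move=> rF rG; apply: regularD => //.
apply: (@regular_ext _ (fun A => -1 * G A)) => [A _|]; first by rewrite mulN1r.
exact: regularZ.
Qed.

Lemma regular_sum (I : Type) (r : seq I) (P : pred I) (F : I -> 'M[C]_n -> C) :
  (forall i, P i -> regular (F i)) -> regular (fun A => \sum_(i <- r | P i) F i A).
Proof.
move=> rF; elim: r => [|i r IH].
  by apply: regular_ext (regular_c n 0) => A _; rewrite big_nil.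
have [Pi|/negPf Pi] := boolP (P i).
  by apply: regular_ext (regularD (rF i Pi) IH) => A _; rewrite big_cons Pi.
by apply: regular_ext IH => A _; rewrite big_cons Pi.
Qed.

Lemma regular_prod (I : Type) (r : seq I) (P : pred I) (F : I -> 'M[C]_n -> C) :
  (forall i, P i -> regular (F i)) -> regular (fun A => \prod_(i <- r | P i) F i A).
Proof.
move=> rF; elim: r => [|i r IH].
  by apply: regular_ext (regular_c n 1) => A _; rewrite big_nil.
have [Pi|/negPf Pi] := boolP (P i).
  by apply: regular_ext (regularM (rF i Pi) IH) => A _; rewrite big_cons Pi.
by apply: regular_ext IH => A _; rewrite big_cons Pi.
Qed.

Lemma regularX k F : regular F -> regular (fun A => F A ^+ k).
Proof.
move=> rF; elim: k => [|k IH].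
  by apply: regular_ext (regular_c n 1) => A _; rewrite expr0.
by apply: regular_ext (regularM rF IH) => A _; rewrite exprS.
Qed.

Lemma regular_lmul B F : B \in unitmx -> regular F -> regular (fun A => F (B *m A)).
Proof.
move=> uB; elim=> {F} [c|i j|i j|F G _ IF _ IG|F G _ IF _ IG|F G e _ IF].
- exact: regular_c.
- apply: (@regular_ext _ (fun A => \sum_k B i k * A k j)) => [A _|]; first by rewrite mxE.
  by apply: regular_sum => k _; apply: regularZ; apply: regular_entry.
- apply: (@regular_ext _ (fun A => \sum_k invmx B k j * invmx A i k)) => [A uA|].
    by rewrite invmx_mul // mxE; apply: eq_bigr => k _; rewrite mulrC.
  by apply: regular_sum => k _; apply: regularZ; apply: regular_inv.
- exact: regularD.
- exact: regularM.
- by apply: regular_ext IF => A uA; apply: e; rewrite unitmx_mul uB.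
Qed.

Lemma regular_rmul B F : B \in unitmx -> regular F -> regular (fun A => F (A *m B)).
Proof.
move=> uB; elim=> {F} [c|i j|i j|F G _ IF _ IG|F G _ IF _ IG|F G e _ IF].
- exact: regular_c.
- apply: (@regular_ext _ (fun A => \sum_k B k j * A i k)) => [A _|].
    by rewrite mxE; apply: eq_bigr => k _; rewrite mulrC.
  by apply: regular_sum => k _; apply: regularZ; apply: regular_entry.
- apply: (@regular_ext _ (fun A => \sum_k invmx B i k * invmx A k j)) => [A uA|].
    by rewrite invmx_mul // mxE.
  by apply: regular_sum => k _; apply: regularZ; apply: regular_inv.
- exact: regularD.
- exact: regularM.
- by apply: regular_ext IF => A uA; apply: e; rewrite unitmx_mul uA.
Qed.

(** Comultiplication of the coordinate ring of GL_n. Separating the variables lets one factor of a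
    product leave an integral over the other. *)
Lemma regular_split F : regular F -> exists (I : finType) (P Q : I -> 'M[C]_n -> C),
  [/\ forall i, regular (P i), forall i, regular (Q i) &
   forall A B, A \in unitmx -> B \in unitmx -> F (A *m B) = \sum_i P i A * Q i B].
Proof.
elim=> {F} [c|i j|i j|F G _ [I [P [Q [rP rQ e]]]] _ [J [P' [Q' [rP' rQ' e']]]]
  |F G _ [I [P [Q [rP rQ e]]]] _ [J [P' [Q' [rP' rQ' e']]]]|F G e _ [I [P [Q [rP rQ e']]]]].
- exists unit, (fun _ _ => c), (fun _ _ => 1); split=> [i|i|A B _ _]; try exact: regular_c.
  by rewrite big_const card_unit /= addr0 mulr1.
- exists 'I_n, (fun k A => A i k), (fun k A => A k j).
  split=> [k|k|A B _ _]; try exact: regular_entry.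
  by rewrite mxE.
- exists 'I_n, (fun k A => invmx A k j), (fun k A => invmx A i k).
  split=> [k|k|A B uA uB]; try exact: regular_inv.
  by rewrite invmx_mul // mxE; apply: eq_bigr => k _; rewrite mulrC.
- exists (I + J)%type, (fun k => match k with inl i => P i | inr j => P' j end),
    (fun k => match k with inl i => Q i | inr j => Q' j end).
  split=> [[]|[]|A B uA uB] //=.
  by rewrite big_sumType /= e // e'.
- exists (I * J)%type, (fun k A => P k.1 A * P' k.2 A), (fun k A => Q k.1 A * Q' k.2 A).
  split=> [[i j]|[i j]|A B uA uB] /=; [exact: regularM|exact: regularM|].
  rewrite e // e' // big_distrlr /= pair_big /=; apply: eq_bigr => -[i j] _ /=; ring.
- by exists I, P, Q; split=> // A B uA uB; rewrite -e ?e' // unitmx_mul uA.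
Qed.

(** A rational map from the line minus the roots of [q] to GL_n. The entries of the inverse are
    included because they are generators of [regular]. *)
Definition ratcurve (q : {poly C}) (a : C -> 'M[C]_n) :=
  [/\ forall z, q.[z] != 0 -> a z \in unitmx,
      forall i j, ratfun q (fun z => a z i j) &
      forall i j, ratfun q (fun z => invmx (a z) i j)].

Lemma ratcurveP q (a b : C -> 'M[C]_n) :
  (forall z, q.[z] != 0 -> a z *m b z = 1%:M) ->
  (forall i j, ratfun q (fun z => a z i j)) ->
  (forall i j, ratfun q (fun z => b z i j)) -> ratcurve q a.
Proof.
move=> ab ra rb; split=> // [z /ab /invmx_eq[]//|i j].
by apply: eq_ratfun (rb i j) => z /ab /invmx_eq[_ ->].
Qed.

Lemma regular_curve q a F : ratcurve q a -> regular F -> ratfun q (fun z => F (a z)).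
Proof.
move=> [ua ra ri]; elim=> {F} [c|i j|i j|F G _ IF _ IG|F G _ IF _ IG|F G e _ IF].
- exact: ratfun_c.
- exact: ra.
- exact: ri.
- exact: ratfunD.
- exact: ratfunM.
- by apply: eq_ratfun IF => z qz; apply: e; apply: ua.
Qed.

(** Along a rational curve a regular function is a fraction of polynomials in the parameter, so
    infinitely many zeros suffice. The curve is then evaluated at a parameter outside the set where
    vanishing was known. *)
Lemma curve_eq0 q a F (S : C -> Prop) : ratcurve q a -> regular F -> zdense S ->
  (forall z, S z -> q.[z] != 0 -> F (a z) = 0) -> forall z, q.[z] != 0 -> F (a z) = 0.
Proof. by move=> ca rF; apply: ratfun_eq0; apply: regular_curve. Qed.

End RegularFunctions.

(** * Density of the torus, and Gaussian elimination *)

Section ZariskiDensity.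
Variable R : realType.
Local Notation C := R[i].
Variable n : nat.
Implicit Types (A B : 'M[C]_n) (F G : 'M[C]_n -> C).

Lemma torus_dense F (t : 'I_n -> C) : regular F ->
  (forall s, is_torus_elt s -> F (tor s) = 0) -> (forall i, t i != 0) -> F (tor t) = 0.
Proof.
(* The first [m] coordinates range over nonzero scalars, the others over the circle; each step of
   the induction frees one coordinate. *)
move=> rF F0; suff H m : forall t : 'I_n -> C, (forall i, t i != 0) ->
    (forall i : 'I_n, (m <= i)%N -> `|t i| = 1) -> F (tor t) = 0.
  by move=> t0; apply: (H n) => // i; rewrite leqNgt ltn_ord.
elim: m => [|m IH] {}t t0 t1; first by apply: F0 => i; apply: t1.
have [mn|nm] := ltnP m n; last first.
  by apply: IH => // i mi; have := leq_trans (ltn_ord i) (leq_trans nm mi); rewrite ltnn.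
pose o := Ordinal mn.
pose s (z : C) i := if i == o then z else t i.
have se : s (t o) = t by apply/funext => i; rewrite /s; case: eqP => [->|].
suff: F (tor (s (t o))) = 0 by rewrite se.
apply: (@curve_eq0 _ _ 'X (fun z => tor (s z)) F _ _ rF (@zdense_circle R)).
- apply: (@ratcurveP _ _ _ _ (fun z => tor (fun i => (s z i)^-1))).
  + move=> z; rewrite hornerX => z0; rewrite mul_tor -tor1; congr tor.
    by apply/funext => i; rewrite divff // /s; case: ifP.
  + move=> i j; apply: (@eq_ratfun _ _ (fun z => (s z i) *+ (i == j))) => [z _|].
      by rewrite tor_entry.
    rewrite /s; case: (i == j); last exact: ratfun_c.
    by case: eqP => _; [apply: ratfun_id|apply: ratfun_c].
  + move=> i j; apply: (@eq_ratfun _ _ (fun z => (s z i)^-1 *+ (i == j))) => [z _|].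
      by rewrite tor_entry.
    rewrite /s; case: (i == j); last exact: ratfun_c.
    case: eqP => _; last exact: ratfun_c.
    by apply: eq_ratfun (ratfunV _) => z _; rewrite hornerX.
- move=> z z1; rewrite hornerX => z0; apply: IH => i; rewrite /s; have [//|io] := eqVneq i o; rewrite ?t0 // => mi.
  apply: t1; case: (ltngtP m i) mi => // e _.
  by case/eqP: io; apply: val_inj.
- by rewrite hornerX.
Qed.

Lemma diag_tor A : (forall i j, i != j -> A i j = 0) -> A = tor (fun i => A i i).
Proof.
move=> h; apply/matrixP => i j; rewrite tor_entry; case: eqP => [->|/eqP/h->] //.
Qed.

Lemma tor_unit_neq0 (t : 'I_n -> C) : tor t \in unitmx -> forall i, t i != 0.
Proof.
rewrite unitmxE /tor det_diag unitfE => /prodf_neq0 h i.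
by have := h i isT; rewrite mxE.
Qed.

(** A family instead of one function: when a function vanishes on a group its translates must be
    tested too, so the property carried along the elimination concerns all of [FF] at once. Lower
    transvections act on the left and upper ones on the right, in accordance with N^- T N. *)
Variable FF : ('M[C]_n -> C) -> Prop.
Hypothesis rFF : forall F, FF F -> regular F.
Let P A := forall F, FF F -> F A = 0.
Hypothesis Plow : forall A (p q : 'I_n) x, A \in unitmx -> (q < p)%N ->
  P (elem x p q *m A) -> P A.
Hypothesis Pup : forall A (p q : 'I_n) x, A \in unitmx -> (p < q)%N ->
  P (A *m elem x p q) -> P A.
Hypothesis Pdiag : forall t : 'I_n -> C, (forall i, t i != 0) -> P (tor t).

Let reduced r A := forall i j : 'I_n, i != j -> (i < r)%N || (j < r)%N -> A i j = 0.

(** Induction on a list [s] of the columns where the pivot row may still be nonzero. Adding a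
    multiple of column [r] changes only an entry of row [r], because the rest of column [r] is
    already zero. *)
Let clear_row (r : 'I_n) :
  (forall A, A \in unitmx -> reduced r.+1 A -> P A) ->
  forall (s : seq 'I_n) A, A \in unitmx -> reduced r A -> A r r != 0 ->
    (forall p : 'I_n, (r < p)%N -> A p r = 0) ->
    (forall q : 'I_n, (r < q)%N -> A r q != 0 -> q \in s) -> P A.
Proof.
move=> IH; elim=> [|q s IHs] A uA dA Arr cA hs.
  apply: IH => // i j ij; rewrite !ltnS (leq_eqVlt i) (leq_eqVlt j).
  have [/eqP/val_inj ir|ir] := boolP (val i == val r); last have [/eqP/val_inj jr|jr] := boolP (val j == val r).
  - move: ij; rewrite ir => rj _; case: (ltngtP j r) => [jr|jr|/val_inj e].
    + by apply: dA => //; rewrite jr orbT.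
    + by apply/eqP; apply: contraT => /(hs _ jr); rewrite in_nil.
    + by rewrite e eqxx in rj.
  - move: ij; rewrite jr => ir' _; case: (ltngtP i r) => [ii|ii|/val_inj e].
    + by apply: dA => //; rewrite ii.
    + exact: cA.
    + by rewrite e eqxx in ir'.
  - by rewrite !orFb; apply: dA.
have [rq|qr] := ltnP r q; last first.
  apply: IHs => // p rp /(hs _ rp); rewrite in_cons => /orP[/eqP pq|//].
  by rewrite pq ltnNge qr in rp.
have rq' : r != q by apply: contraTneq rq => ->; rewrite ltnn.
apply: (@Pup A r q (- A r q / A r r) uA rq); apply: IHs.
- by rewrite unitmx_mul uA (elem_inv _ rq').1.
- move=> i j ij h; rewrite mul_elemE dA // add0r.
  have [jq|] := eqVneq j q; rewrite ?mulr0 //.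
  move: h; rewrite jq => /orP[ir|qr]; last by rewrite ltnNge ltnW in qr.
  have ir' : i != r by apply: contraTneq ir => ->; rewrite ltnn.
  by rewrite (dA _ _ ir') ?mul0r ?ir.
- by rewrite mul_elemE (negPf rq') mulr0 addr0.
- by move=> p rp; rewrite mul_elemE (negPf rq') mulr0 addr0 cA.
- move=> p rp; rewrite mul_elemE; have [->|pq] := eqVneq p q.
    by rewrite mulr1 mulrCA divff // mulr1 subrr eqxx.
  by rewrite mulr0 addr0 => /(hs _ rp); rewrite in_cons (negPf pq).
Qed.

(** The same scheme for the rows below the pivot, with left transvections. The column is cleared
    before the row, since [clear_row] relies on a clean column. *)
Let clear_col (r : 'I_n) :
  (forall A, A \in unitmx -> reduced r.+1 A -> P A) ->
  forall (s : seq 'I_n) A, A \in unitmx -> reduced r A -> A r r != 0 ->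
    (forall p : 'I_n, (r < p)%N -> A p r != 0 -> p \in s) -> P A.
Proof.
move=> IH; elim=> [|p s IHs] A uA dA Arr hs.
  apply: (@clear_row r IH (enum 'I_n)) => // [p rp|q _ _]; last by rewrite mem_enum.
  by apply/eqP; apply: contraT => /(hs _ rp).
have [rp|pr] := ltnP r p; last first.
  apply: IHs => // q rq /(hs _ rq); rewrite in_cons => /orP[/eqP pq|//].
  by rewrite pq ltnNge pr in rq.
have rp' : r != p by apply: contraTneq rp => ->; rewrite ltnn.
have pr' : p != r by rewrite eq_sym.
apply: (@Plow A p r (- A p r / A r r) uA rp); apply: IHs.
- by rewrite unitmx_mul uA (elem_inv _ pr').1.
- move=> i j ij h; rewrite elem_mulE dA // add0r.
  have [ip|] := eqVneq i p; rewrite ?mul0r //.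
  move: h; rewrite ip => /orP[pr|jr]; first by rewrite ltnNge ltnW in pr.
  have rj : r != j by apply: contraTneq jr => ->; rewrite ltnn.
  by rewrite (dA _ _ rj) ?mulr0 ?jr ?orbT.
- by rewrite elem_mulE (negPf rp') !mul0r addr0.
- move=> q rq; rewrite elem_mulE; have [->|qp] := eqVneq q p.
    by rewrite mul1r divfK // subrr eqxx.
  by rewrite !mul0r addr0 => /(hs _ rq); rewrite in_cons (negPf qp).
Qed.

(* The pivot A r r is made nonzero by moving along the line A + z E_rr. *)
Lemma gauss_dense A : A \in unitmx -> P A.
Proof.
suff H m : forall r A, (n - r <= m)%N -> A \in unitmx -> reduced r A -> P A.
  by move=> uA; apply: (H n 0%N) => //; rewrite subn0.
elim: m => [|m IH] r {}A.
  rewrite leqn0 subn_eq0 => nr uA dA.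
  have e : A = tor (fun i => A i i).
    by apply: diag_tor => i j ij; apply: dA => //; rewrite (leq_trans (ltn_ord i) nr).
  by rewrite e; apply: Pdiag; apply: tor_unit_neq0; rewrite -e.
have [rn|nr] := ltnP r n; last by move=> _; apply: IH; rewrite (eqP nr).
move=> hm uA dA.
pose o := Ordinal rn.
have IH' B : B \in unitmx -> reduced o.+1 B -> P B.
  by apply: IH; rewrite /= subnS; case: (n - r)%N hm.
pose a z := A + z *: delta_mx o o.
(* The line is lifted to a matrix of polynomials: its determinant [q] is the common denominator
   along the curve, and its adjugate gives the inverse. *)
pose ap : 'M[{poly C}]_n := map_mx polyC A + 'X *: delta_mx o o.
have ape z : map_mx (horner_eval z) ap = a z.
  apply/matrixP => i j; rewrite !mxE /horner_eval hornerD hornerC hornerM hornerX.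
  by case: (_ && _); rewrite hornerE.
pose q := \det ap.
have qE z : q.[z] = \det (a z) by rewrite -ape det_map_mx.
move=> F FF_F; rewrite (_ : A = a 0); last by rewrite /a scale0r addr0.
apply: (@curve_eq0 _ _ q a F (fun z => True /\ (A o o)%:P.[z] + 'X.[z] != 0)).
- split=> [z|i j|i j].
  + by rewrite qE -unitfE -unitmxE.
  + apply: eq_ratfun (ratfun_poly q (ap i j)) => z _.
    by rewrite -ape [RHS]mxE.
  + apply: (@eq_ratfun _ _ (fun z => q.[z]^-1 * (\adj ap i j).[z])) => [z|].
      rewrite qE -unitfE -unitmxE => uaz.
      by rewrite /invmx uaz [RHS]mxE; congr (_ * _); rewrite -ape -map_mx_adj [RHS]mxE.
    by apply: ratfunM; [apply: ratfunV|apply: ratfun_poly].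
- exact: rFF.
- apply: (zdense_sub _ (@zdense_nroot _ _ ('X + (A o o)%:P) _ (@zdense_setT R))).
    by move=> z [_]; rewrite hornerD addrC.
  by rewrite -size_poly_eq0 size_XaddC.
- move=> z [_ nz]; rewrite qE -unitfE -unitmxE => uaz.
  have {}nz : a z o o != 0 by move: nz; rewrite hornerC hornerX !mxE !eqxx mulr1.
  apply: (@clear_col o IH' (enum 'I_n) (a z)) => // [i j ij h|p _ _]; last by rewrite mem_enum.
  rewrite !mxE dA // add0r; case: eqP => [io|]; rewrite ?mulr0 //.
  case: eqP => [jo|]; rewrite ?mulr0 //.
  by rewrite io jo eqxx in ij.
- by rewrite qE /a scale0r addr0 -unitfE -unitmxE.
Qed.

End ZariskiDensity.

(** * Zariski closure of the unitary group *)

Section UnitaryDensity.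
Variable R : realType.
Local Notation C := R[i].
Variable n : nat.
Implicit Types (A B : 'M[C]_n) (F G : 'M[C]_n -> C).

Definition zclosure A := forall F, regular F /\ (forall U, unitary U -> F U = 0) -> F A = 0.

(** The closure of a group is a group: with a unitary matrix on the left the right factor goes from
    unitary matrices to [B]; then, with [B] fixed, the left factor goes to [A]. *)
Lemma zclosureM A B : A \in unitmx -> B \in unitmx -> zclosure A -> zclosure B -> zclosure (A *m B).
Proof.
move=> uA uB zA zB F [rF F0]; apply: (zA (fun X => F (X *m B))); split.
  exact: regular_rmul.
move=> U uU; apply: (zB (fun X => F (U *m X))); split.
  by apply: regular_lmul => //; apply: unitary_unit.
by move=> V uV; apply: F0; apply: unitary_mul.
Qed.

(** For p != q, the matrix ((1+al, be), (ga, 1+al)) on the coordinates [p], [q], and the identity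
    elsewhere. Equal diagonal entries and determinant 1 make the inverse a mere change of sign of
    [be] and [ga]. *)
Definition plane (p q : 'I_n) (al be ga : C) : 'M[C]_n :=
  1%:M + al *: (delta_mx p p + delta_mx q q) + (be *: delta_mx p q + ga *: delta_mx q p).

Lemma plane_mulK p q al be ga : p != q -> (1 + al) ^+ 2 - be * ga = 1 ->
  plane p q al be ga *m plane p q al (- be) (- ga) = 1%:M.
Proof.
move=> /negPf pq e; have qp : q == p = false by rewrite eq_sym.
rewrite /plane; set Q := delta_mx p p + delta_mx q q.
have -> : (- be) *: delta_mx p q + (- ga) *: delta_mx q p =
  - (be *: delta_mx p q + ga *: delta_mx q p) :> 'M[C]_n by rewrite !scaleNr opprD.
set X := be *: _ + _; set Y := 1%:M + al *: Q.
have QX : Q *m X = X.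
  by rewrite /Q /X mulmxDl !mulmxDr -!scalemxAr !mul_delta_mx_cond pq qp !eqxx !mulr0n !scaler0
    addr0 add0r.
have XQ : X *m Q = X.
  by rewrite /Q /X mulmxDl !mulmxDr -!scalemxAl !mul_delta_mx_cond pq qp !eqxx !mulr0n !scaler0
    addr0 add0r.
have XX : X *m X = (be * ga) *: Q.
  rewrite /Q /X mulmxDl !mulmxDr -!scalemxAl -!scalemxAr !mul_delta_mx_cond pq qp !eqxx !mulr0n
    !scaler0 addr0 add0r !scalerA scalerDr; congr (_ + _ *: _); exact: mulrC.
have QQ : Q *m Q = Q.
  by rewrite /Q mulmxDl !mulmxDr !mul_delta_mx_cond pq qp !eqxx !mulr0n addr0 add0r.
have YX : Y *m X = X *m Y.
  by rewrite /Y mulmxDl mulmxDr mul1mx mulmx1 -scalemxAl -scalemxAr QX XQ.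
rewrite (mulmxDl Y X) (mulmxDr Y Y) (mulmxDr X Y) !mulmxN YX XX.
have -> : Y *m Y = 1%:M + (2 * al + al ^+ 2) *: Q.
  rewrite /Y mulmxDl mul1mx mulmxDr mulmx1 -scalemxAl -scalemxAr QQ -addrA; congr (_ + _).
  by rewrite addrA -scalerDl scalerA -scalerDl; congr (_ *: _); ring.
rewrite addrA subrK -addrA -scalerBl (_ : _ - _ = 0) ?scale0r ?addr0 //.
by rewrite -(subrr (1 : C)) -[X in _ = X - _]e; ring.
Qed.

Lemma plane_unitary p q al be ga : p != q -> (1 + al) ^+ 2 - be * ga = 1 ->
  Num.conj al = al -> Num.conj ga = - be -> unitary (plane p q al be ga).
Proof.
move=> pq e ca cg; rewrite /unitary -[RHS](plane_mulK pq e); congr (_ *m _).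
have cb : Num.conj be = - ga by rewrite -[ga]conjCK cg rmorphN opprK.
apply/matrixP => i j; rewrite !mxE !(rmorphD, rmorphM) /= ca cg cb.
by rewrite !rmorph_nat [j == i]eq_sym !(andbC (j == _)); ring.
Qed.

Lemma ratfun_plane (r : {poly C}) p q (al be ga : C -> C) i j :
  ratfun r al -> ratfun r be -> ratfun r ga -> ratfun r (fun z => plane p q (al z) (be z) (ga z) i j).
Proof.
move=> ra rb rg.
apply: (@eq_ratfun _ _ (fun z => ((1%:M : 'M[C]_n) i j + al z * ((delta_mx p p + delta_mx q q : 'M[C]_n) i j)) +
  (be z * ((delta_mx p q : 'M[C]_n) i j) + ga z * ((delta_mx q p : 'M[C]_n) i j)))) => [z _|].
  by rewrite !mxE.
by do ![apply: ratfunD|apply: ratfunM|apply: ratfun_c].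
Qed.

(* Complexify tau, the tangent of half the angle of a rotation, then let the rotation
   degenerate to a transvection. *)
Lemma zclosure_elem x p q : p != q -> zclosure (elem x p q).
Proof.
move=> pq.
(* [y] is a phase put on the off-diagonal entries of the rotation; it stays on the circle here and
   is tied to the curve parameter below. *)
have step1 y (tau : C) : `|y| = 1 -> 1 + tau ^+ 2 != 0 ->
    zclosure (plane p q (- 2 * tau ^+ 2 / (1 + tau ^+ 2)) (- 2 * tau * y / (1 + tau ^+ 2))
      (2 * tau / y / (1 + tau ^+ 2))).
  move=> y1 tn F FF; pose r : {poly C} := 1 + 'X ^+ 2.
  have y0 := unit_neq0 y1.
  have rE z : r.[z] = 1 + z ^+ 2 by rewrite /r hornerD hornerC horner_exp hornerX.
  pose al z := - 2 * z ^+ 2 * r.[z]^-1; pose be z := - 2 * z * y * r.[z]^-1.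
  pose ga z := 2 * z * y^-1 * r.[z]^-1.
  have e z : r.[z] != 0 -> (1 + al z) ^+ 2 - be z * ga z = 1.
    by rewrite /al /be /ga rE => h; field; rewrite h.
  have ra : ratfun r al.
    rewrite /al; do ![exact: ratfunV|exact: ratfun_c|apply: ratfunM|exact: ratfun_id].
  have rb : ratfun r be.
    rewrite /be; do ![exact: ratfunV|exact: ratfun_c|apply: ratfunM|exact: ratfun_id].
  have rg : ratfun r ga.
    rewrite /ga; do ![exact: ratfunV|exact: ratfun_c|apply: ratfunM|exact: ratfun_id].
  have rN h : ratfun r h -> ratfun r (fun z => - h z).
    move=> rh; apply: (@eq_ratfun _ _ (fun z => -1 * h z)) => [z _|]; first by rewrite mulN1r.
    by apply: ratfunM => //; apply: ratfun_c.
  have := @curve_eq0 _ _ r (fun z => plane p q (al z) (be z) (ga z)) F _ _ FF.1 (@zdense_real R) _ tau.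
  rewrite /al /be /ga rE; apply => //.
    apply: (@ratcurveP _ _ _ _ (fun z => plane p q (al z) (- be z) (- ga z))) => [z rz|i j|i j].
    - by apply: plane_mulK => //; apply: e; rewrite rE in rz *.
    - exact: (@ratfun_plane _ _ _ al be ga).
    - by apply: (@ratfun_plane _ _ _ al (fun z => - be z) (fun z => - ga z)) => //; apply: rN.
  move=> _ [t ->] rt; have tr : t%:C%C \is @Num.real C by rewrite complex_real.
  apply: FF.2; apply: plane_unitary => //.
  - exact: (e _ rt).
  - apply: conj_Creal; apply: rpredM; last by rewrite rpredV rE rpredD ?rpredX ?rpred1.
    by rewrite rpredM ?rpredX ?rpredN ?realn //.
  - have cy : Num.conj y^-1 = y.
      have /normc1P h := y1; rewrite fmorphV; apply: (mulIf (x := Num.conj y)).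
        by rewrite conjC_eq0.
      by rewrite h mulVf // conjC_eq0.
    have -> : 2 * t%:C%C / y / r.[t%:C%C] = (2 * t%:C%C / r.[t%:C%C]) * y^-1 by ring.
    have cM (u v : C) : Num.conj (u * v) = Num.conj u * Num.conj v by exact: rmorphM.
    rewrite cM cy conj_Creal; first by ring.
    by rewrite rpredM ?rpredV ?rE ?rpredD ?rpredX ?rpredM ?rpred1 ?realn //.
(* On the circle, the next curve is [step1] with [y] = 1/z and [tau] = [sg] z: the numerator of
   entry (p, q) becomes -2 [sg], free of z, and that of entry (q, p) becomes 2 [sg] z^2. At z = 0
   only -2 [sg] survives off the diagonal, which must be x. *)
move=> F FF; have [sg sgE] : exists sg, x = - 2 * sg by exists (- x / 2); field.
pose r : {poly C} := 1 + (sg ^+ 2) *: 'X ^+ 2.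
have rE z : r.[z] = 1 + sg ^+ 2 * z ^+ 2.
  by rewrite /r hornerD hornerC hornerZ horner_exp hornerX.
pose al z := - 2 * sg ^+ 2 * z ^+ 2 * r.[z]^-1; pose be z := - 2 * sg * r.[z]^-1.
pose ga z := 2 * sg * z ^+ 2 * r.[z]^-1.
have e z : r.[z] != 0 -> (1 + al z) ^+ 2 - be z * ga z = 1.
  by rewrite /al /be /ga rE => h; field; apply: contra h => /eqP h; apply/eqP; rewrite -[RHS]h; ring.
have ra : ratfun r al.
  rewrite /al; do ![exact: ratfunV|exact: ratfun_c|apply: ratfunM|exact: ratfun_id].
have rb : ratfun r be.
  rewrite /be; do ![exact: ratfunV|exact: ratfun_c|apply: ratfunM|exact: ratfun_id].
have rg : ratfun r ga.
  rewrite /ga; do ![exact: ratfunV|exact: ratfun_c|apply: ratfunM|exact: ratfun_id].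
have rN h : ratfun r h -> ratfun r (fun z => - h z).
  move=> rh; apply: (@eq_ratfun _ _ (fun z => -1 * h z)) => [z _|]; first by rewrite mulN1r.
  by apply: ratfunM => //; apply: ratfun_c.
have -> : elem x p q = plane p q (al 0) (be 0) (ga 0).
  have r0 : r.[0] = 1 by rewrite rE expr0n mulr0 addr0.
  have -> : al 0 = 0 by rewrite /al expr0n mulr0 mul0r.
  have -> : ga 0 = 0 by rewrite /ga expr0n mulr0 mul0r.
  by rewrite /elem /plane /be r0 invr1 mulr1 -sgE !scale0r !addr0.
have := @curve_eq0 _ _ r (fun z => plane p q (al z) (be z) (ga z)) F _ _ FF.1 (@zdense_circle R) _ 0.
apply.
- apply: (@ratcurveP _ _ _ _ (fun z => plane p q (al z) (- be z) (- ga z))) => [z rz|i j|i j].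
  + by apply: plane_mulK => //; apply: e.
  + exact: (@ratfun_plane _ _ _ al be ga).
  + by apply: (@ratfun_plane _ _ _ al (fun z => - be z) (fun z => - ga z)) => //; apply: rN.
- move=> z z1 rz; have z0 := unit_neq0 z1.
  have zV1 : `|z^-1| = 1 by rewrite normfV z1 invr1.
  have := @step1 z^-1 (sg * z) zV1 _ F FF; rewrite exprMn -rE => /(_ rz) <-; congr (F (plane _ _ _ _ _)).
  + by rewrite /al; ring.
  + by rewrite /be -!mulrA; congr (_ * (_ * _)); rewrite mulrA divff // mul1r.
  + by rewrite /ga invrK; ring.
- by rewrite rE expr0n mulr0 addr0 oner_eq0.
Qed.

Lemma elem_unit (x : C) (p q : 'I_n) : p != q -> elem x p q \in unitmx.
Proof. by move/(elem_inv x)=> []. Qed.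

(** An algebraic form of Weyl's unitary trick: elimination reduces an invertible matrix to a
    diagonal one, and transvections and invertible diagonal matrices lie in the closure. *)
Theorem unitary_dense F : regular F -> (forall U, unitary U -> F U = 0) ->
  forall A, A \in unitmx -> F A = 0.
Proof.
move=> rF F0 A uA; suff: zclosure A by apply.
move: A uA {F rF F0}; apply: gauss_dense.
- by move=> F [].
- move=> A p q x uA qp zA.
  have pq : p != q by apply: contraTneq qp => ->; rewrite ltnn.
  suff -> : A = elem (- x) p q *m (elem x p q *m A).
    apply: zclosureM => //; [exact: elem_unit| |exact: zclosure_elem].
    by rewrite unitmx_mul elem_unit.
  have := elemK (- x) pq; rewrite opprK => e.
  by rewrite mulmxA e mul1mx.
- move=> A p q x uA qp zA.
  have pq : p != q by apply: contraTneq qp => ->; rewrite ltnn.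
  suff -> : A = (A *m elem x p q) *m elem (- x) p q.
    apply: zclosureM => //; [ |exact: elem_unit|exact: zclosure_elem].
    by rewrite unitmx_mul elem_unit // uA.
  by rewrite -mulmxA elemK // mulmx1.
- move=> t t0 F [rF F0]; apply: torus_dense => // s hs; apply: F0; exact: tor_unitary.
Qed.

End UnitaryDensity.

(** * Symmetric powers *)

Section Words.
Variables n k : nat.
Implicit Types (f g : msetk n k) (t s : k.-tuple 'I_n).

Lemma count_mem_card (i : 'I_n) t : count_mem i t = #|[pred p | tnth t p == i]|.
Proof. by rewrite -sum1_card -sum1_count big_tuple. Qed.

Lemma sum_count_mem t : (\sum_i count_mem i t)%N = k.
Proof.
rewrite -[RHS]card_ord -sum1_card (partition_big (tnth t) xpredT) //=; apply: eq_bigr => i _.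
by rewrite count_mem_card -sum1_card; apply: eq_bigl => p; rewrite !inE.
Qed.

Lemma count_mem_lt (i : 'I_n) t : (count_mem i t < k.+1)%N.
Proof. by rewrite ltnS -{2}(size_tuple t) count_size. Qed.

Fact content_subproof t :
  (\sum_i ([ffun i => Ordinal (count_mem_lt i t)] i : nat) == k)%N.
Proof.
by apply/eqP; rewrite -[RHS](sum_count_mem t); apply: eq_bigr => i _; rewrite ffunE.
Qed.

Definition content t : msetk n k :=
  exist (fun f : {ffun 'I_n -> 'I_k.+1} => \sum_i (f i : nat) == k) _ (content_subproof t).

Lemma contentE t i : val (content t) i = count_mem i t :> nat.
Proof. by rewrite /= ffunE. Qed.

Lemma tcontentE t f : tcontent t f = (content t == f).
Proof.
apply/forallP/eqP => [h|<- i]; last by rewrite contentE.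
apply: val_inj; apply/ffunP => i; apply: val_inj.
apply: (etrans (contentE t i)); exact/esym/eqP/h.
Qed.

Lemma msetk_eqP f g : (forall i, val f i = val g i :> nat) -> f = g.
Proof. by move=> h; apply: val_inj; apply/ffunP => i; apply: val_inj; apply: h. Qed.

Lemma msetk_sum f : (\sum_i (val f i : nat))%N = k.
Proof. by case: f => f /= /eqP. Qed.

Lemma content_surj f : exists t, content t = f.
Proof.
pose s := flatten [seq nseq (val f i) i | i <- enum 'I_n].
have ss : size s == k.
  rewrite size_flatten /shape -map_comp sumnE big_map big_enum /= -[X in _ == X](msetk_sum f).
  by apply/eqP/eq_bigr => i _ /=; rewrite size_nseq.
exists (Tuple ss); apply: msetk_eqP => i; rewrite contentE /= /s count_flatten -map_comp sumnE big_map.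
rewrite big_enum /= (bigD1 i) //= count_nseq /= eqxx mul1n big1 ?addn0 // => j /negPf ji.
by rewrite count_nseq /= ji.
Qed.

Lemma content_perm t s : content t = content s -> perm_eq t s.
Proof.
move=> e; rewrite /perm_eq; apply/allP => i _ /=.
by rewrite -!contentE e.
Qed.

(** The multinomial coefficient k!/prod_i f(i)!. It measures how far the monomial basis is from
    being self-dual under transposition. *)
Definition nwords f : nat := #|[pred t | content t == f]|.

Lemma nwords_gt0 f : (0 < nwords f)%N.
Proof. by have [t tf] := content_surj f; apply/card_gt0P; exists t; rewrite inE tf. Qed.

End Words.

Lemma digits_inj K n (f g : 'I_n -> nat) : (forall i, f i < K)%N -> (forall i, g i < K)%N ->
  (\sum_i f i * K ^ i = \sum_i g i * K ^ i)%N -> f =1 g.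
Proof.
elim: n f g => [|n IH] f g fK gK; first by move=> _ [].
rewrite !big_ord_recl /= !expn0 !muln1.
have e (h : 'I_n.+1 -> nat) :
    (\sum_(i < n) h (lift ord0 i) * K ^ bump 0 i = (\sum_(i < n) h (lift ord0 i) * K ^ i) * K)%N.
  by rewrite big_distrl /=; apply: eq_bigr => i _; rewrite /bump add1n expnSr mulnA.
rewrite !e (addnC (f ord0)) (addnC (g ord0)) => eq.
have K0 : (0 < K)%N by apply: leq_ltn_trans (fK ord0).
have f0 : f ord0 = g ord0.
  by have := congr1 (modn^~ K) eq; rewrite !modnMDl !modn_small.
have {}eq : (\sum_(i < n) f (lift ord0 i) * K ^ i = \sum_(i < n) g (lift ord0 i) * K ^ i)%N.
  by have := congr1 (divn^~ K) eq; rewrite !divnMDl // !divn_small // !addn0.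
move=> i; case: (unliftP ord0 i) => [j ->|->] //.
exact: (IH (fun j => f (lift ord0 j)) (fun j => g (lift ord0 j)) (fun _ => fK _) (fun _ => gK _) eq).
Qed.

Section SymmetricPowers.
Variable R : realType.
Local Notation C := R[i].
Variables n k : nat.
Implicit Types (f g h : msetk n k) (t s : k.-tuple 'I_n) (x : 'I_n -> C) (M : 'M[C]_n).

Definition monom x f : C := \prod_i x i ^+ val f i.

Lemma monom_content x t : \prod_p x (tnth t p) = monom x (content t).
Proof.
rewrite (partition_big (tnth t) xpredT) //=; apply: eq_bigr => i _.
rewrite contentE count_mem_card -prodr_const.
by apply: eq_big => [p|p /eqP ->].
Qed.

Definition kron (z : C) (i : 'I_n) : C := z ^+ (k.+1 ^ i).
Definition code f : nat := (\sum_i (val f i : nat) * k.+1 ^ i)%N.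

Lemma code_inj : injective code.
Proof.
move=> f g e; apply: msetk_eqP.
apply: (@digits_inj k.+1 n (fun i => val f i) (fun i => val g i)) => // i; exact: ltn_ord.
Qed.

(* Kronecker's substitution x_i = z^((k+1)^i) separates the monomials. *)
Lemma monom_kron z f : monom (kron z) f = z ^+ code f.
Proof.
rewrite /monom /code expr_sum; apply: eq_bigr => i _.
by rewrite /kron -exprM mulnC.
Qed.

(** The values of [code] are distinct, so after the substitution the numbers [a f] are the
    coefficients of a polynomial in one variable with infinitely many zeros. *)
Lemma monom_free_dense (S : C -> Prop) (a : msetk n k -> C) : zdense S ->
  (forall z, S z -> \sum_f a f * monom (kron z) f = 0) -> a = fun=> 0.
Proof.
move=> dS h; pose p : {poly C} := \sum_f a f *: 'X^(code f).
have p0 : p = 0.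
  apply: (zdense_polyP dS) => z Sz; rewrite /p horner_sum -[RHS](h z Sz).
  by apply: eq_bigr => f _; rewrite hornerZ hornerXn monom_kron.
apply/funext => f; have := coef0 C (code f); rewrite -p0 /p coef_sum (bigD1 f) //=.
rewrite coefZ coefXn eqxx mulr1 big1 ?addr0 // => g gf.
by rewrite coefZ coefXn (inj_eq code_inj) eq_sym (negPf gf) mulr0.
Qed.

Lemma monom_free (a : msetk n k -> C) :
  (forall x, \sum_f a f * monom x f = 0) -> a = fun=> 0.
Proof. by move=> h; apply: (monom_free_dense (@zdense_setT R)) => z _; apply: h. Qed.

Lemma monom_inj (a b : msetk n k -> C) :
  (forall x, \sum_f a f * monom x f = \sum_f b f * monom x f) -> a = b.
Proof.
move=> h; suff e : (fun f => a f - b f) = fun=> 0.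
  by apply/funext => f; apply/eqP; rewrite -subr_eq0; have /eqP := congr1 (@^~ f) e.
apply: monom_free => x.
transitivity (\sum_f a f * monom x f - \sum_f b f * monom x f); last by rewrite h subrr.
by rewrite -sumrB; apply: eq_bigr => f _; rewrite mulrBl.
Qed.

Lemma symkE_pick M g s : exists2 s', content s' = content s &
  symk M g (content s) = \sum_(t | tcontent t g) \prod_(p < k) M (tnth t p) (tnth s' p).
Proof.
rewrite /symk; case: pickP => [s'|/(_ s)]; rewrite tcontentE; last by rewrite eqxx.
by move=> /eqP e; exists s'.
Qed.

(** [symk] picks some word of the given content. Two such words differ by a permutation of the
    positions, and reindexing the words [t] by this permutation shows that the choice is
    immaterial. *)
Lemma symkE M g s :
  symk M g (content s) = \sum_(t | content t == g) \prod_(p < k) M (tnth t p) (tnth s p).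
Proof.
have [s' es ->] := symkE_pick M g s.
have /tuple_permP [u eu] := content_perm es.
have su p : tnth s' p = tnth s (u p).
  by rewrite -[s'](_ : [tuple tnth s (u i) | i < k] = s') ?tnth_mktuple //; apply: val_inj; exact: (esym eu).
pose act (v : 'S_k) t := [tuple tnth t (v p) | p < k].
have actK (v : 'S_k) : cancel (act v) (act v^-1%g).
  by move=> t; apply: eq_from_tnth => p; rewrite !tnth_mktuple permKV.
rewrite (reindex (act u)) /=; last first.
  exists (act u^-1%g) => t _; first exact: actK.
  by rewrite -{1}[u]invgK actK.
apply: eq_big => [t|t _].
  rewrite tcontentE; congr (_ == g); apply: msetk_eqP => i; rewrite !contentE !count_mem_card.
  rewrite -!sum1_card [RHS](reindex_inj (@perm_inj _ u)) /=; apply: eq_bigl => p.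
  by rewrite !inE tnth_mktuple.
rewrite [RHS](reindex_inj (@perm_inj _ u)) /=; apply: eq_bigr => p _.
by rewrite tnth_mktuple su.
Qed.

Lemma prod_sum_words (F : 'I_k -> 'I_n -> C) :
  \prod_p \sum_i F p i = \sum_(t : k.-tuple 'I_n) \prod_p F p (tnth t p).
Proof.
rewrite bigA_distr_bigA /= (reindex (fun t : k.-tuple 'I_n => [ffun p => tnth t p])) /=.
  by apply: eq_bigr => t _; apply: eq_bigr => p _; rewrite ffunE.
exists (fun u : {ffun 'I_k -> 'I_n} => [tuple u p | p < k]) => t _.
  by apply: eq_from_tnth => p; rewrite tnth_mktuple ffunE.
by apply/ffunP => p; rewrite ffunE tnth_mktuple.
Qed.

(* Sym^k M acts on polynomial functions by substituting M^T x for x. *)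
Lemma symk_monom M f x :
  \sum_g symk M g f * monom x g = monom (fun i => \sum_p M p i * x p) f.
Proof.
have [s <-] := content_surj f; rewrite -monom_content prod_sum_words.
rewrite (partition_big (@content n k) xpredT) //=; apply: eq_bigr => g _.
rewrite symkE big_distrl /=; apply: eq_bigr => t /eqP <-.
by rewrite -monom_content big_split.
Qed.

(** Monomials being free, both sides may be compared as polynomial functions, where each factor is a
    linear substitution of the variables. *)
Lemma symkM (M N : 'M[C]_n) g f : symk (M *m N) g f = \sum_h symk M g h * symk N h f.
Proof.
move: g; apply/funeqP; apply: monom_inj => x; rewrite symk_monom.
under [RHS]eq_bigr => g _ do rewrite big_distrl /=.
rewrite exchange_big /=.
transitivity (\sum_h symk N h f * monom (fun i => \sum_p M p i * x p) h).
  rewrite symk_monom; apply: eq_bigr => i _; congr (_ ^+ _).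
  under eq_bigr => p _ do rewrite mxE big_distrl /=.
  rewrite exchange_big /=; apply: eq_bigr => j _; rewrite big_distrr /=.
  by apply: eq_bigr => p _; ring.
apply: eq_bigr => h _; rewrite -symk_monom big_distrr /=.
by apply: eq_bigr => g _; ring.
Qed.

Lemma symk_tor (c : 'I_n -> C) g f : symk (tor c) g f = monom c f *+ (g == f).
Proof.
move: g; apply/funeqP; apply: monom_inj => x; rewrite symk_monom.
rewrite [RHS](bigD1 f) //= eqxx big1 ?addr0 => [|g /negPf ->]; last by rewrite mul0r.
rewrite -big_split /=; apply: eq_bigr => i _; rewrite -exprMn; congr (_ ^+ _).
rewrite (bigD1 i) //= tor_entry eqxx big1 ?addr0 // => p /negPf pi.
by rewrite tor_entry pi mul0r.
Qed.

Lemma symk1 g f : symk (1%:M : 'M[C]_n) g f = (g == f)%:R.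
Proof.
rewrite -tor1 symk_tor; congr (_ *+ _); rewrite /monom big1 // => i _; exact: expr1n.
Qed.

(** Both sides add the same products over pairs of words, one of content [f] and one of content [g].
    This converts the dual factor of [Skm], which carries a transpose, into an ordinary symmetric
    power. *)
Lemma symk_tr M g f : (nwords f)%:R * symk M g f = (nwords g)%:R * symk M^T f g.
Proof.
have H (A : 'M[C]_n) a b : (nwords b)%:R * symk A a b =
    \sum_(s | content s == b) \sum_(t | content t == a) \prod_(p < k) A (tnth t p) (tnth s p).
  rewrite /nwords -sum1_card natr_sum big_distrl /=; apply: eq_bigr => s /eqP <-.
  by rewrite mul1r symkE.
rewrite !H exchange_big /=; apply: eq_bigr => s _; apply: eq_bigr => t _.
by apply: eq_bigr => p _; rewrite mxE.
Qed.

End SymmetricPowers.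

(** * Integration over the block subgroups *)

Section Tame.
Context d (T : measurableType d) (R : realType).
Local Notation C := R[i].
Implicit Types (D : set T).

(** Such functions are integrable for a probability and stable under products, so integrability need
    not be tracked separately. *)
Definition rtame D (f : T -> R) := measurable_fun D f /\ exists M, forall x, D x -> `|f x| <= M.

Lemma rtame_cst D c : rtame D (fun=> c).
Proof. by split; [exact: measurable_cst|exists `|c|]. Qed.

Lemma rtameD D f g : rtame D f -> rtame D g -> rtame D (fun x => f x + g x).
Proof.
move=> [mf [M hM]] [mg [N hN]]; split; first exact: measurable_funD.
by exists (M + N) => x Dx; apply: le_trans (ler_normD _ _) _; apply: lerD; [apply: hM|apply: hN].
Qed.

Lemma rtameM D f g : rtame D f -> rtame D g -> rtame D (fun x => f x * g x).
Proof.
move=> [mf [M hM]] [mg [N hN]]; split; first exact: measurable_funM.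
by exists (M * N) => x Dx; rewrite normrM ler_pM // ?hM // ?hN.
Qed.

Lemma rtameN D f : rtame D f -> rtame D (fun x => - f x).
Proof.
move=> [mf [M hM]]; split; first exact: measurableT_comp.
by exists M => x Dx; rewrite normrN hM.
Qed.

Lemma rtameB D f g : rtame D f -> rtame D g -> rtame D (fun x => f x - g x).
Proof. by move=> tf tg; apply: rtameD => //; apply: rtameN. Qed.

Lemma rtame_norm D f : rtame D f -> rtame D (fun x => `|f x|).
Proof.
move=> [mf [M hM]]; split; first exact: measurableT_comp.
by exists M => x Dx; rewrite normr_id hM.
Qed.

Lemma rtame_ext D f g : (forall x, D x -> f x = g x) -> rtame D f -> rtame D g.
Proof.
move=> e [mf [M hM]]; split; last by exists M => x Dx; rewrite -e // hM.
by apply: eq_measurable_fun mf => x /set_mem; apply: e.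
Qed.

Variable mu : probability T R.

Lemma rtame_int D f : measurable D -> rtame D f -> mu.-integrable D (EFin \o f).
Proof.
move=> mD [mf [M hM]]; apply: measurable_bounded_integrable => //.
  by apply: le_lt_trans (probability_le1 mu mD) _; rewrite ltry.
exists M; split; first by rewrite num_real.
by move=> N MN x Dx; apply: le_trans (hM x Dx) (ltW MN).
Qed.

Definition tame D (f : T -> C) :=
  rtame D (fun x => complex.Re (f x)) /\ rtame D (fun x => complex.Im (f x)).

Lemma tame_cst D c : tame D (fun=> c).
Proof. by split; apply: rtame_cst. Qed.

Lemma tame_ext D f g : (forall x, D x -> f x = g x) -> tame D f -> tame D g.
Proof.
by move=> e [h1 h2]; split; [apply: rtame_ext h1 => x Dx|apply: rtame_ext h2 => x Dx]; rewrite e.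
Qed.

Lemma ReD (a b : C) : complex.Re (a + b) = complex.Re a + complex.Re b.
Proof. by case: a b => a1 a2 []. Qed.
Lemma ImD (a b : C) : complex.Im (a + b) = complex.Im a + complex.Im b.
Proof. by case: a b => a1 a2 []. Qed.
Lemma ReM (a b : C) : complex.Re (a * b) = complex.Re a * complex.Re b - complex.Im a * complex.Im b.
Proof. by case: a b => a1 a2 []. Qed.
Lemma ImM (a b : C) : complex.Im (a * b) = complex.Re a * complex.Im b + complex.Im a * complex.Re b.
Proof. by case: a b => a1 a2 []. Qed.

Lemma tameD D f g : tame D f -> tame D g -> tame D (fun x => f x + g x).
Proof.
move=> [f1 f2] [g1 g2]; split.
  by apply: rtame_ext (rtameD f1 g1) => x _; rewrite ReD.
by apply: rtame_ext (rtameD f2 g2) => x _; rewrite ImD.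
Qed.

Lemma tameM D f g : tame D f -> tame D g -> tame D (fun x => f x * g x).
Proof.
move=> [f1 f2] [g1 g2]; split.
  by apply: rtame_ext (rtameB (rtameM f1 g1) (rtameM f2 g2)) => x _; rewrite ReM.
by apply: rtame_ext (rtameD (rtameM f1 g2) (rtameM f2 g1)) => x _; rewrite ImM.
Qed.

Lemma tame_conj D f : tame D f -> tame D (fun x => Num.conj (f x)).
Proof.
move=> [f1 f2]; split.
  by apply: rtame_ext f1 => x _; case: (f x).
by apply: rtame_ext (rtameN f2) => x _; case: (f x).
Qed.

Lemma tame_sum D (I : Type) (r : seq I) (P : pred I) (F : I -> T -> C) :
  (forall i, tame D (F i)) -> tame D (fun x => \sum_(i <- r | P i) F i x).
Proof.
move=> tF; elim: r => [|i r IH].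
  by apply: tame_ext (tame_cst D 0) => x _; rewrite big_nil.
have [Pi|/negPf Pi] := boolP (P i).
  by apply: tame_ext (tameD (tF i) IH) => x _; rewrite big_cons Pi.
by apply: tame_ext IH => x _; rewrite big_cons Pi.
Qed.

Lemma tame_sub D E f : measurable D -> E `<=` D -> tame D f -> tame E f.
Proof.
move=> mD ED [[m1 [M1 h1]] [m2 [M2 h2]]]; split; split.
- exact: measurable_funS m1.
- by exists M1 => x /ED/h1.
- exact: measurable_funS m2.
- by exists M2 => x /ED/h2.
Qed.

End Tame.

Section ComplexIntegral.
Variables (R : realType) (n : nat).
Local Notation C := R[i].
Local Notation T := (MxMeas R n).
Variable mu : probability T R.
Variable D : set T.
Hypothesis mD : measurable D.
Hypothesis muD : mu D = 1%E.
Implicit Types f g : T -> C.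

Lemma cint_ext f g : (forall x, D x -> f x = g x) -> cint mu D f = cint mu D g.
Proof.
move=> e; rewrite /cint; congr Complex; apply: eq_Rintegral => x /set_mem Dx;
by rewrite e.
Qed.

Lemma cintD f g : tame D f -> tame D g ->
  cint mu D (fun x => f x + g x) = cint mu D f + cint mu D g.
Proof.
move=> [f1 f2] [g1 g2]; rewrite /cint.
have -> : (fun x => complex.Re (f x + g x)) = fun x => complex.Re (f x) + complex.Re (g x).
  by apply/funext => x; rewrite ReD.
have -> : (fun x => complex.Im (f x + g x)) = fun x => complex.Im (f x) + complex.Im (g x).
  by apply/funext => x; rewrite ImD.
by rewrite !RintegralD //; exact: rtame_int.
Qed.

Lemma cintZ c f : tame D f -> cint mu D (fun x => c * f x) = c * cint mu D f.
Proof.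
move=> [f1 f2]; rewrite /cint.
have -> : (fun x => complex.Re (c * f x)) =
    fun x => complex.Re c * complex.Re (f x) - complex.Im c * complex.Im (f x).
  by apply/funext => x; rewrite ReM.
have -> : (fun x => complex.Im (c * f x)) =
    fun x => complex.Re c * complex.Im (f x) + complex.Im c * complex.Re (f x).
  by apply/funext => x; rewrite ImM.
rewrite RintegralB ?RintegralD //; try by apply: rtame_int => //; apply: rtameM => //; apply: rtame_cst.
rewrite !RintegralZl //; try exact: rtame_int.
by case: c.
Qed.

Lemma cint_cst c : cint mu D (fun=> c) = c.
Proof.
rewrite /cint !Rintegral_cst //; case: c => a b /=.
have e : fine (mu D) = 1 by exact: (congr1 fine muD).
by congr Complex; rewrite -[RHS]mulr1; congr (_ * _); exact: e.
Qed.

Lemma cint_sum (I : Type) (r : seq I) (P : pred I) (F : I -> T -> C) :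
  (forall i, tame D (F i)) ->
  cint mu D (fun x => \sum_(i <- r | P i) F i x) = \sum_(i <- r | P i) cint mu D (F i).
Proof.
move=> tF; elim: r => [|i r IH].
  by rewrite big_nil -[RHS]cint_cst; apply: cint_ext => x _; rewrite big_nil.
rewrite big_cons -IH; case: ifP => Pi; last by apply: cint_ext => x _; rewrite big_cons Pi.
rewrite -cintD //; last exact: tame_sum.
by apply: cint_ext => x _; rewrite big_cons Pi.
Qed.

End ComplexIntegral.

Section UnitaryBlocks.
Variables (R : realType) (n : nat).
Local Notation C := R[i].
Local Notation T := (MxMeas R n).
Implicit Types (B : {set 'I_n}) (A : 'M[C]_n).

Definition cmeas (D : set T) (f : T -> C) :=
  measurable_fun D (fun X => complex.Re (f X)) /\ measurable_fun D (fun X => complex.Im (f X)).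

Lemma cmeas_cst (D : set T) c : cmeas D (fun=> c).
Proof. by split; exact: measurable_cst. Qed.

Lemma cmeas_ext (D : set T) (f g : T -> C) : (forall X, D X -> f X = g X) -> cmeas D f -> cmeas D g.
Proof.
move=> e [h1 h2]; split; [apply: eq_measurable_fun h1|apply: eq_measurable_fun h2] => X /set_mem DX;
by rewrite e.
Qed.

Lemma cmeasD (D : set T) (f g : T -> C) : cmeas D f -> cmeas D g -> cmeas D (fun X => f X + g X).
Proof.
move=> [f1 f2] [g1 g2]; split.
  apply: eq_measurable_fun (measurable_funD f1 g1) => X _; by rewrite ReD.
apply: eq_measurable_fun (measurable_funD f2 g2) => X _; by rewrite ImD.
Qed.

Lemma cmeasM (D : set T) (f g : T -> C) : cmeas D f -> cmeas D g -> cmeas D (fun X => f X * g X).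
Proof.
move=> [f1 f2] [g1 g2]; split.
  apply: eq_measurable_fun (measurable_funB (measurable_funM f1 g1) (measurable_funM f2 g2)) => X _.
  by rewrite ReM.
apply: eq_measurable_fun (measurable_funD (measurable_funM f1 g2) (measurable_funM f2 g1)) => X _.
by rewrite ImM.
Qed.

Lemma cmeas_conj (D : set T) (f : T -> C) : cmeas D f -> cmeas D (fun X => Num.conj (f X)).
Proof.
move=> [f1 f2]; split.
  by apply: eq_measurable_fun f1 => X _; case: (f X).
have mN : measurable_fun D (fun X => - complex.Im (f X)) by exact: measurableT_comp.
by apply: eq_measurable_fun mN => X _; case: (f X).
Qed.

Lemma cmeas_sum (D : set T) (I : Type) (r : seq I) (F : I -> T -> C) :
  (forall i, cmeas D (F i)) -> cmeas D (fun X => \sum_(i <- r) F i X).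
Proof.
move=> tF; elim: r => [|i r IH].
  by apply: cmeas_ext (cmeas_cst D 0) => x _; rewrite big_nil.
by apply: cmeas_ext (cmeasD (tF i) IH) => x _; rewrite big_cons.
Qed.

Lemma cmeas_entry (i j : 'I_n) : cmeas setT (fun X : T => (X : 'M[C]_n) i j).
Proof.
split=> _ Y mY; rewrite setTI; apply: sub_sigma_algebra; exists i, j, Y; split=> //.
  by left.
by right.
Qed.

Lemma measurable_eqc (f : T -> C) c : cmeas setT f -> measurable [set X | f X = c].
Proof.
move=> [mr mi].
have -> : [set X | f X = c] = ((fun X => complex.Re (f X)) @^-1` [set complex.Re c]) `&`
    ((fun X => complex.Im (f X)) @^-1` [set complex.Im c]).
  apply/seteqP; split=> [X /= ->//|X /= [e1 e2]].
  by case: (f X) e1 e2 => a b /= -> ->; case: c.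
apply: measurableI; rewrite -[X in measurable X]setTI; [exact: mr|exact: mi].
Qed.

Lemma measurable_UB B : measurable (UB B : set T).
Proof.
have -> : (UB B : set T) = (\bigcap_(p in [set: 'I_n * 'I_n])
      [set X : T | \sum_k (X : 'M[C]_n) p.1 k * Num.conj ((X : 'M[C]_n) p.2 k) = (p.1 == p.2)%:R])
   `&` (\bigcap_(p in [set p : 'I_n * 'I_n | (p.1 \notin B) || (p.2 \notin B)])
      [set X : T | (X : 'M[C]_n) p.1 p.2 = (p.1 == p.2)%:R]).
  apply/seteqP; split=> [X [uX hX]|X [h1 h2]].
    split=> [[i j] /= _|[i j] /=]; last exact: hX.
    by have := congr1 (fun M : 'M[C]_n => M i j) uX; rewrite !mxE => <-; apply: eq_bigr => k _; rewrite !mxE.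
  split=> [|i j]; last exact: (h2 (i, j)).
  apply/matrixP => i j; rewrite !mxE; have /= <- := h1 (i, j) I.
  by apply: eq_bigr => k _; rewrite !mxE.
apply: measurableI; apply: fin_bigcap_measurable => // -[i j] _; apply: measurable_eqc.
  apply: cmeas_sum => k; apply: cmeasM; first exact: cmeas_entry.
  by apply: cmeas_conj; apply: cmeas_entry.
exact: cmeas_entry.
Qed.

Lemma UB_unitary B A : UB B A -> unitary A.
Proof. by case. Qed.

Lemma UBT : (UB [set: 'I_n] : set T) = [set X : T | unitary (X : 'M[C]_n)].
Proof. by apply/seteqP; split=> X //= [] // uX; split=> // i j; rewrite !inE. Qed.

Lemma UB_mul B A A' : UB B A -> UB B A' -> UB B (A *m A').
Proof.
move=> [uA hA] [uA' hA']; split; first exact: unitary_mul.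
move=> i j ij; rewrite mxE; case: (boolP (i \in B)) ij => [iB /= jB|iB _].
  rewrite (bigD1 j) //= [A i j]hA ?jB ?orbT // hA' ?jB // eqxx mulr1 big1 ?addr0 // => k kj.
  by rewrite hA' ?jB ?orbT // (negPf kj) mulr0.
rewrite (bigD1 i) //= hA ?iB // eqxx mul1r hA' ?iB // big1 ?addr0 // => k ki.
by rewrite hA ?iB // eq_sym (negPf ki) mul0r.
Qed.

Lemma UB_inv B A : UB B A -> UB B (invmx A).
Proof.
move=> [uA hA]; split; first exact: unitaryV.
move=> i j ij; have -> : invmx A i j = Num.conj (A j i) by rewrite (unitary_inv uA) 2!mxE.
have -> : A j i = (j == i)%:R by apply: hA; rewrite orbC.
by rewrite eq_sym; exact: rmorph_nat.
Qed.

Lemma unitary_entry_le1 A i j : unitary A -> `|A i j| <= 1.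
Proof.
move=> uA; have := congr1 (fun M : 'M[C]_n => M i i) uA; rewrite !mxE eqxx (bigD1 j) //= !mxE -normCK => e.
rewrite -(@expr_le1 _ 2) //; rewrite -[leRHS]e lerDl sumr_ge0 // => k _.
by rewrite !mxE -normCK exprn_ge0.
Qed.

Lemma ReIm_le (z : C) (M : R) : `|z| <= M%:C%C -> `|complex.Re z| <= M /\ `|complex.Im z| <= M.
Proof.
move=> zM; have M0 : 0 <= M by rewrite -lecR; exact: (le_trans (normr_ge0 z) zM).
have : `|z| ^+ 2 <= (M%:C%C) ^+ 2 by rewrite lerXn2r // nnegrE ?normr_ge0 // lecR.
rewrite -add_Re2_Im2 -rmorphXn lecR => h.
have sq x y : x ^+ 2 + y <= M ^+ 2 -> 0 <= y -> `|x| <= M :> R.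
  move=> xy y0; rewrite -(@ler_pXn2r _ 2) ?nnegrE // real_normK ?num_real //.
  by apply: le_trans xy; rewrite lerDl.
by split; [apply: sq h _|apply: (sq _ (complex.Re z ^+ 2)); rewrite 1?addrC]; rewrite ?sqr_ge0.
Qed.

Lemma tame_entry B i j : tame (UB B) (fun X : T => (X : 'M[C]_n) i j).
Proof.
have [m1 m2] := cmeas_entry i j.
have h (X : T) : UB B X -> `|complex.Re ((X : 'M[C]_n) i j)| <= 1 /\ `|complex.Im ((X : 'M[C]_n) i j)| <= 1.
  by move=> /UB_unitary uX; apply: ReIm_le; apply: unitary_entry_le1.
by split; split; [exact: measurable_funTS|exists 1 => X /h[]|exact: measurable_funTS|exists 1 => X /h[]].
Qed.

(** On unitary matrices the entries are bounded by 1, and the entries of the inverse are conjugates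
    of entries, so no denominator is left. *)
Lemma tame_regular B (F : 'M[C]_n -> C) : regular F -> tame (UB B) (F : T -> C).
Proof.
elim=> {F} [c|i j|i j|F G _ IF _ IG|F G _ IF _ IG|F G e _ IF].
- exact: tame_cst.
- exact: tame_entry.
- apply: tame_ext (tame_conj (tame_entry B j i)) => X /UB_unitary uX.
  by rewrite unitary_inv // !mxE.
- exact: tameD.
- exact: tameM.
- by apply: tame_ext IF => X /UB_unitary uX; apply: e; apply: unitary_unit.
Qed.

Lemma measurable_lmul A : measurable_fun setT (fun X : T => (A *m (X : 'M[C]_n)) : T).
Proof.
apply: (@measurability _ _ T T setT _ (@mx_gen R n)) => //.
move=> _ [Z [i [j [Y [mY e]]]] <-]; rewrite setTI.
have [mr mi] : cmeas setT (fun X : T => (A *m (X : 'M[C]_n)) i j).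
  apply: (@cmeas_ext _ (fun X : T => \sum_k A i k * (X : 'M[C]_n) k j)) => [X _|]; first by rewrite mxE.
  by apply: cmeas_sum => k; apply: cmeasM; [exact: cmeas_cst|exact: cmeas_entry].
case: e => ->.
  by have := mr measurableT Y mY; rewrite setTI.
by have := mi measurableT Y mY; rewrite setTI.
Qed.

Lemma measurable_adj : measurable_fun setT (fun X : T => ((map_mx Num.conj (X : 'M[C]_n))^T : 'M[C]_n) : T).
Proof.
apply: (@measurability _ _ T T setT _ (@mx_gen R n)) => //.
move=> _ [Z [i [j [Y [mY e]]]] <-]; rewrite setTI.
have [mr mi] : cmeas setT (fun X : T => (map_mx Num.conj (X : 'M[C]_n))^T i j).
  apply: (cmeas_ext _ (cmeas_conj (cmeas_entry j i))) => X _; by rewrite !mxE.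
case: e => ->.
  by have := mr measurableT Y mY; rewrite setTI.
by have := mi measurableT Y mY; rewrite setTI.
Qed.

Variable B : {set 'I_n}.
Variable mu : probability T R.
Hypothesis hmu : haar_prob (UB B) mu.

Lemma haar1 : mu (UB B) = 1%E.
Proof. by case: hmu. Qed.

Let phi A (X : T) : T := A *m (X : 'M[C]_n).

Let preimage_phi A : UB B A -> phi A @^-1` (UB B) = UB B.
Proof.
move=> hA; apply/seteqP; split=> X /= hX; last exact: UB_mul.
have -> : X = invmx A *m (phi A X).
  by rewrite /phi mulmxA mulVmx ?mul1mx //; apply/unitary_unit/UB_unitary/hA.
by apply: UB_mul => //; apply: UB_inv.
Qed.

(** [haar_prob] states invariance on measurable sets; it reaches functions through the image
    measure. The domain of integration is preserved because the preimage of [UB B] under translation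
    by one of its elements is [UB B]. *)
Lemma rtame_translate A (f : T -> R) : UB B A -> rtame (UB B) f ->
  rtame (UB B) (fun X => f (phi A X)) /\
  Rintegral mu (UB B) (fun X => f (phi A X)) = Rintegral mu (UB B) f.
Proof.
move=> hA tf; have [mf [M hM]] := tf; have mUB := measurable_UB B.
have mphi := measurable_lmul A.
have mfphi : measurable_fun (UB B) (fun X => f (phi A X)).
  move=> _ Y mY; rewrite -[X in X `&` _](preimage_phi hA) -[X in measurable X]setTI.
  exact: (mphi measurableT _ (mf mUB Y mY)).
have tphi : rtame (UB B) (fun X => f (phi A X)).
  by split=> //; exists M => X hX; apply: hM; apply: UB_mul.
split=> //; rewrite /Rintegral; congr fine.
rewrite [RHS]integral_mkcond.
transitivity (\int[pushforward mu (phi A)]_x (((fun x => (f x)%:E) \_ (UB B)) x))%E; last first.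
  apply: eq_measure_integral => E mE _; rewrite /pushforward.
  by case: hmu => _; apply.
rewrite integral_pushforward //=.
- rewrite [LHS]integral_mkcond preimage_setT; apply: eq_integral => X _ /=.
  rewrite !patchE; congr (if _ then _ else _).
  apply/idP/idP => /set_mem hX; apply/mem_set; first exact: UB_mul.
  by rewrite -(preimage_phi hA).
- by apply/(measurable_restrictT _ _).1 => //; apply/measurable_EFinP.
- rewrite preimage_setT; have := rtame_int mu mUB tphi.
  rewrite integrable_mkcond //; congr (integrable _ _ _); apply/funext => X.
  rewrite /= !patchE; congr (if _ then _ else _).
  apply/idP/idP => /set_mem hX; apply/mem_set; first exact: UB_mul.
  by rewrite -(preimage_phi hA).
Qed.

Lemma tame_translate A (f : T -> C) : UB B A -> tame (UB B) f ->
  tame (UB B) (fun X => f (A *m (X : 'M[C]_n))).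
Proof. by move=> hA [f1 f2]; split; [case: (rtame_translate hA f1)|case: (rtame_translate hA f2)]. Qed.

Lemma cint_translate A (f : T -> C) : UB B A -> tame (UB B) f ->
  cint mu (UB B) (fun X => f (A *m (X : 'M[C]_n))) = cint mu (UB B) f.
Proof.
move=> hA [f1 f2]; rewrite /cint; congr Complex.
  by case: (rtame_translate hA f1).
by case: (rtame_translate hA f2).
Qed.

End UnitaryBlocks.

Section MixedPowers.
Variables (R : realType) (n : nat).
Local Notation C := R[i].
Implicit Types (A M : 'M[C]_n).

Lemma invmx_tr_mul A A' : A \in unitmx -> A' \in unitmx ->
  (invmx (A *m A'))^T = (invmx A)^T *m (invmx A')^T.
Proof. by move=> uA uA'; rewrite invmx_mul // trmx_mul. Qed.

Lemma Skm_mul k m A A' x z : A \in unitmx -> A' \in unitmx ->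
  @Skm R n k m (A *m A') x z = \sum_y Skm A x y * Skm A' y z.
Proof.
move=> uA uA'; rewrite /Skm symkM invmx_tr_mul // symkM big_distrlr /= pair_big /=.
by apply: eq_bigr => -[y1 y2] _ /=; ring.
Qed.

Lemma Skm1 k m x y : @Skm R n k m 1%:M x y = (x == y)%:R.
Proof. by case: x y => [a b] [c d]; rewrite /Skm invmx1 trmx1 !symk1 -natrM mulnb. Qed.

Lemma regular_symk k (Psi : 'M[C]_n -> 'M[C]_n) (g f : msetk n k) :
  (forall i j, regular (fun A => Psi A i j)) -> regular (fun A => symk (Psi A) g f).
Proof.
move=> rPsi; have [s <-] := content_surj f.
apply: (@regular_ext _ _ (fun A => \sum_(t : k.-tuple 'I_n | content t == g)
    \prod_(p < k) Psi A (tnth t p) (tnth s p))) => [A _|]; first by rewrite symkE.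
by apply: regular_sum => t _; apply: regular_prod => p _.
Qed.

Lemma regular_Skm k m x y : regular (fun A => @Skm R n k m A x y).
Proof.
apply: (@regularM _ _ (fun A => symk A x.1 y.1) (fun A => symk (invmx A)^T x.2 y.2)).
  by apply: (@regular_symk _ id) => i j; apply: regular_entry.
apply: (@regular_symk _ (fun A => (invmx A)^T)) => i j.
by apply: (@regular_ext R n _ _ _ (@regular_inv R n j i)) => A _; rewrite mxE.
Qed.

Lemma Skm_tor k m (t : 'I_n -> C) x y : (forall i, t i != 0) ->
  @Skm R n k m (tor t) x y = (monom t x.1 * monom (fun i => (t i)^-1) x.2) *+ (x == y).
Proof.
move=> t0; rewrite /Skm (tor_inv t0).2 (_ : (tor _)^T = tor (fun i => (t i)^-1)); last first.
  by apply/matrixP => i j; rewrite mxE !tor_entry eq_sym; case: eqP => [->|].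
case: x y => [a b] [c d] /=; rewrite !symk_tor mulrnAr mulrnAl -mulrnA mulnb xpair_eqE.
by case: eqP => [->|_]; case: eqP => [->|_] //=.
Qed.

End MixedPowers.

(** * The average of S_{k,k} over one block subgroup *)

Section BlockAverage.
Variables (R : realType) (n k : nat) (B : {set 'I_n}).
Local Notation C := R[i].
Implicit Types (f g h : msetk n k) (A M : 'M[C]_n).

Definition blockB M := forall i j : 'I_n, (i \notin B) || (j \notin B) -> M i j = (i == j)%:R.

Definition agree g f := [forall j, (j \notin B) ==> (val g j == val f j)].

Lemma agreeP g f : reflect (forall j, j \notin B -> val g j = val f j) (agree g f).
Proof.
apply: (iffP forallP) => [h j jB|h j]; first by apply/eqP/(implyP (h j)).
by apply/implyP => /h ->.
Qed.

(** If two words have contents that differ at a letter i outside [B], some position carries i in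
    exactly one of them. The entry of [M] there is off-diagonal with an index outside [B], so it
    kills the product. *)
Lemma symk_agree M g f : blockB M -> symk M g f != 0 -> agree g f.
Proof.
move=> bM; have [s <-] := content_surj f; rewrite symkE => /negP nz.
apply/agreeP => i iB; apply/val_inj/eqP; apply: contraT => ne; case: nz; apply/eqP.
apply: big1 => t /eqP tg.
have [/forallP e|/forallPn [p pe]] := boolP [forall p, (tnth t p == i) == (tnth s p == i)].
  move: ne; rewrite -tg (contentE t i : val (val (content t) i) = _) (contentE s i : val (val (content s) i) = _).
  rewrite !count_mem_card => /eqP; case; apply: eq_card => p; rewrite !inE; exact: (eqP (e p)).
rewrite (bigD1 p) //= bM ?mulr0; last first.
  have [e|ti] := eqVneq (tnth t p) i; first by rewrite e iB.
  have [e|si] := eqVneq (tnth s p) i; first by rewrite e iB orbT.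
  by rewrite (negPf ti) (negPf si) eqxx in pe.
have -> : (tnth t p == tnth s p) = false; last by rewrite mul0r.
by apply/negP => /eqP e; rewrite e eqxx in pe.
Qed.

Lemma blockB_UB A : UB B A -> blockB A /\ blockB (invmx A)^T.
Proof.
move=> hA; split=> i j ij; first by apply: hA.2.
by rewrite mxE (UB_inv hA).2 1?orbC // eq_sym.
Qed.

Lemma blockB_tor (t : 'I_n -> C) : is_torus_elt t -> (forall i, i \notin B -> t i = 1) -> UB B (tor t).
Proof.
move=> ht t1; split; first exact: tor_unitary.
move=> i j ij; rewrite tor_entry; case: eqP => [e|] //; rewrite -e orbb in ij.
by rewrite t1.
Qed.

(* The coefficient (1 - i)/|B| makes spread unitary with nonzero entries on all of B x B. *)
Definition spread_coef : C := Complex (#|B|%:R^-1) (- #|B|%:R^-1).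
Definition spread : 'M[C]_n :=
  \matrix_(i, j) ((i == j)%:R - spread_coef * ((i \in B) && (j \in B))%:R).

(** [spread] is I - c J, where J is the all-ones matrix on [B] and J^2 = [#|B|] J. Unitarity amounts
    to c + conj c = [#|B|] c conj c, which holds for c = (1 - i)/[#|B|]. *)
Lemma spread_UB : (0 < #|B|)%N -> UB B spread.
Proof.
move=> B0.
have b0 : (#|B|%:R : R) != 0 by rewrite pnatr_eq0 -lt0n.
split; last by move=> i j ij; rewrite mxE -negb_and in ij *; rewrite (negPf ij) mulr0 subr0.
apply/matrixP => i j; rewrite !mxE.
have cc (a b : bool) : Num.conj (a%:R - spread_coef * b%:R) = a%:R - Num.conj spread_coef * b%:R.
  by rewrite rmorphB rmorphM !rmorph_nat.
transitivity (\sum_l ((i == l)%:R - spread_coef * ((i \in B) && (l \in B))%:R) *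
    ((j == l)%:R - Num.conj spread_coef * ((j \in B) && (l \in B))%:R)).
  by apply: eq_bigr => l _; rewrite !mxE cc.
transitivity (\sum_l ((i == l)%:R * (j == l)%:R)
    - \sum_l ((i == l)%:R * (Num.conj spread_coef * ((j \in B) && (l \in B))%:R))
    - \sum_l ((j == l)%:R * (spread_coef * ((i \in B) && (l \in B))%:R))
    + \sum_l (spread_coef * Num.conj spread_coef * ((i \in B) && (j \in B))%:R * (l \in B)%:R)).
  rewrite -!sumrB -big_split /=; apply: eq_bigr => l _.
  by case: (i \in B); case: (j \in B); case: (l \in B) => /=; ring.
have one (a : 'I_n) (F : 'I_n -> C) : \sum_l (a == l)%:R * F l = F a.
  rewrite (bigD1 a) //= eqxx mul1r big1 ?addr0 // => l /negPf la.
  by rewrite eq_sym la mul0r.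
rewrite !one -big_distrr /= -natr_sum.
rewrite [j == i]eq_sym (andbC (i \in B) (j \in B)) -addrA -addrA -[RHS]addr0; congr (_ + _).
case: (_ && _); rewrite ?mulr0 ?mul0r ?oppr0 ?addr0 // !mulr1.
have -> : (\sum_l ((l \in B) : nat))%N = #|B|.
  by rewrite -sum1_card [RHS]big_mkcond /=; apply: eq_bigr => l _; case: (l \in B).
have -> : (#|B|%:R : C) = Complex (#|B|%:R) 0 by rewrite -(rmorph_nat (real_complex R)).
by rewrite /spread_coef; apply/eqP; rewrite eq_complex /=; apply/andP; split; apply/eqP; field.
Qed.

Lemma spread_neq0 i j : i \in B -> j \in B -> spread i j != 0.
Proof.
move=> iB jB; rewrite mxE iB jB mulr1 /spread_coef.
have b0 : (#|B|%:R : R) != 0 by rewrite pnatr_eq0 -lt0n; apply/card_gt0P; exists i.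
rewrite eq_complex negb_and; apply/orP; right.
by case: (i == j); rewrite /= ?oppr0 ?add0r ?opprK invr_eq0.
Qed.

Definition collapse (j0 : 'I_n) (t : k.-tuple 'I_n) : k.-tuple 'I_n :=
  [tuple (if tnth t p \in B then j0 else tnth t p) | p < k].

(** No cancellation can occur: a contributing word has, at each position, the letter of [t] or
    another letter of [B] in place of a letter of [B]. All such words of the same content yield the
    same nonzero product, so the coefficient is this product times a positive count. *)
Lemma symk_spread_neq0 j0 t : j0 \in B ->
  symk spread (content t) (content (collapse j0 t)) != 0.
Proof.
move=> jB; rewrite symkE.
pose F i : C := if i \in B then spread i j0 else 1.
pose ok (t' : k.-tuple 'I_n) := [forall p, (tnth t' p == tnth t p) ||
  (tnth t' p \in B) && (tnth t p \in B)].
have e (t' : k.-tuple 'I_n) : content t' == content t ->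
    \prod_(p < k) spread (tnth t' p) (tnth (collapse j0 t) p) = (ok t')%:R * monom F (content t).
  move=> /eqP <-; have [/forallP h|/forallPn [p]] := boolP (ok t').
    rewrite mul1r -monom_content; apply: eq_bigr => p _; rewrite tnth_mktuple /F.
    case/orP: (h p) => [/eqP ->|/andP[-> ->]] //.
    case: ifP => // tB; rewrite mxE eqxx tB mulr0 subr0 //.
  rewrite negb_or => /andP[/negPf np nB]; rewrite mul0r (bigD1 p) //= tnth_mktuple mxE.
  case: ifP nB => tB; rewrite ?andbT ?andbF.
    move=> nB; rewrite (negPf nB) andFb mulr0 subr0; case: eqP => [e|]; last by rewrite mul0r.
    by rewrite e jB in nB.
  by move=> _; rewrite np tB andbF mulr0 subr0 mul0r.
rewrite (eq_bigr (fun t' => (ok t')%:R * monom F (content t))) // -big_distrl /=.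
apply: mulf_neq0.
  rewrite -natr_sum pnatr_eq0 (bigD1 t) //=.
  by rewrite (_ : ok t) //; apply/forallP => p; rewrite eqxx.
rewrite /monom; apply/prodf_neq0 => i _; apply: expf_neq0; rewrite /F.
by case: ifP => iB; [apply: spread_neq0|apply: oner_neq0].
Qed.

(** Letters outside [B] are kept, letters of [B] all become [j0], and the total [k] fixes the
    multiplicity of [j0]. *)
Lemma content_collapse j0 t t' : agree (content t) (content t') ->
  content (collapse j0 t) = content (collapse j0 t').
Proof.
move=> /agreeP h.
have out u i : i != j0 -> (val (content (collapse j0 u)) i : nat) =
    if i \in B then 0%N else val (content u) i.
  move=> ij; rewrite !contentE !count_mem_card; case: ifPn => iB.
    apply/eqP; rewrite -leqn0 leqNgt; apply/negP => /card_gt0P[p]; rewrite inE tnth_mktuple.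
    by case: ifPn => [_|pB] /eqP e; [rewrite e eqxx in ij|rewrite e iB in pB].
  apply: eq_card => p; rewrite !inE tnth_mktuple; case: ifPn => // pB.
  rewrite eq_sym (negPf ij); apply/esym/negbTE; apply: contraNneq iB => <- //.
have out_eq i : i != j0 -> val (content (collapse j0 t)) i = val (content (collapse j0 t')) i :> nat.
  by move=> ij; rewrite !out //; case: ifPn => // iB; rewrite h.
apply: msetk_eqP => i; have [->|] := eqVneq i j0; last exact: out_eq.
have := etrans (msetk_sum (content (collapse j0 t))) (esym (msetk_sum (content (collapse j0 t')))).
by rewrite (bigD1 j0) //= [RHS](bigD1 j0) //= (eq_bigr _ (fun i => @out_eq i)) => /addIn.
Qed.

Lemma exists_circle m : (0 < m)%N -> exists2 z : C, `|z| = 1 & z ^+ m != 1.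
Proof.
move=> m0; have [|z z1] := @zdense_circle R ('X^m - 1).
  by rewrite -size_poly_eq0 size_XnsubC.
by rewrite hornerD hornerN hornerXn hornerC subr_eq0 => h; exists z.
Qed.

(** Moving coordinate [i] by z multiplies by z to the power plus or minus m, the difference of the
    multiplicities, and z is chosen with z^m != 1. As no other coordinate moves, the torus element
    lies in U_B as soon as [i] is in [B]. *)
Lemma tor_separate (i : 'I_n) g g' : val g i != val g' i ->
  exists t : 'I_n -> C, [/\ is_torus_elt t, forall j, j != i -> t j = 1 &
    monom t g * monom (fun j => (t j)^-1) g' != 1].
Proof.
move=> gi.
have [m [m0 hm]] : exists m, (0 < m)%N /\ ((val g i = val g' i + m :> nat)%N \/ (val g' i = val g i + m :> nat)%N).
  have : (val g i : nat) != val g' i by [].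
  case: (ltngtP (val g i) (val g' i)) => // h _.
    by exists (val g' i - val g i)%N; rewrite subn_gt0 h subnKC ?(ltnW h) //; split=> //; right.
  by exists (val g i - val g' i)%N; rewrite subn_gt0 h subnKC ?(ltnW h) //; split=> //; left.
have [z z1 zm] := exists_circle m0; have z0 := unit_neq0 z1.
pose t j : C := if j == i then z else 1.
exists t; split=> [j|j /negPf ji|]; rewrite /t; [by case: ifP; rewrite ?normr1|by rewrite ji|].
have mon (u : 'I_n -> C) h : (forall j, j != i -> u j = 1) -> monom u h = u i ^+ val h i.
  by move=> hu; rewrite /monom (bigD1 i) //= big1 ?mulr1 // => j /hu ->; rewrite expr1n.
rewrite !mon; try by move=> j /negPf ji; rewrite ji ?invr1.
rewrite eqxx; case: hm => ->; rewrite exprD !exprVn.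
  by rewrite mulrAC divff ?expf_neq0 // mul1r.
rewrite mulrA divff ?expf_neq0 // mul1r; apply: contra zm => /eqP e.
by rewrite -[z ^+ m]invrK e invr1.
Qed.

Lemma msetk_neq g g' : g != g' -> exists i, val g i != val g' i.
Proof.
move=> gg'; apply/existsP; rewrite -negb_forall; apply: contra gg' => /forallP h.
by apply/eqP; apply: val_inj; apply/ffunP => i; apply/eqP.
Qed.

Variable mu : probability (MxMeas R n) R.
Hypothesis hmu : haar_prob (UB B) mu.

Let mUB := @measurable_UB R n B.
Let avg x y := cint mu (UB B) (fun A => @Skm R n k k A x y).

Lemma avg_invariant A x y : UB B A -> \sum_z Skm A x z * avg z y = avg x y.
Proof.
move=> hA; have uA := unitary_unit hA.1.
have tS a b : tame (UB B) (fun X : MxMeas R n => @Skm R n k k X a b).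
  exact (@tame_regular R n B _ (@regular_Skm R n k k a b)).
rewrite /avg -[RHS](cint_translate hmu hA (tS x y)).
rewrite (cint_ext mu (g := fun X => \sum_z Skm A x z * @Skm R n k k X z y)); last first.
  by move=> X hX; rewrite Skm_mul //; apply: unitary_unit hX.1.
rewrite cint_sum //; last by move=> z; apply: tameM => //; apply: tame_cst.
  by apply: eq_bigr => z _; rewrite cintZ.
exact: haar1 hmu.
Qed.

Lemma avg_agree g g' f : avg (g, g') (f, f) != 0 -> agree g f /\ agree g' f.
Proof.
apply: contra_neqP => /not_andP h.
rewrite /avg (cint_ext mu (g := fun=> 0)).
  by rewrite cint_cst //; apply: haar1 hmu.
move=> X hX; have [b1 b2] := blockB_UB hX; apply/eqP; apply: contraT.
rewrite /Skm /= mulf_eq0 negb_or => /andP[s1 s2]; case: h => h; case: h.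
  exact: symk_agree s1.
exact: symk_agree s2.
Qed.

(** If the average were nonzero, [g] and [g'] would both agree with [f] off [B] and so differ at a
    letter of [B]. A torus element separating them would then belong to U_B, and invariance would
    multiply the average by a factor other than 1. *)
Lemma avg_diag g g' f : g != g' -> avg (g, g') (f, f) = 0.
Proof.
move=> gg'; apply/eqP; apply: contraT => nz; have [ag ag'] := avg_agree nz.
have [i gi] := msetk_neq gg'.
have iB : i \in B.
  by apply: contraNT gi => iB; rewrite (agreeP _ _ ag) // (agreeP _ _ ag').
have [t [ht t1 tgg']] := tor_separate gi.
have t0 j : t j != 0 by apply: unit_neq0; apply: ht.
have UBt : UB B (tor t).
  apply: blockB_tor => // j jB; apply: t1; by apply: contraNneq jB => ->.
have := avg_invariant (g, g') (f, f) UBt.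
rewrite (bigD1 (g, g')) //= big1 ?addr0 => [|y /negPf yg]; last first.
  by rewrite Skm_tor // eq_sym yg mulr0n mul0r.
rewrite Skm_tor // eqxx mulr1n /= => e; case/eqP: tgg'; apply: (mulIf nz).
by rewrite e mul1r.
Qed.

Let b f g := avg (g, g) (f, f) / (nwords g)%:R.

Let nw0 g : ((nwords g)%:R : C) != 0.
Proof. by rewrite pnatr_eq0 -lt0n nwords_gt0. Qed.

(* diag(b f) commutes with Sym^k A for A in U_B. *)
Lemma avg_commute f A g h : UB B A -> symk A g h * b f h = b f g * symk A g h.
Proof.
move=> hA; have uA := unitary_unit hA.1.
(* Once [symk_tr] has removed the transpose, invariance of the average says that conjugation by
   Sym^k A fixes the diagonal matrix with entries [b f]. *)
have key g1 g2 : \sum_l symk A g1 l * b f l * symk (invmx A) l g2 = b f g1 *+ (g1 == g2).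
  apply: (mulfI (nw0 g2)); transitivity (avg (g1, g2) (f, f)); last first.
    have [<-|ne] := eqVneq g1 g2; last by rewrite avg_diag // mulr0.
    by rewrite /b mulr1n mulrC divfK.
  rewrite -(avg_invariant _ _ hA) big_distrr /=.
  transitivity (\sum_l \sum_l' Skm A (g1, g2) (l, l') * avg (l, l') (f, f)); last first.
    by rewrite pair_big /=; apply: eq_bigr => -[].
  apply: eq_bigr => l _; rewrite (bigD1 l) //= big1 ?addr0 => [|l' ll']; last first.
    by rewrite avg_diag ?mulr0 // eq_sym.
  have := symk_tr (invmx A) l g2; rewrite /Skm /= => e.
  have -> : avg (l, l) (f, f) = b f l * (nwords l)%:R by rewrite /b divfK.
  transitivity (symk A g1 l * b f l * ((nwords g2)%:R * symk (invmx A) l g2)); first by ring.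
  by rewrite e; ring.
transitivity (\sum_g2 (\sum_l symk A g l * b f l * symk (invmx A) l g2) * symk A g2 h).
  have cl l : \sum_g2 symk A g l * b f l * symk (invmx A) l g2 * symk A g2 h =
      symk A g l * b f l * (l == h)%:R.
    rewrite -symk1 -(mulVmx uA) symkM big_distrr /=; apply: eq_bigr => g2 _.
    by rewrite mulrA.
  under eq_bigr => g2 _ do rewrite big_distrl /=.
  rewrite exchange_big /= (bigD1 h) //= cl eqxx mulr1 big1 ?addr0 // => l /negPf lh.
  by rewrite cl lh mulr0.
rewrite (bigD1 g) //= key eqxx big1 ?addr0 // => g2 ne.
by rewrite key eq_sym (negPf ne) mul0r.
Qed.

(** A diagonal matrix commuting with a matrix has equal entries wherever the latter has a nonzero
    coefficient. [spread] links each multiset to the one with its mass in [B] gathered at [j0], and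
    [f] and [g] share this target. *)
Lemma avg_const f g : agree g f -> b f g = b f f.
Proof.
move=> ag; have [->//|ne] := eqVneq g f.
have [j0 jB] : exists j, j \in B.
  apply/existsP; apply: contraT => /existsPn h; case/eqP: ne; apply: val_inj; apply/ffunP => i.
  exact: (agreeP _ _ ag).
have B0 : (0 < #|B|)%N by apply/card_gt0P; exists j0.
have [t et] := content_surj g; have [s es] := content_surj f.
have ec : content (collapse j0 t) = content (collapse j0 s).
  by apply: content_collapse; rewrite et es.
have H u : b f (content (collapse j0 u)) = b f (content u).
  apply: (mulfI (symk_spread_neq0 u jB)); rewrite avg_commute; first by rewrite mulrC.
  exact: spread_UB.
by have := H t; have := H s; rewrite et es ec => <- <-.
Qed.

Lemma avg_Skm g g' f : avg (g, g') (f, f) =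
  if (g == g') && agree g f then (nwords g)%:R / ((nwords f)%:R * #|finset (fun h => agree h f)|%:R) else 0.
Proof.
have [<- /=|ne] := eqVneq g g'; last by rewrite avg_diag.
case: ifPn => ag; last by apply/eqP; apply: contraNT ag => /avg_agree[].
have af : agree f f by apply/agreeP.
have -> : avg (g, g) (f, f) = b f g * (nwords g)%:R by rewrite /b divfK.
rewrite avg_const //.
(* The normalization comes from contracting the two factors: the diagonal sum weighted by
   1/[nwords h] turns the integrand into the (f, f) coefficient of Sym^k(X^-1) Sym^k(X), which is 1,
   divided by [nwords f]. *)
have total : \sum_h b f h = (nwords f)%:R^-1.
  have tS (h : msetk n k) : tame (UB B) (fun X : MxMeas R n => (nwords h)%:R^-1 * @Skm R n k k X (h, h) (f, f)).
    apply: tameM; first exact: tame_cst.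
    exact (@tame_regular R n B _ (@regular_Skm R n k k (h, h) (f, f))).
  transitivity (cint mu (UB B) (fun X => \sum_h (nwords h)%:R^-1 * @Skm R n k k X (h, h) (f, f))).
    rewrite cint_sum //; last exact: haar1 hmu.
    apply: eq_bigr => h _; rewrite cintZ // 1?mulrC //.
    exact (@tame_regular R n B _ (@regular_Skm R n k k (h, h) (f, f))).
  rewrite -[RHS](cint_cst mUB (haar1 hmu)); apply: cint_ext => X hX.
  have uX := unitary_unit hX.1.
  transitivity (\sum_h (nwords f)%:R^-1 * (symk (invmx X) f h * symk X h f)).
    apply: eq_bigr => h _; rewrite /Skm /=; apply: (mulfI (nw0 h)); rewrite mulrA mulfV // mul1r.
    apply: (mulfI (nw0 f)); have e := symk_tr (invmx X) f h.
    rewrite mulrCA -e; field; exact: nw0.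
  by rewrite -big_distrr /= -symkM mulVmx // symk1 eqxx mulr1.
have {total} : b f f * #|finset (fun h => agree h f)|%:R = (nwords f)%:R^-1.
  rewrite -total (bigID (fun h => agree h f)) /= [X in _ + X]big1 => [|h nh]; last first.
    rewrite /b; have [->|/avg_agree[ah _]] := eqVneq (avg (h, h) (f, f)) 0; first by rewrite mul0r.
    by rewrite ah in nh.
  rewrite addr0 (eq_bigr (fun=> b f f)) => [|h ah]; last exact: avg_const.
  by rewrite sumr_const cardsE mulr_natr.
have c0 : (#|finset (fun h => agree h f)|%:R : C) != 0.
  by rewrite pnatr_eq0 -lt0n; apply/card_gt0P; exists f; rewrite inE.
move=> e; apply: (mulIf c0); rewrite mulrAC e invfM.
by rewrite mulrC mulrA divfK.
Qed.

End BlockAverage.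

(** * The torus-invariant part of S_{k,k} is the KMP operator *)

Section KMP.
Variables (R : realType) (n k : nat).
Local Notation C := R[i].
Implicit Types (f g h : msetk n k).

Lemma TorInv_Skm (v : msetk n k * msetk n k -> C) :
  TorInv (@Skm R n k k) v <-> forall g g', g != g' -> v (g, g') = 0.
Proof.
have act (t : 'I_n -> C) g g' : is_torus_elt t -> opapply (@Skm R n k k (tor t)) v (g, g') =
    monom t g * monom (fun i => (t i)^-1) g' * v (g, g').
  move=> ht; have t0 j : t j != 0 by apply: unit_neq0; apply: ht.
  rewrite /opapply (bigD1 (g, g')) //= Skm_tor // eqxx mulr1n big1 ?addr0 // => y /negPf yg.
  by rewrite Skm_tor // eq_sym yg mulr0n mul0r.
split=> [h g g' gg'|h t ht].
  have [i gi] := msetk_neq gg'; have [t [ht _ ne]] := tor_separate R gi.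
  have := congr1 (@^~ (g, g')) (h t ht); rewrite /= act // => e.
  apply/eqP; apply: contraNT ne => v0; apply/eqP; apply: (mulIf v0); by rewrite e mul1r.
apply/funext => -[g g']; rewrite act //.
have [<-|/h ->] := eqVneq g g'; last by rewrite mulr0.
rewrite -big_split /= big1 ?mul1r // => i _; rewrite exprVn divff // expf_neq0 //.
by apply: unit_neq0; apply: ht.
Qed.

Theorem KMP_Skm (w : {set 'I_n} -> R) (mu : {set 'I_n} -> probability (MxMeas R n) R)
  (hmu : forall B : {set 'I_n}, haar_prob (UB B) (mu B)) :
  conj_on [set: msetk n k -> C] (@LKMP R n w k) (TorInv (@Skm R n k k)) (Lop w mu (@Skm R n k k)).
Proof.
(* The kernel found in [avg_Skm] is that of [NB] times [nwords g] / [nwords f]; rescaling by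
   [nwords] cancels this ratio. *)
pose Phi (u : msetk n k -> C) (x : msetk n k * msetk n k) : C :=
  if x.1 == x.2 then (nwords x.1)%:R * u x.1 else 0.
have nw0 g : ((nwords g)%:R : C) != 0 by rewrite pnatr_eq0 -lt0n nwords_gt0.
have alg1 (W N c U : C) : N != 0 -> c != 0 ->
    W * (1 - N / (N * c)) * (N * U) = N * (W * (1 - c^-1) * U).
  by move=> N0 c0; field; rewrite N0 c0.
have alg2 (W M N c U : C) : N != 0 -> c != 0 ->
    W * (0 - M / (N * c)) * (N * U) = M * (W * (0 - c^-1) * U).
  by move=> N0 c0; field; rewrite N0 c0.
exists Phi; split.
- move=> a u v; apply/funext => x; rewrite /Phi; case: ifP => _; ring.
- by move=> u _; apply/TorInv_Skm => g g' /negPf gg'; rewrite /Phi /= gg'.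
- move=> u v _ _ e; apply/funext => g; have := congr1 (@^~ (g, g)) e.
  by rewrite /Phi /= eqxx => /(mulfI (nw0 g)).
- move=> v /TorInv_Skm hv; exists (fun g => v (g, g) / (nwords g)%:R) => //.
  apply/funext => -[g g']; rewrite /Phi /=; have [<-|/hv ->//] := eqVneq g g'.
  by rewrite mulrC divfK.
- move=> u _; apply/funext => -[g g'].
  transitivity (\sum_h Lop w mu (@Skm R n k k) (g, g') (h, h) * ((nwords h)%:R * u h)); last first.
    rewrite /opapply.
    transitivity (\sum_h \sum_h' Lop w mu (@Skm R n k k) (g, g') (h, h') * Phi u (h, h')); last first.
      by rewrite pair_big /=; apply: eq_bigr => -[].
    apply: eq_bigr => h _; rewrite (bigD1 h) //= big1 ?addr0 ?/Phi ?eqxx // => h' /negPf hh'.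
    by rewrite /= eq_sym hh' mulr0.
  have LE h : Lop w mu (@Skm R n k k) (g, g') (h, h) * ((nwords h)%:R * u h) =
      if g == g' then (nwords g)%:R * (LKMP w g h * u h) else 0.
    rewrite /Lop /LKMP.
    transitivity (\sum_(B : {set 'I_n}) (real_complex R (w B) *
        (((g, g') == (h, h))%:R - if (g == g') && agree B g h then
          (nwords g)%:R / ((nwords h)%:R * #|finset (fun h' => agree B h' h)|%:R) else 0)) *
        ((nwords h)%:R * u h)).
      by rewrite -big_distrl /=; congr (_ * _); apply: eq_bigr => B _; rewrite (avg_Skm (hmu B)).
    have [<-|/negPf gg'] := eqVneq g g'; last first.
      apply: big1 => B _; rewrite xpair_eqE; case: eqP => [gh|_]; last by rewrite subr0 !mulr0 mul0r.
      by case: eqP => [g'h|_]; [rewrite gh g'h eqxx in gg'|rewrite subr0 !mulr0 mul0r].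
    rewrite big_distrl /= big_distrr /=; apply: eq_bigr => B _.
    rewrite /NB inE xpair_eqE andbb /= -/(agree B g h).
    have c0 : (#|finset (fun h' => agree B h' h)|%:R : C) != 0.
      rewrite pnatr_eq0 -lt0n; apply/card_gt0P; exists h; rewrite inE; exact/agreeP.
    have -> : finset (fun h' : msetk n k => [forall j, (j \notin B) ==> (val h' j == val h j)]) =
      finset (fun h' => agree B h' h) by [].
    have [gh|gh] := eqVneq g h.
      rewrite gh mulr1n; case: ifP => _; last by ring.
      exact: (alg1 _ _ _ _ (nw0 h) c0).
    rewrite mulr0n; case: ifP => _; last by ring.
    exact: (alg2 _ _ _ _ _ (nw0 h) c0).
  rewrite (eq_bigr _ (fun h _ => LE h)) /Phi /=; case: ifP => _; last by rewrite big1.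
  by rewrite /opapply big_distrr.
Qed.

End KMP.

(** * Matrix coefficients of irreducible representations are regular *)

Section StepFunction.
Variable R : realType.
Implicit Types x y : R.

(* (1 - x^M)^(2^M / 2^m) with M = m^2 tends to 1 for x <= 1/2 and to 0 for 1/2 < x <= 1; this is
   the function of the Brosowski-Deutsch proof of the Stone-Weierstrass theorem. *)
Definition step_poly (m : nat) : {poly R} := (1 - 'X ^+ (m * m)) ^+ (2 ^ (m * m - m)).

Lemma step_polyE m x : (step_poly m).[x] = (1 - x ^+ (m * m)) ^+ (2 ^ (m * m - m)).
Proof. by rewrite /step_poly horner_exp hornerD hornerN hornerC horner_exp hornerX. Qed.

Lemma bernoulli_ge y N : 0 <= y <= 1 -> 1 - N%:R * y <= (1 - y) ^+ N.
Proof.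
move=> /andP[y0 y1]; elim: N => [|N IH]; first by rewrite mul0r subr0 expr0.
have q1 : (1 - y) ^+ N <= 1 by apply: exprn_ile1; lra.
have q0 : 0 <= (1 - y) ^+ N by apply: exprn_ge0; lra.
rewrite exprS -natr1; nra.
Qed.

(** Used as (1 - y)^N <= 1/(1 + N y): it makes the power small when N y is large, whereas
    [bernoulli_ge] keeps it near 1 when N y is small. *)
Lemma bernoulli_le y N : 0 <= y <= 1 -> (1 - y) ^+ N * (1 + N%:R * y) <= 1.
Proof.
move=> /andP[y0 y1]; elim: N => [|N IH]; first by rewrite mul0r addr0 expr0 mulr1.
have q0 : 0 <= (1 - y) ^+ N by apply: exprn_ge0; lra.
have N0 : 0 <= N%:R :> R by apply: ler0n.
rewrite exprS -natr1; set a := (1 - y) ^+ N in IH q0 *; set b := N%:R in N0 IH *.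
apply: le_trans IH; rewrite -subr_ge0.
have -> : a * (1 + b * y) - (1 - y) * a * (1 + (b + 1) * y) = a * (y ^+ 2 * (b + 1)) by ring.
by rewrite mulr_ge0 // mulr_ge0 ?sqr_ge0 // addr_ge0.
Qed.

Lemma bernoulli_pow y N : 0 <= y -> 1 + N%:R * y <= (1 + y) ^+ N.
Proof.
move=> y0; elim: N => [|N IH]; first by rewrite mul0r addr0 expr0.
have N0 : 0 <= N%:R :> R by apply: ler0n.
rewrite exprS -natr1; apply: le_trans (_ : (1 + y) * (1 + N%:R * y) <= _); first nra.
by rewrite ler_wpM2l // addr_ge0.
Qed.

Lemma step_poly01 m x : 0 <= x <= 1 -> 0 <= (step_poly m).[x] <= 1.
Proof.
move=> /andP[x0 x1]; rewrite step_polyE.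
have h : 0 <= x ^+ (m * m) <= 1 by rewrite exprn_ge0 // exprn_ile1.
by apply/andP; split; [apply: exprn_ge0|apply: exprn_ile1]; lra.
Qed.

Lemma step_poly_near x : 0 <= x <= 1 -> exists m0, forall m, (m0 <= m)%N ->
  `|(step_poly m).[x] - (x <= 2^-1)%R%:R| <= 2^-1 ^+ m.
Proof.
move=> /andP[x0 x1].
have mm m : (m <= m * m)%N by case: m => // m; rewrite leq_pmulr.
have pw (m : nat) : (2 ^ (m * m - m))%:R = 2 ^+ (m * m) * 2^-1 ^+ m :> R.
  by rewrite natrX expfB_cond ?pnatr_eq0 ?exprVn.
have y01 m : 0 <= x ^+ (m * m) <= 1 by rewrite exprn_ge0 // exprn_ile1.
(* With y = x^(m^2) and N = 2^(m^2 - m), N y equals (2x)^(m^2) / 2^m. This is at most 2^-m when x <=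
   1/2, and at least 2^m for larger x once (2x)^m >= 4. *)
have [xh|hx] := leP x 2^-1.
  exists 0%N => m _; have /andP[_ s1] := @step_poly01 m x (introT andP (conj x0 x1)).
  rewrite ler0_norm ?subr_le0 // opprB lerBlDl -lerBlDr step_polyE.
  apply: le_trans (bernoulli_ge _ (y01 m)); rewrite lerD2l lerN2 pw.
  rewrite mulrAC -exprMn -[leRHS]mul1r ler_wpM2r ?exprn_ge0 ?invr_ge0 //.
  by apply: exprn_ile1; [rewrite mulr_ge0|lra].
pose r := 2 * x - 1; have r0 : 0 < r by rewrite /r; lra.
(* Beyond 3/r one has 1 + m r >= 4, and Bernoulli's inequality then gives (2x)^m >= 4. *)
have [m0 hm0] : exists m0 : nat, 3 / r < m0%:R.
  by have /archi_boundP h : 0 <= 3 / r by [rewrite divr_ge0 // ltW]; exists (Num.bound (3 / r)).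
exists m0 => m mm0; have /andP[s0 s1] := @step_poly01 m x (introT andP (conj x0 x1)).
rewrite subr0 ger0_norm // step_polyE.
have r4 : 4 <= (2 * x) ^+ m.
  have -> : 2 * x = 1 + r by rewrite /r; ring.
  apply: le_trans (bernoulli_pow m (ltW r0)).
  have : 3 < m%:R * r.
    rewrite -ltr_pdivrMr //; apply: lt_le_trans hm0 _; by rewrite ler_nat.
  lra.
have big : 2 ^+ m <= (2 ^ (m * m - m))%:R * x ^+ (m * m).
  rewrite pw mulrAC -exprMn exprM -exprMn; apply: lerXn2r; rewrite ?nnegrE //; last lra.
  by rewrite mulr_ge0 // exprn_ge0 // mulr_ge0.
have := bernoulli_le (2 ^ (m * m - m)) (y01 m).
set a := _ ^+ (2 ^ _); have a0 : 0 <= a by rewrite /a -step_polyE.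
move=> h; rewrite exprVn -[leRHS]mul1r ler_pdivlMr //.
apply: le_trans h; rewrite ler_wpM2l //; apply: le_trans big _; by rewrite lerDr.
Qed.

Lemma cvg_near_geometric (u : nat -> R) l m0 :
  (forall m, (m0 <= m)%N -> `|u m - l| <= 2^-1 ^+ m) -> u @ \oo --> l.
Proof.
move=> h; apply/cvgrPdist_le => e e0.
have c : (fun m : nat => 2^-1 ^+ m : R) @ \oo --> (0 : R).
  by apply: cvg_expr; rewrite ger0_norm ?invr_ge0 // invf_lt1 // ltr1n.
move/cvgrPdist_le: c => /(_ e e0) c; near=> m.
rewrite distrC; apply: le_trans (h m _) _; first by near: m; exists m0.
have : `|0 - 2^-1 ^+ m : R| <= e by near: m; exact: c.
by rewrite sub0r normrN ger0_norm // exprn_ge0 // invr_ge0.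
Unshelve. all: by end_near. Qed.

Lemma step_poly_cvg x : 0 <= x <= 1 -> (fun m => (step_poly m).[x]) @ \oo --> ((x <= 2^-1)%R%:R : R).
Proof. by move=> /step_poly_near[m0 h]; apply: cvg_near_geometric h. Qed.

End StepFunction.

Section RealIntegral.
Context d (T : measurableType d) (R : realType) (mu : probability T R) (D : set T).
Hypothesis mD : measurable D.
Hypothesis muD : mu D = 1%E.
Implicit Types f g : T -> R.
Local Notation I f := (Rintegral mu D f).

Lemma IntD f g : rtame D f -> rtame D g -> I (fun x => f x + g x) = I f + I g.
Proof. by move=> tf tg; rewrite RintegralD //; exact: rtame_int. Qed.

Lemma IntZ c f : rtame D f -> I (fun x => c * f x) = c * I f.
Proof. by move=> tf; rewrite RintegralZl //; exact: rtame_int. Qed.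

Lemma IntB f g : rtame D f -> rtame D g -> I (fun x => f x - g x) = I f - I g.
Proof. by move=> tf tg; rewrite RintegralB //; exact: rtame_int. Qed.

Lemma Int_le f g : rtame D f -> rtame D g -> (forall x, D x -> f x <= g x) -> I f <= I g.
Proof. by move=> tf tg; apply: le_Rintegral => //; exact: rtame_int. Qed.

Lemma Int_norm f : rtame D f -> `|I f| <= I (fun x => `|f x|).
Proof. by move=> tf; apply: le_normr_Rintegral => //; exact: rtame_int. Qed.

Lemma Int_ext f g : (forall x, D x -> f x = g x) -> I f = I g.
Proof. by move=> e; apply: eq_Rintegral => x /set_mem; apply: e. Qed.

Lemma Int_dct (f_ : nat -> T -> R) f M : (forall m, measurable_fun D (f_ m)) -> measurable_fun D f ->
  (forall m x, D x -> `|f_ m x| <= M) ->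
  (forall x, D x -> (fun m => f_ m x) @ \oo --> f x) ->
  forall e, 0 < e -> exists m, I (fun x => `|f_ m x - f x|) <= e.
Proof.
move=> mf_ mf hM hc e e0.
have hcE x : D x -> (fun m => (f_ m x)%:E) @ \oo --> (f x)%:E.
  by move=> Dx; apply: cvg_EFin; [exact: nearW|exact: hc].
have [_ c _] := @dominated_convergence _ T R mu D mD (fun m x => (f_ m x)%:E) (fun x => (f x)%:E)
  (fun=> M%:E) (fun m => (measurable_EFinP _ _).2 (mf_ m)) ((measurable_EFinP _ _).2 mf)
  (aeW _ hcE)
  (rtame_int mu mD (rtame_cst D M)) (aeW _ (fun x m Dx => hM m x Dx)).
move/fine_cvgP: c => [_ /cvgrPdist_le /(_ e e0) [N _ hN]]; exists N.
have := hN N (leqnn N); rewrite /= sub0r normrN => h; apply: le_trans h.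
by apply: ler_norm.
Qed.

End RealIntegral.

(** * L^1 density of regular functions on the unitary group *)

Section Approximation.
Variables (R : realType) (n : nat).
Local Notation C := R[i].
Local Notation T := (MxMeas R n).
Local Notation G := (UB [set: 'I_n]%SET : set T).
Variable mu : probability T R.
Hypothesis hmu : haar_prob (UB [set: 'I_n]%SET) mu.
Implicit Types (E F : set T) (q : T -> R).

Let mG : measurable G := measurable_UB [set: 'I_n]%SET.
Let muG : mu G = 1%E := haar1 hmu.
Local Notation I f := (Rintegral mu G f).

Definition rregular q := exists2 p : 'M[C]_n -> C, regular p &
  forall A, unitary A -> p A = (q A)%:C%C.

Lemma rregular_cst c : rregular (fun=> c).
Proof. by exists (fun=> c%:C%C) => //; exact: regular_c. Qed.

Lemma rregularD q q' : rregular q -> rregular q' -> rregular (fun X => q X + q' X).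
Proof.
move=> [p rp e] [p' rp' e']; exists (fun A => p A + p' A); first exact: regularD.
by move=> A uA; rewrite e // e' // rmorphD.
Qed.

Lemma rregularM q q' : rregular q -> rregular q' -> rregular (fun X => q X * q' X).
Proof.
move=> [p rp e] [p' rp' e']; exists (fun A => p A * p' A); first exact: regularM.
by move=> A uA; rewrite e // e' // rmorphM.
Qed.

Lemma rregularB q q' : rregular q -> rregular q' -> rregular (fun X => q X - q' X).
Proof.
move=> [p rp e] [p' rp' e']; exists (fun A => p A - p' A); first exact: regularB.
by move=> A uA; rewrite e // e' // rmorphB.
Qed.

Lemma rregularX q m : rregular q -> rregular (fun X => q X ^+ m).
Proof.
move=> [p rp e]; exists (fun A => p A ^+ m); first exact: regularX.
by move=> A uA; rewrite e // rmorphXn.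
Qed.

(** Conjugation is not algebraic, but on unitary matrices the conjugate of an entry is an entry of
    the inverse. Real and imaginary parts are thus available among regular functions. *)
Lemma rregular_Re (i j : 'I_n) : rregular (fun X : T => complex.Re ((X : 'M[C]_n) i j)).
Proof.
exists (fun A : 'M[C]_n => 2^-1 * (A i j + invmx A j i)).
  by apply: regularZ; apply: regularD; [apply: regular_entry|apply: regular_inv].
move=> A uA; rewrite (unitary_inv uA) !mxE.
by rewrite (ReJ_add (A i j)) mulrC.
Qed.

Lemma rregular_Im (i j : 'I_n) : rregular (fun X : T => complex.Im ((X : 'M[C]_n) i j)).
Proof.
exists (fun A : 'M[C]_n => (2^-1 * 'i%C) * (invmx A j i - A i j)).
  by apply: regularZ; apply: regularB; [apply: regular_inv|apply: regular_entry].
move=> A uA; rewrite (unitary_inv uA) !mxE.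
by rewrite (ImJ_sub (A i j)); ring.
Qed.

Lemma rregular_tame q : rregular q -> rtame G q.
Proof.
move=> [p rp e]; have [tp _] := tame_regular [set: 'I_n]%SET rp.
by apply: rtame_ext tp => X /UB_unitary uX; rewrite e.
Qed.

(** These sets form a sigma-algebra, so only preimages of half-lines under the real and imaginary
    parts of the entries need an explicit approximation. *)
Definition approx E := measurable E /\
  forall e, 0 < e -> exists2 q, rregular q & I (fun X => `|\1_E X - q X|) <= e.

Lemma rtame_indic E : measurable E -> rtame G (\1_E : T -> R).
Proof.
move=> mE; split; first exact: measurable_indic.
by exists 1 => X _; rewrite indicE; case: (_ \in _); rewrite ?normr1 ?normr0 ?ler01.
Qed.

Lemma approx0 : approx set0.
Proof.
split=> // e e0; exists (fun=> 0); first exact: rregular_cst.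
rewrite (Int_ext mu (g := fun=> 0)) => [|X _]; last by rewrite indic0 subrr normr0.
by rewrite Rintegral_cst // mul0r ltW.
Qed.

Lemma approxC E : approx E -> approx (~` E).
Proof.
move=> [mE hE]; split=> [|e e0]; first exact: measurableC.
have [q rq hq] := hE e e0; exists (fun X => 1 - q X).
  by apply: rregularB => //; apply: rregular_cst.
rewrite (Int_ext mu (g := fun X => `|\1_E X - q X|)) // => X _.
have -> : \1_(~` E) X = 1 - \1_E X :> R.
  by rewrite !indicE in_setC; case: (X \in E); rewrite ?subrr ?subr0.
have -> : 1 - \1_E X - (1 - q X) = - (\1_E X - q X) by ring.
exact: normrN.
Qed.

Lemma approxI E F : approx E -> approx F -> approx (E `&` F).
Proof.
move=> [mE hE] [mF hF]; split=> [|e e0]; first exact: measurableI.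
have e2 : 0 < e / 2 by rewrite divr_gt0.
have [p rp hp] := hE _ e2; have tp := rregular_tame rp; have [_ [M hM]] := tp.
(* [p] is chosen before [q], because its bound [K] enters the tolerance for [q]: |1_E 1_F - p q| <=
   |1_E - p| + K |1_F - q|. *)
pose K := `|M| + 1; have K0 : 0 < K by rewrite /K ltr_pwDr.
have [q rq hq] := hF _ (divr_gt0 e2 K0); have tq := rregular_tame rq.
exists (fun X => p X * q X); first exact: rregularM.
have tE := rtame_indic mE; have tF := rtame_indic mF.
have tEF := rtame_indic (measurableI _ _ mE mF).
have t1 := rtame_norm (rtameB tE tp); have t2 := rtame_norm (rtameB tF tq).
apply: (@le_trans _ _ (I (fun X => `|\1_E X - p X| + K * `|\1_F X - q X|))).
  apply: Int_le => //.
  - by apply: rtame_norm; apply: rtameB => //; apply: rtameM.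
  - by apply: rtameD => //; apply: rtameM => //; apply: rtame_cst.
  move=> X GX; rewrite indicI /=.
  have -> : \1_E X * \1_F X - p X * q X = (\1_E X - p X) * \1_F X + p X * (\1_F X - q X) :> R by ring.
  apply: le_trans (ler_normD _ _) _; apply: lerD; rewrite normrM.
    rewrite -[leRHS]mulr1 ler_wpM2l // indicE.
    by case: (_ \in _); rewrite ?normr1 ?normr0.
  rewrite ler_wpM2r //; apply: le_trans (hM X GX) _.
  by rewrite /K (le_trans (ler_norm M)) // lerDl.
rewrite IntD //; last by apply: rtameM => //; apply: rtame_cst.
rewrite IntZ // [leRHS](_ : e = e / 2 + K * (e / 2 / K)); last by field; rewrite gt_eqF.
by apply: lerD => //; rewrite ler_pM2l.
Qed.

Lemma approxU E F : approx E -> approx F -> approx (E `|` F).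
Proof.
move=> aE aF; rewrite -[E `|` F]setCK setCU; apply: approxC.
by apply: approxI; apply: approxC.
Qed.

Lemma approx_limit E (f_ : nat -> T -> R) (M : R) : measurable E ->
  (forall m, rtame G (f_ m)) ->
  (forall m X, G X -> `|f_ m X| <= M) ->
  (forall X, G X -> (fun m => f_ m X) @ \oo --> (\1_E X : R)) ->
  (forall m (e : R), 0 < e -> exists2 q, rregular q & I (fun X => `|f_ m X - q X|) <= e) ->
  approx E.
Proof.
move=> mE tf hM hc hf; split=> // e e0.
have e2 : 0 < e / 2 by rewrite divr_gt0.
have tE := rtame_indic mE.
have [m hm] := Int_dct mu mG (fun m => (tf m).1) tE.1 hM hc e2.
have [q rq hq] := hf m _ e2; exists q => //; have tq := rregular_tame rq.
have t1 := rtame_norm (rtameB (tf m) tE); have t2 := rtame_norm (rtameB (tf m) tq).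
apply: (@le_trans _ _ (I (fun X => `|f_ m X - \1_E X| + `|f_ m X - q X|))).
  apply: Int_le => //; [by apply: rtame_norm; apply: rtameB|by apply: rtameD|].
  move=> X _; have -> : \1_E X - q X = - (f_ m X - \1_E X) + (f_ m X - q X) by ring.
  by apply: le_trans (ler_normD _ _) _; rewrite normrN.
by rewrite IntD // [leRHS]splitr lerD.
Qed.

Lemma approx_bigcup (F : nat -> set T) : (forall m, approx (F m)) -> approx (\bigcup_m F m).
Proof.
move=> aF; pose U m := \big[setU/set0]_(i < m) F i.
have aU m : approx (U m).
  rewrite /U; elim: m => [|m IH]; first by rewrite big_ord0; exact: approx0.
  by rewrite big_ord_recr; exact: approxU.
have UE l X : U l X <-> exists2 m, (m < l)%N & F m X by rewrite /U -bigcup_mkord.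
apply: (@approx_limit _ (fun m => \1_(U m)) 1) => [||m X _|X _|m].
- by apply: bigcupT_measurable => m; case: (aF m).
- by move=> m; apply: rtame_indic; case: (aU m).
- by rewrite indicE; case: (_ \in _); rewrite ?normr1 ?normr0 ?ler01.
- have [[m _ Fm]|nF] := pselect ((\bigcup_m F m) X).
    apply: (@cvg_near_geometric _ _ _ m.+1) => l ml; rewrite !indicE.
    have -> : X \in U l by apply/mem_set/UE; exists m.
    have -> : X \in \bigcup_m F m by apply/mem_set; exists m.
    by rewrite subrr normr0 exprn_ge0 ?invr_ge0.
  apply: (@cvg_near_geometric _ _ _ 0) => l _; rewrite !indicE.
  have -> : (X \in U l) = false by apply: memNset => /UE[m _ Fm]; apply: nF; exists m.
  have -> : (X \in \bigcup_m F m) = false by apply: memNset.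
  by rewrite subrr normr0 exprn_ge0 ?invr_ge0.
- by have [_] := aU m.
Qed.

Lemma approx_le (l : T -> R) c : measurable [set X | l X <= c] -> rregular l -> approx [set X | l X <= c].
Proof.
move=> mE rl; have [_ [M hM]] := rregular_tame rl.
pose K := `|M| + `|c| + 1; have K0 : 0 < K by rewrite /K ltr_wpDl ?addr_ge0.
(* Affine rescaling that carries the values of [l] on the group into [0, 1] and the threshold [c] to
   1/2, where [step_poly] jumps. *)
pose x X := (l X - c) / (2 * K) + 2^-1.
have rx : rregular x.
  apply: rregularD; last exact: rregular_cst.
  apply: (@rregularM (fun X => l X - c)); last exact: rregular_cst.
  by apply: rregularB => //; apply: rregular_cst.
have x01 X : G X -> 0 <= x X <= 1.
  move=> /hM hX; have hl := le_trans hX (ler_norm M).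
  have : `|l X - c| <= K.
    by apply: le_trans (ler_normB _ _) _; rewrite /K -addrA lerD // lerDl.
  rewrite ler_norml => /andP[h1 h2]; rewrite /x.
  have e : (l X - c) / (2 * K) = ((l X - c) / K) / 2 by field; rewrite gt_eqF.
  have b1 : (l X - c) / K <= 1 by rewrite ler_pdivrMr // mul1r.
  have b2 : -1 <= (l X - c) / K by rewrite ler_pdivlMr // mulN1r.
  by rewrite e; apply/andP; split; lra.
have xh X : (x X <= 2^-1) = (l X <= c).
  by rewrite /x -lerBrDr subrr pmulr_lle0 ?subr_le0 // invr_gt0 mulr_gt0.
have rs m : rregular (fun X => (step_poly R m).[x X]).
  have [p rp e] : rregular (fun X => (1 - x X ^+ (m * m)) ^+ (2 ^ (m * m - m))).
    by apply: rregularX; apply: rregularB; [exact: rregular_cst|exact: rregularX].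
  by exists p => // A uA; rewrite e // step_polyE.
apply: (@approx_limit _ (fun m X => (step_poly R m).[x X]) 1) => // [m|m X /x01 h|X /x01 h|m e e0].
- exact: rregular_tame.
- by have /andP[s0 s1] := step_poly01 m h; rewrite ger0_norm.
- have := step_poly_cvg h; rewrite xh indicE.
  suff -> : (X \in [set X | l X <= c]) = (l X <= c) by [].
  by apply/idP/idP => [/set_mem|/mem_set].
- exists (fun X => (step_poly R m).[x X]) => //.
  rewrite (Int_ext mu (g := fun=> 0)) => [|X _]; last by rewrite subrr normr0.
  by rewrite Rintegral_cst // mul0r ltW.
Qed.

Lemma approx_preimage (l : T -> R) (Y : set R) :
  measurable_fun setT l -> rregular l -> measurable Y -> approx (l @^-1` Y).
Proof.
move=> ml rl; rewrite [measurable](RGenOInfty.measurableE R).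
move: Y; apply: smallest_sub; first split.
- by rewrite preimage_set0; exact: approx0.
- by move=> A aA; rewrite setTD preimage_setC; exact: approxC.
- by move=> A aA; rewrite preimage_bigcup; exact: approx_bigcup.
- move=> _ [c ->]; rewrite -[X in approx X]setCK; apply: approxC.
  have -> : ~` (l @^-1` `]c, +oo[%classic) = [set X | l X <= c].
    apply/seteqP; split=> X /=; rewrite in_itv /= andbT; first by move/negP; rewrite -leNgt.
    by rewrite leNgt => /negP.
  apply: approx_le => //.
  rewrite -[X in measurable X]setTI.
  have -> : [set X | l X <= c] = l @^-1` `]-oo, c]%classic.
    by apply/seteqP; split=> X /=; rewrite in_itv.
  exact: ml.
Qed.

Lemma approx_measurable E : measurable E -> approx E.
Proof.
move: E; apply: smallest_sub; first split.
- exact: approx0.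
- by move=> A aA; rewrite setTD; exact: approxC.
- by move=> A aA; exact: approx_bigcup.
- move=> E [i [j [Y [mY e]]]]; have [mr mi] := @cmeas_entry R n i j.
  case: e => ->.
    exact: (approx_preimage mr (rregular_Re i j) mY).
  exact: (approx_preimage mi (rregular_Im i j) mY).
Qed.

(** Indicators are L^1 limits of regular functions, so [h] is orthogonal to all of them; with E = {h
    >= 0} one has |h| = 2 1_E h - h. *)
Lemma regular_dense_real (h : T -> R) : rtame G h ->
  (forall q, rregular q -> I (fun X => q X * h X) = 0) -> I (fun X => `|h X|) = 0.
Proof.
move=> th h0; have [mh [M hM]] := th.
have zero E : measurable E -> I (fun X => \1_E X * h X) = 0.
  move=> mE; apply/eqP; rewrite -normr_le0; apply/ler_addgt0Pl => e e0.
  rewrite addr0; pose K := `|M| + 1; have K0 : 0 < K by rewrite /K ltr_pwDr.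
  have [_ aE] := approx_measurable mE; have [q rq hq] := aE _ (divr_gt0 e0 K0).
  have tE := rtame_indic mE; have tq := rregular_tame rq.
  have -> : I (fun X => \1_E X * h X) = I (fun X => (\1_E X - q X) * h X).
    rewrite [RHS](Int_ext mu (g := fun X => \1_E X * h X - q X * h X)); last first.
      by move=> X _; rewrite mulrBl.
    have t1 := rtameM tE th; have t2 := rtameM tq th.
    by rewrite (IntB mu mG t1 t2) (h0 _ rq) subr0.
  have t := rtameM (rtameB tE tq) th.
  apply: le_trans (Int_norm mu mG t) _.
  apply: (@le_trans _ _ (I (fun X => K * `|\1_E X - q X|))).
    apply: Int_le => //; first exact: rtame_norm.
      by apply: rtameM; [exact: rtame_cst|apply: rtame_norm; exact: rtameB].
    move=> X /hM hX; rewrite normrM mulrC ler_wpM2r //.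
    by apply: le_trans hX _; rewrite /K (le_trans (ler_norm M)) // lerDl.
  rewrite IntZ //; last by apply: rtame_norm; apply: rtameB.
  by rewrite mulrC -ler_pdivlMr.
pose E := G `&` h @^-1` `[0, +oo[%classic.
have mE : measurable E by apply: mh.
have tE := rtame_indic mE.
rewrite (Int_ext mu (g := fun X => 2 * (\1_E X * h X) - 1 * h X)) => [|X GX].
  have t1 := rtameM tE th; have t2 := rtameM (rtame_cst G 2) t1.
  have t3 := rtameM (rtame_cst G 1) th.
  by rewrite (IntB mu mG t2 t3) (IntZ mu mG 2 t1) (zero _ mE) mulr0 h0 ?subr0 //; exact: rregular_cst.
have [hX|hX] := leP 0 (h X).
  have -> : \1_E X = 1 :> R by rewrite indicE mem_set //; split=> //=; rewrite in_itv /= hX.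
  by rewrite ger0_norm //; ring.
have -> : \1_E X = 0 :> R.
  by rewrite indicE memNset // => -[_ /=]; rewrite in_itv /= andbT leNgt hX.
by rewrite ltr0_norm //; ring.
Qed.

(** Orthogonality to regular functions makes |Re h| and |Im h| integrate to 0, after which any
    bounded factor is harmless. *)
Lemma regular_dense (h q : T -> C) : tame G h -> tame G q ->
  (forall p, regular p -> cint mu G (fun X => p X * h X) = 0) ->
  cint mu G (fun X => q X * h X) = 0.
Proof.
move=> [t1 t2] [q1 q2] h0.
have h12 p : rregular p -> I (fun X => p X * complex.Re (h X)) = 0 /\ I (fun X => p X * complex.Im (h X)) = 0.
  move=> [p' rp' e]; have := h0 p' rp'; rewrite /cint => -[e1 e2]; split.
    rewrite -[RHS]e1; apply: Int_ext => X /UB_unitary uX; rewrite e // ReM /=; ring.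
  rewrite -[RHS]e2; apply: Int_ext => X /UB_unitary uX; rewrite e // ImM /=; ring.
have z1 := regular_dense_real t1 (fun p rp => (h12 p rp).1).
have z2 := regular_dense_real t2 (fun p rp => (h12 p rp).2).
have kill (a b : T -> R) : rtame G a -> rtame G b -> I (fun X => `|b X|) = 0 -> I (fun X => a X * b X) = 0.
  move=> ta tb z; apply/eqP; rewrite -normr_le0; apply: le_trans (Int_norm mu mG (rtameM ta tb)) _.
  have [_ [M hM]] := ta.
  rewrite -[leRHS](mulr0 M) -z -IntZ //; last exact: rtame_norm.
  apply: Int_le => //; [by apply: rtame_norm; exact: rtameM| |].
    by apply: rtameM; [exact: rtame_cst|exact: rtame_norm].
  by move=> X /hM hX; rewrite normrM ler_wpM2r.
have k11 := kill _ _ q1 t1 z1; have k12 := kill _ _ q1 t2 z2.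
have k21 := kill _ _ q2 t1 z1; have k22 := kill _ _ q2 t2 z2.
have e1 : I (fun X => complex.Re (q X * h X)) = 0.
  rewrite (Int_ext mu (g := fun X => complex.Re (q X) * complex.Re (h X) - complex.Im (q X) * complex.Im (h X))).
    by rewrite (IntB mu mG (rtameM q1 t1) (rtameM q2 t2)) k11 k22 subr0.
  by move=> X _; rewrite ReM.
have e2 : I (fun X => complex.Im (q X * h X)) = 0.
  rewrite (Int_ext mu (g := fun X => complex.Re (q X) * complex.Im (h X) + complex.Im (q X) * complex.Re (h X))).
    by rewrite (IntD mu mG (rtameM q1 t2) (rtameM q2 t1)) k12 k21 addr0.
  by move=> X _; rewrite ImM.
by rewrite /cint e1 e2.
Qed.

End Approximation.

Section Subspaces.
Variables (R : realType) (I : finType).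
Local Notation C := R[i].
Implicit Types (c v : I -> C) (W : set (I -> C)).

Definition pairing c v : C := \sum_x c x * v x.

(** Biduality in finite dimension. [W] is a predicate without a basis, so a matrix of maximal rank
    with row space inside [W] is taken. By maximality its row space is all of [W], and a nonzero
    vector annihilated by it would contradict separation. *)
Lemma separating_full W : lin_subspace W ->
  (forall v, (forall c, W c -> pairing c v = 0) -> v = fun=> 0) -> forall c, W c.
Proof.
move=> [W0 Wlin] sep.
pose N := #|I|; pose fn (r : 'rV[C]_N) : I -> C := fun x => r 0 (enum_rank x).
have fn_lin a (u v : 'rV[C]_N) : fn (a *: u + v) = fun x => a * fn u x + fn v x.
  by apply/funext => x; rewrite /fn !mxE.
have fn_row c : fn (\row_i c (enum_val i)) = c.
  by apply/funext => x; rewrite /fn mxE enum_rankK.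
pose inW (A : 'M[C]_N) := forall D : 'rV[C]_N, W (fn (D *m A)).
pose hasrank r := `[< exists2 A, inW A & \rank A = r >].
have ex0 : exists r, hasrank r.
  exists 0%N; apply/asboolP; exists 0; last exact: mxrank0.
  move=> D; rewrite mulmx0 (_ : fn 0 = fun=> 0) //.
  by apply/funext => x; rewrite /fn mxE.
have bd r : hasrank r -> (r <= N)%N by move=> /asboolP[A _ <-]; apply: rank_leq_row.
case: (ex_maxnP ex0 bd) => r /asboolP[A AW Ar] rmax.
have sub c : W c -> (\row_i c (enum_val i) <= A)%MS.
  move=> Wc; set u := \row_i _.
  have : (\rank (A + u)%MS <= \rank A)%N.
    rewrite Ar; apply: rmax; apply/asboolP; exists (A + u)%MS => // D.
    have : (D *m (A + u)%MS <= A + u)%MS by apply: submxMl.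
    move=> /sub_addsmxP[[E F] /= ->].
    have [e ->] : exists e, F *m u = e *: u.
      exists (F 0 0); by apply/rowP => i; rewrite !mxE big_ord1 [u _ _]mxE.
    rewrite addrC fn_lin; apply: Wlin => //.
    by rewrite fn_row.
  rewrite leqNgt => /negP lt; apply/negPn/negP => nle; apply: lt.
  rewrite (ltn_leqif (mxrank_leqif_sup (addsmxSl A u))).
  by apply: contra nle => /(submx_trans (addsmxSr A u)).
have full : row_full A.
  rewrite /row_full eqn_leq rank_leq_col /= leqNgt; apply/negP => lt.
  have : kermx A^T != 0 by rewrite kermx_eq0 /row_free mxrank_tr neq_ltn lt.
  move/rowV0Pn => [v /sub_kermxP vA v0]; case/eqP: v0.
  have e : fn v = fun=> 0.
    apply: sep => c /sub /submxP[D eD].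
    have : \row_i c (enum_val i) *m v^T = 0.
      by rewrite eD -mulmxA -[A]trmxK -trmx_mul vA trmx0 mulmx0.
    move=> /matrixP/(_ 0 0); rewrite !mxE => e; rewrite -[RHS]e /pairing.
    rewrite (reindex (@enum_val I predT)) /=; last first.
      by exists enum_rank => x _; rewrite ?enum_valK ?enum_rankK.
    by apply: eq_bigr => i _; rewrite !mxE /fn enum_valK.
  apply/rowP => i; have := congr1 (@^~ (enum_val i)) e.
  by rewrite /= /fn enum_valK mxE.
move=> c; rewrite -(fn_row c); have /submxP[D ->] := submx_full (\row_i c (enum_val i)) full.
exact: AW.
Qed.

(** The dual of an irreducible representation is irreducible, because the annihilator of an
    invariant space of covectors is a subrepresentation. *)
Lemma irreducible_functionals n (rho : 'M[C]_n -> I -> I -> C) W : irreducible rho -> lin_subspace W ->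
  (forall c A, unitary A -> W c -> W (fun y => pairing c (fun x => rho A x y))) ->
  (exists2 c, W c & c <> fun=> 0) -> forall c, W c.
Proof.
move=> [I0 irr] Wlin Wact [c1 Wc1 c10].
pose V v := forall c, W c -> pairing c v = 0.
have V_lin : lin_subspace V.
  split=> [c _|a u v hu hv c hc]; first by rewrite /pairing big1 // => z _; rewrite mulr0.
  transitivity (a * pairing c u + pairing c v); last by rewrite hu // hv // mulr0 addr0.
  by rewrite /pairing big_distrr -big_split /=; apply: eq_bigr => z _; ring.
have V_act A : unitary A -> forall v, V v -> V (opapply (rho A) v).
  move=> uA v hv c hc; rewrite -[RHS](hv _ (Wact c A uA hc)) /pairing /opapply.
  under eq_bigr => z _ do rewrite big_distrr /=.
  rewrite exchange_big /=; apply: eq_bigr => z _; rewrite big_distrl /=.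
  by apply: eq_bigr => z' _; ring.
case: (irr V V_lin V_act) => [V0|VT]; first exact: (separating_full Wlin V0).
case: c10; apply/funext => z; have := VT (fun x => (x == z)%:R) c1 Wc1.
rewrite /pairing (bigD1 z) //= eqxx mulr1 big1 ?addr0 // => z' /negPf ->.
by rewrite mulr0.
Qed.

End Subspaces.

(** * Boundedness of measurable representations, then regularity of irreducible ones *)

Section MeasurableRep.
Variables (R : realType) (n : nat) (mu : {set 'I_n} -> probability (MxMeas R n) R).
Hypothesis hmu : forall B : {set 'I_n}, haar_prob (UB B) (mu B).
Local Notation C := R[i].
Local Notation T := (MxMeas R n).
Local Notation G := (UB [set: 'I_n]%SET : set T).
Local Notation muT := (mu [set: 'I_n]%SET).
Let mG : measurable G := measurable_UB [set: 'I_n]%SET.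
Let muG : muT G = 1%E := haar1 (hmu _).

Variables (I : finType) (rho : 'M[C]_n -> I -> I -> C).
Hypothesis hrho : is_rep rho.

Lemma rep1 : rho 1%:M = fun x y => (x == y)%:R.
Proof. by case: hrho => h _ _; apply/funext => x; apply/funext => y. Qed.

Lemma repM A B x z : unitary A -> unitary B -> rho (A *m B) x z = \sum_y rho A x y * rho B y z.
Proof. by move=> uA uB; case: hrho => _ h _; apply: h. Qed.

Lemma opapply_repM A B v : unitary A -> unitary B ->
  opapply (rho (A *m B)) v = opapply (rho A) (opapply (rho B) v).
Proof.
move=> uA uB; apply/funext => x; rewrite /opapply.
under eq_bigr => y _ do rewrite repM // big_distrl /=.
rewrite exchange_big /=; apply: eq_bigr => y _; rewrite big_distrr /=.
by apply: eq_bigr => z _; rewrite mulrA.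
Qed.

Lemma opapply_rep1 v : opapply (rho 1%:M) v = v.
Proof.
apply/funext => x; rewrite /opapply rep1 (bigD1 x) //= eqxx mul1r big1 ?addr0 // => y /negPf yx.
by rewrite eq_sym yx mul0r.
Qed.

(** This is the inverse on unitary matrices, given by a formula whose measurability on all matrices
    is clear entry by entry. *)
Let adj (X : T) : T := (map_mx Num.conj (X : 'M[C]_n))^T.

Let adjE (X : T) : G X -> adj X = invmx (X : 'M[C]_n).
Proof. by move=> /UB_unitary uX; rewrite (unitary_inv uX). Qed.

Let adjG : adj @^-1` G `&` G = G.
Proof.
by apply/seteqP; split=> [X []//|X GX]; split=> //=; rewrite adjE //; exact: UB_inv.
Qed.

Let ReIm (b : bool) (z : C) : R := if b then complex.Re z else complex.Im z.

Let mrho b x y : measurable_fun G (fun X : T => ReIm b (rho X x y)).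
Proof. by case: hrho => _ _ /(_ x y)[m1 m2]; rewrite UBT; case: b. Qed.

Let mrhoV b x y : measurable_fun G (fun X : T => ReIm b (rho (adj X) x y)).
Proof.
move=> _ Y mY; rewrite -{1}adjG setIAC; apply: measurableI => //.
have := @measurable_adj R n measurableT _ (@mrho b x y mG Y mY).
rewrite setTI; congr measurable; apply/seteqP; split=> X //=.
Qed.

Let E (N : nat) : set T := \bigcap_(p in [set: bool * bool * I * I])
  (G `&` (fun X : T => ReIm p.1.1.1 (if p.1.1.2 then rho X p.1.2 p.2 else rho (adj X) p.1.2 p.2))
    @^-1` `[- N%:R, N%:R]%classic).

Let mE N : measurable (E N).
Proof.
apply: fin_bigcap_measurable => // -[[[b c] x] y] _ /=.
by case: c; [apply: (@mrho b x y mG)|apply: (@mrhoV b x y mG)].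
Qed.

Let E_bound N X : E N X -> forall b x y, `|ReIm b (rho X x y)| <= N%:R /\ `|ReIm b (rho (adj X) x y)| <= N%:R.
Proof.
move=> hX b x y; have [_ /= h1] := hX (b, true, x, y) Logic.I.
have [_ /= h2] := hX (b, false, x, y) Logic.I.
by move: h1 h2; rewrite !in_itv /= -!ler_norml.
Qed.

Let E_big : exists N, (2^-1%:E < muT (E N))%E \/ #|I| = 0%N.
Proof.
have [I0|I0] := eqVneq #|I| 0%N; first by exists 0%N; right.
have [x0 _] : exists x : I, x \in I by apply/existsP; rewrite -lt0n in I0; case/card_gt0P: I0 => x _; apply/existsP; exists x.
have cup : \bigcup_N E N = G.
  apply/seteqP; split=> [X [N _ hX]|X GX].
    by case: (hX (true, true, x0, x0) Logic.I).
  pose M := \sum_(p : bool * bool * I * I) `|ReIm p.1.1.1 (if p.1.1.2 then rho X p.1.2 p.2 else rho (adj X) p.1.2 p.2)|.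
  have M0 : 0 <= M by apply: sumr_ge0.
  exists (Num.bound M) => // p _; split=> //=; rewrite in_itv /= -ler_norml.
  apply: le_trans (ltW (archi_boundP M0)); rewrite /M (bigD1 p) //= lerDl.
  exact: sumr_ge0.
have nd : nondecreasing_seq E.
  move=> N1 N2 N12; apply/subsetPset => X hX p hp; have [GX /= h] := hX p hp; split=> //=.
  move: h; rewrite !in_itv /= -!ler_norml => h; apply: le_trans h _; by rewrite ler_nat.
have c := @nondecreasing_cvg_mu _ _ _ muT E mE _ nd.
have {c} : muT (E N) @[N --> \oo] --> (1%E : \bar R).
  by rewrite -muG -cup; apply: c; apply: bigcupT_measurable.
move/fine_cvgP => [_ /cvgrPdist_le /(_ 4^-1)].
rewrite invr_gt0 => /(_ (ltr0n _ 4)) [N _ /(_ N (leqnn N)) /=] hN; exists N; left.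
rewrite -[muT (E N)]fineK ?fin_num_measure // lte_fin.
have := ler_norm (1 - fine (muT (E N))); lra.
Qed.

(** A Steinhaus-type argument, for which measurability is enough. For large N the set [E N], where
    rho(X) and rho(X^-1) have coefficients bounded by N, and its preimage under translation by A
    both have measure above 1/2. They share a point X, and A = (A X) X^-1 is a product of two
    matrices controlled by N. *)
Lemma rep_bounded : exists M : R, forall X : 'M[C]_n, unitary X -> forall x y,
  `|complex.Re (rho X x y)| <= M /\ `|complex.Im (rho X x y)| <= M.
Proof.
have [N [hN|I0]] := E_big; last first.
  by exists 0 => X _ x; have := fintype0 x I0.
exists (#|I|%:R * (2 * N%:R ^+ 2)) => A uA x y.
have GA : G A by rewrite UBT.
pose E' := (fun X : T => (A *m (X : 'M[C]_n) : T)) @^-1` (E N).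
have mE' : measurable E'.
  by have := @measurable_lmul R n A measurableT _ (mE N); rewrite setTI.
have muE' : muT E' = muT (E N) by case: (hmu [set: 'I_n]%SET) => _; apply.
have [X [EX E'X]] : (E N `&` E') !=set0.
  apply/set0P; apply/eqP => e0.
  have : (muT (E N `|` E') <= 1)%E by apply: probability_le1; exact: measurableU.
  have -> : muT (E N `|` E') = (muT (E N) + muT E')%E by apply: measureU.
  rewrite muE'.
  have f := fin_num_measure muT _ (mE N).
  move: hN; rewrite -(fineK f) lte_fin -EFinD lee_fin; lra.
have [GX _] := EX (true, true, x, x) Logic.I.
have uX : unitary (X : 'M[C]_n) := UB_unitary GX.
have eA : A = (A *m (X : 'M[C]_n)) *m adj X.
  by rewrite adjE // mulmxK // unitary_unit.
have uadj : unitary (adj X : 'M[C]_n) by rewrite adjE //; exact: unitaryV.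
have bnd (a1 a2 b1 b2 : R) : `|a1| <= N%:R -> `|a2| <= N%:R -> `|b1| <= N%:R -> `|b2| <= N%:R ->
    `|a1 * b1| + `|a2 * b2| <= 2 * N%:R ^+ 2.
  move=> h1 h2 h3 h4; rewrite !normrM expr2 mulr2n mulrDl mul1r; apply: lerD; exact: ler_pM.
rewrite eA repM //; last exact: unitary_mul.
have bndE (z : I) b1 b2 := conj (@E_bound N _ E'X b1 x z).1 (@E_bound N _ EX b2 z y).2.
have ReS (F : I -> C) : complex.Re (\sum_z F z) = \sum_z complex.Re (F z).
  by elim/big_ind2: _ => // a a' b b' <- <-; rewrite ReD.
have ImS (F : I -> C) : complex.Im (\sum_z F z) = \sum_z complex.Im (F z).
  by elim/big_ind2: _ => // a a' b b' <- <-; rewrite ImD.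
have sumb (F : I -> R) : (forall z, `|F z| <= 2 * N%:R ^+ 2) -> `|\sum_z F z| <= #|I|%:R * (2 * N%:R ^+ 2).
  move=> h; apply: le_trans (ler_norm_sum _ _ _) _.
  rewrite mulr_natl -sumr_const; apply: ler_sum => z _; exact: h.
rewrite ReS ImS; split; apply: sumb => z.
  rewrite ReM; apply: le_trans (ler_normB _ _) _; apply: bnd.
  - exact: (bndE z true true).1.
  - exact: (bndE z false true).1.
  - exact: (bndE z true true).2.
  - exact: (bndE z true false).2.
rewrite ImM; apply: le_trans (ler_normD _ _) _; apply: bnd.
- exact: (bndE z true true).1.
- exact: (bndE z false true).1.
- exact: (bndE z true false).2.
- exact: (bndE z true true).2.
Qed.

Lemma rep_tame B x y : tame (UB B) (fun X : T => rho X x y).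
Proof.
have sub : (UB B : set T) `<=` G by rewrite UBT => X [].
apply: (tame_sub mG sub); have [M hM] := rep_bounded; split; split.
- exact: (@mrho true x y).
- by exists M => X /UB_unitary uX; case: (hM X uX x y).
- exact: (@mrho false x y).
- by exists M => X /UB_unitary uX; case: (hM X uX x y).
Qed.

Lemma rep_tameV B x y : tame (UB B) (fun X : T => rho (invmx (X : 'M[C]_n)) x y).
Proof.
have sub : (UB B : set T) `<=` G by rewrite UBT => X [].
apply: (tame_sub mG sub); have [M hM] := rep_bounded.
apply: (@tame_ext _ _ _ _ (fun X : T => rho (adj X) x y)) => [X GX|]; first by rewrite adjE.
split; split.
- exact: (@mrhoV true x y).
- by exists M => X GX; rewrite adjE //; case: (hM _ (unitaryV (UB_unitary GX)) x y).
- exact: (@mrhoV false x y).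
- by exists M => X GX; rewrite adjE //; case: (hM _ (unitaryV (UB_unitary GX)) x y).
Qed.

Hypothesis irr : irreducible rho.

Let regcoef (c : I -> C) := forall y, exists2 F, regular F &
  forall A, unitary A -> pairing c (fun x => rho A x y) = F A.

Let regcoef_lin : lin_subspace regcoef.
Proof.
split=> [y|a u v hu hv y].
  exists (fun=> 0); first exact: regular_c.
  by move=> A _; rewrite /pairing big1 // => x _; rewrite mul0r.
have [F rF eF] := hu y; have [F' rF' eF'] := hv y.
exists (fun A => a * F A + F' A); first by apply: regularD => //; apply: regularZ.
move=> A uA; rewrite -eF // -eF' // /pairing big_distrr -big_split /=.
by apply: eq_bigr => x _; ring.
Qed.

Let regcoef_act c A : unitary A -> regcoef c -> regcoef (fun y => pairing c (fun x => rho A x y)).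
Proof.
move=> uA hc y; have [F rF eF] := hc y.
exists (fun B => F (A *m B)); first exact: regular_lmul (unitary_unit uA) rF.
move=> B uB; rewrite -eF; last exact: unitary_mul.
rewrite /pairing; under [RHS]eq_bigr => x _ do rewrite repM // big_distrr /=.
rewrite exchange_big /=; apply: eq_bigr => z _; rewrite big_distrl /=.
by apply: eq_bigr => x _; ring.
Qed.

(* Substitute B X for X in the integral and separate the variables in p (B X). *)
Let regcoef_fourier (p : 'M[C]_n -> C) x : regular p ->
  regcoef (fun z => cint muT G (fun X : T => p X * rho (invmx (X : 'M[C]_n)) x z)).
Proof.
move=> rp y; have [J [P [Q [rP rQ pPQ]]]] := regular_split rp.
have t (q : 'M[C]_n -> C) z : regular q -> tame G (fun X : T => q X * rho (invmx (X : 'M[C]_n)) x z).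
  by move=> rq; apply: tameM; [exact: tame_regular|exact: rep_tameV].
exists (fun B => \sum_j P j B * cint muT G (fun X : T => Q j X * rho (invmx (X : 'M[C]_n)) x y)).
  by apply: regular_sum => j _; apply: regularM => //; apply: regular_c.
move=> B uB; have GB : G B by rewrite UBT.
transitivity (cint muT G (fun X : T => p (B *m (X : 'M[C]_n)) * rho (invmx (X : 'M[C]_n)) x y)); last first.
  rewrite (cint_ext _ (g := fun X : T => \sum_j P j B * (Q j X * rho (invmx (X : 'M[C]_n)) x y))).
    rewrite cint_sum //; last by move=> j; apply: tameM; [exact: tame_cst|exact: t].
    by apply: eq_bigr => j _; rewrite cintZ //; exact: t.
  move=> X /UB_unitary uX; rewrite pPQ ?unitary_unit // big_distrl /=.
  by apply: eq_bigr => j _; rewrite mulrA.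
transitivity (cint muT G (fun X : T => \sum_z rho B z y * (p (B *m (X : 'M[C]_n)) * rho (invmx (B *m (X : 'M[C]_n))) x z))).
  rewrite cint_sum //; last first.
    move=> z; apply: tameM; first exact: tame_cst.
    exact: (tame_translate (hmu _) GB (t p z rp)).
  rewrite /pairing; apply: eq_bigr => z _.
  have tt := tame_translate (hmu _) GB (t p z rp).
  rewrite cintZ // mulrC; congr (_ * _); exact/esym/(cint_translate (hmu _) GB (t p z rp)).
apply: cint_ext => X /UB_unitary uX.
have -> : invmx (X : 'M[C]_n) = invmx (B *m (X : 'M[C]_n)) *m B.
  by rewrite invmx_mul ?unitary_unit // mulmxKV // unitary_unit.
rewrite repM //; last exact/unitaryV/unitary_mul.
by rewrite big_distrr /=; apply: eq_bigr => z _; ring.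
Qed.

(** [regcoef] is an invariant space of covectors, so one nonzero member suffices, and
    [regcoef_fourier] supplies candidates. If all of these were zero, density would make the
    coefficients of rho(X^-1) orthogonal to those of rho(X), against rho(X^-1) rho(X) = 1. *)
Lemma rep_regular x y : exists2 F, regular F & forall A, unitary A -> rho A x y = F A.
Proof.
suff H : forall c, regcoef c.
  have [F rF eF] := H (fun z => (z == x)%:R) y; exists F => // A uA.
  rewrite -eF // /pairing (bigD1 x) //= eqxx mul1r big1 ?addr0 // => z /negPf ->.
  by rewrite mul0r.
apply: (irreducible_functionals irr regcoef_lin (fun c A uA => @regcoef_act c A uA)).
apply: contrapT => /forall2NP c0.
have z0 p z : regular p -> cint muT G (fun X : T => p X * rho (invmx (X : 'M[C]_n)) x z) = 0.
  move=> rp; have [|/contrapT e] := c0 (fun z => cint muT G (fun X : T => p X * rho (invmx (X : 'M[C]_n)) x z)).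
    by case; exact: regcoef_fourier.
  exact: (congr1 (@^~ z) e).
suff : (1 : C) = 0 by move/eqP; rewrite oner_eq0.
rewrite -(cint_cst mG muG 1).
rewrite (cint_ext _ (g := fun X : T => \sum_z rho X z x * rho (invmx (X : 'M[C]_n)) x z)).
  rewrite cint_sum //; last by move=> z; apply: tameM; [exact: rep_tame|exact: rep_tameV].
  apply: big1 => z _. apply: (@regular_dense R n muT (fun X : T => rho (invmx (X : 'M[C]_n)) x z) (fun X : T => rho X z x)); [exact: rep_tameV|exact: rep_tame|].
  by move=> p rp; apply: z0.
move=> X /UB_unitary uX; have := congr1 (fun A => rho A x x) (mulVmx (unitary_unit uX)).
rewrite rep1 eqxx repM // ?mulr1n => [<-|]; last exact: unitaryV.
by apply: eq_bigr => z _; rewrite mulrC.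
Qed.

End MeasurableRep.

(** * Highest weight coefficients *)

Section RegularExtension.
Variables (R : realType) (n : nat) (mu : {set 'I_n} -> probability (MxMeas R n) R).
Hypothesis hmu : forall B : {set 'I_n}, haar_prob (UB B) (mu B).
Local Notation C := R[i].
Local Notation T := (MxMeas R n).
Variables (I : finType) (rho : 'M[C]_n -> I -> I -> C).
Hypothesis hrho : is_rep rho.
Hypothesis irr : irreducible rho.

(** The regular functions found for the coefficients satisfy the product rule on unitary matrices;
    density carries it to GL_n one variable at a time. *)
Lemma rep_extension : exists r : 'M[C]_n -> I -> I -> C,
  [/\ forall x y, regular (fun A => r A x y),
      forall A, unitary A -> r A = rho A &
      forall A B, A \in unitmx -> B \in unitmx -> forall x z,
        r (A *m B) x z = \sum_y r A x y * r B y z].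
Proof.
have /choice [F hF] : forall p : I * I, exists F, regular F /\ forall A, unitary A -> rho A p.1 p.2 = F A.
  by move=> p; have [F rF eF] := rep_regular hmu hrho irr p.1 p.2; exists F.
have rF x y : regular (fun A => F (x, y) A) by exact: (hF (x, y)).1.
exists (fun A x y => F (x, y) A); split=> //.
  by move=> A uA; apply/funext => x; apply/funext => y; rewrite -(hF (x, y)).2.
pose D x z A B := F (x, z) (A *m B) - \sum_y F (x, y) A * F (y, z) B.
have D0 A B x z : unitary A -> unitary B -> D x z A B = 0.
  move=> uA uB; rewrite /D -(hF (x, z)).2; last exact: unitary_mul.
  rewrite (repM hrho) // -(eq_bigr _ (fun y _ => congr2 *%R ((hF (x, y)).2 A uA) ((hF (y, z)).2 B uB))) /=.
  by rewrite subrr.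
have D1 A B x z : unitary A -> B \in unitmx -> D x z A B = 0.
  move=> uA uB; apply: (@unitary_dense R n (fun B => D x z A B) _ _ B uB).
    apply: regularB; first exact: regular_lmul (unitary_unit uA) (rF x z).
    by apply: regular_sum => y _; apply: regularZ.
  by move=> U uU; apply: D0.
move=> A B uA uB x z; apply/eqP; rewrite -subr_eq0; apply/eqP.
apply: (@unitary_dense R n (fun A => D x z A B) _ _ A uA).
  apply: regularB; first exact: regular_rmul uB (rF x z).
  by apply: regular_sum => y _; apply: regularM => //; apply: regular_c.
by move=> U uU; apply: D1.
Qed.

End RegularExtension.

(** * Projection onto a weight space *)

Section WeightProjection.
Variables (R : realType) (n : nat) (mu : {set 'I_n} -> probability (MxMeas R n) R).
Hypothesis hmu : forall B : {set 'I_n}, haar_prob (UB B) (mu B).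
Local Notation C := R[i].
Local Notation T := (MxMeas R n).
Variables (I : finType) (rho : 'M[C]_n -> I -> I -> C).
Hypothesis hrho : is_rep rho.

Lemma opapplyZ (J : finType) (L : J -> J -> C) a (w : J -> C) :
  opapply L (fun x => a * w x) = fun x => a * opapply L w x.
Proof.
by apply/funext => x; rewrite /opapply big_distrr; apply: eq_bigr => y _; rewrite mulrCA.
Qed.

Lemma pairing_opapply (J : finType) (c : J -> C) (L : J -> J -> C) w :
  pairing c (opapply L w) = pairing (fun y => \sum_x c x * L x y) w.
Proof.
rewrite /pairing /opapply; under eq_bigr => x _ do rewrite big_distrr /=.
rewrite exchange_big /=; apply: eq_bigr => y _; rewrite big_distrl /=.
by apply: eq_bigr => x _; rewrite mulrA.
Qed.

Lemma pairingZ (J : finType) (c : J -> C) a w : pairing c (fun x => a * w x) = a * pairing c w.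
Proof. by rewrite /pairing big_distrr; apply: eq_bigr => x _ /=; ring. Qed.

Lemma tame_opapply B (w : I -> C) x : tame (UB B) (fun X : T => opapply (rho X) w x).
Proof.
apply: tame_sum => y; apply: tameM; last exact: tame_cst.
exact: (rep_tame hmu hrho).
Qed.

Lemma cint_opapply B (g : T -> C) (w : I -> C) x : tame (UB B) g ->
  opapply (fun x y => cint (mu B) (UB B) (fun X : T => g X * rho X x y)) w x =
  cint (mu B) (UB B) (fun X : T => g X * opapply (rho X) w x).
Proof.
move=> tg; have mB := measurable_UB B.
have t y : tame (UB B) (fun X : T => g X * rho X x y).
  by apply: tameM => //; exact: (rep_tame hmu hrho).
rewrite (cint_ext _ (g := fun X : T => \sum_y w y * (g X * rho X x y))).
  rewrite cint_sum //; last 2 first.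
  - exact: haar1 (hmu B).
  - by move=> y; apply: tameM => //; exact: tame_cst.
  by apply: eq_bigr => y _; rewrite cintZ // mulrC.
by move=> X _; rewrite /opapply big_distrr; apply: eq_bigr => y _ /=; ring.
Qed.

Lemma cint_pairing B (c : I -> C) (F : T -> I -> C) : (forall x, tame (UB B) (fun X => F X x)) ->
  pairing c (fun x => cint (mu B) (UB B) (fun X => F X x)) = cint (mu B) (UB B) (fun X => pairing c (F X)).
Proof.
move=> tF; rewrite /pairing cint_sum.
- by apply: eq_bigr => x _; rewrite cintZ //; exact: measurable_UB.
- exact: measurable_UB.
- exact: haar1 (hmu B).
- by move=> x; apply: tameM => //; exact: tame_cst.
Qed.

Definition circ (i : 'I_n) (z : C) : 'M[C]_n := tor (fun j => if j == i then z else 1).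

Lemma circ_torus (i : 'I_n) (z : C) : `|z| = 1 -> is_torus_elt (fun j : 'I_n => if j == i then z else 1 : C).
Proof. by move=> z1 j; case: ifP => // _; rewrite normr1. Qed.

Lemma circ_UB (i : 'I_n) (z : C) : `|z| = 1 -> UB [set i]%SET (circ i z).
Proof.
move=> z1; apply: blockB_tor; first exact: circ_torus.
by move=> j; rewrite inE => /negPf ->.
Qed.

Lemma UB1E i (X : 'M[C]_n) : UB [set i]%SET X -> X = circ i (X i i) /\ `|X i i| = 1.
Proof.
move=> [uX hX]; have e : X = circ i (X i i).
  apply/matrixP => j l; rewrite tor_entry; have [->|ji] := eqVneq j i.
    have [<-|li] := eqVneq i l; first by rewrite mulr1n.
    by rewrite hX ?inE 1?[l == i]eq_sym ?li ?orbT // (negPf li) mulr0n.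
  by rewrite hX ?inE ?ji.
split=> //; apply/normc1P; have := congr1 (fun M : 'M[C]_n => M i i) uX.
rewrite !mxE eqxx (bigD1 i) //= !mxE big1 ?addr0 // => l li.
by rewrite !mxE e tor_entry [i == l]eq_sym (negPf li) mulr0n mul0r.
Qed.

(** The character z^(-m) of the circle, written as a power of z or of its conjugate so that it is
    bounded and measurable in matrix entries. *)
Definition conjpow (z : C) (m : int) : C :=
  match m with Posz k => Num.conj z ^+ k | Negz k => z ^+ k.+1 end.

Lemma conjpowE (z : C) m : `|z| = 1 -> conjpow z m = z ^ (- m).
Proof.
move=> z1; have zz : z * Num.conj z = 1 by apply/normc1P.
case: m => k /=; last by rewrite NegzE opprK.
rewrite -exprnN -exprVn; congr (_ ^+ _).
by apply: (mulfI (unit_neq0 z1)); rewrite zz divff // unit_neq0.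
Qed.

Lemma tame_conjpow B (i : 'I_n) m : tame (UB B) (fun X : T => conjpow ((X : 'M[C]_n) i i) m).
Proof.
have tp (f : T -> C) k : tame (UB B) f -> tame (UB B) (fun X => f X ^+ k).
  move=> tf; elim: k => [|k IH]; first exact: tame_cst.
  by apply: tame_ext (tameM tf IH) => X _; rewrite exprS.
case: m => k; apply: (tp (fun X => _)); last exact: tame_entry.
by apply: tame_conj; exact: tame_entry.
Qed.

Definition has_weight (lam : 'I_n -> int) (v : I -> C) := forall t, is_torus_elt t ->
  opapply (rho (tor t)) v = fun x => (\prod_i t i ^ lam i) * v x.

Definition has_coweight (lam : 'I_n -> int) (c : I -> C) := forall t, is_torus_elt t ->
  forall w, pairing c (opapply (rho (tor t)) w) = (\prod_i t i ^ lam i) * pairing c w.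

Lemma prod_circ (lam : 'I_n -> int) (i : 'I_n) (z : C) :
  \prod_j (if j == i then z else 1) ^ lam j = z ^ lam i.
Proof.
rewrite (bigD1 i) //= eqxx big1 ?mulr1 // => j /negPf ->; exact: exp1rz.
Qed.

(** Fourier projection onto the exponent [lam i] of the i-th circle, which is U_B for B = {i}. It
    commutes with the torus, so that the projections for different i can be composed. *)
Lemma circle_projection (lam : 'I_n -> int) i : exists P : I -> I -> C,
  [/\ forall z w, `|z : C| = 1 -> opapply (rho (circ i z)) (opapply P w) = fun x => z ^ lam i * opapply P w x,
      forall t w, is_torus_elt t -> opapply (rho (tor t)) (opapply P w) = opapply P (opapply (rho (tor t)) w),
      forall c w, has_coweight lam c -> pairing c (opapply P w) = pairing c w &
      forall v, has_weight lam v -> opapply P v = v].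
Proof.
have mB := @measurable_UB R n [set i]%SET; have m1 := haar1 (hmu [set i]%SET).
pose g (X : T) := conjpow ((X : 'M[C]_n) i i) (lam i).
have tg : tame (UB [set i]%SET) g by exact: tame_conjpow.
exists (fun x y => cint (mu [set i]%SET) (UB [set i]%SET) (fun X : T => g X * rho X x y)).
set P := fun x y => _.
have PE w : opapply P w = fun x => cint (mu [set i]%SET) (UB [set i]%SET) (fun X : T => g X * opapply (rho X) w x).
  by apply/funext => x; rewrite cint_opapply.
have tgw w x : tame (UB [set i]%SET) (fun X : T => g X * opapply (rho X) w x).
  by apply: tameM => //; exact: tame_opapply.
have act A w : unitary A -> opapply (rho A) (opapply P w) =
    fun x => cint (mu [set i]%SET) (UB [set i]%SET) (fun X : T => g X * opapply (rho (A *m (X : 'M[C]_n))) w x).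
  move=> uA; apply/funext => x; rewrite PE.
  transitivity (pairing (rho A x) (fun y => cint (mu [set i]%SET) (UB [set i]%SET) (fun X : T => g X * opapply (rho X) w y))); first by [].
  rewrite (cint_pairing _ (F := fun X y => g X * opapply (rho X) w y)) //.
  apply: cint_ext => X /UB_unitary uX; rewrite pairingZ; congr (_ * _).
  by rewrite (opapply_repM hrho).
split.
- move=> z w z1; have hz := circ_UB i z1; rewrite act; last exact: UB_unitary hz.
  apply/funext => x; rewrite PE.
  rewrite -(cint_translate (hmu _) hz (tgw w x)) -cintZ //; last first.
    exact: (tame_translate (hmu _) hz (tgw w x)).
  apply: cint_ext => X hX; have [_ X1] := UB1E hX; rewrite mulrA; congr (_ * _).
  have e : (circ i z *m (X : 'M[C]_n)) i i = z * (X : 'M[C]_n) i i.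
    by rewrite /circ /tor mul_diag_mx !mxE eqxx.
  rewrite /g e !conjpowE ?normrM ?z1 ?mul1r // expfzMl mulrA -expfzDr ?unit_neq0 //.
  by rewrite subrr expr0z mul1r.
- move=> t w ht; rewrite act; last exact: tor_unitary.
  apply/funext => x; rewrite PE; apply: cint_ext => X hX; congr (_ * _).
  have [eX X1] := UB1E hX; rewrite -(opapply_repM hrho); [|exact: UB_unitary hX|exact: tor_unitary].
  congr (opapply (rho _) _ _); rewrite {1 2}eX /circ !mul_tor; congr tor.
  by apply/funext => j; rewrite mulrC.
- move=> c w hc; rewrite PE (cint_pairing _ (F := fun X y => g X * opapply (rho X) w y)) //.
  rewrite -[RHS](cint_cst mB m1); apply: cint_ext => X hX; have [eX X1] := UB1E hX.
  rewrite pairingZ eX hc; last exact: circ_torus.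
  rewrite prod_circ -eX /g conjpowE // mulrA -expfzDr ?unit_neq0 //.
  by rewrite addNr expr0z mul1r.
- move=> v hv; rewrite PE; apply/funext => x; rewrite -[RHS](cint_cst mB m1).
  apply: cint_ext => X hX; have [eX X1] := UB1E hX; rewrite eX hv; last exact: circ_torus.
  rewrite prod_circ -eX /g conjpowE // mulrA -expfzDr ?unit_neq0 //.
  by rewrite addNr expr0z mul1r.
Qed.

Lemma opapply_comp (P Q : I -> I -> C) w :
  opapply P (opapply Q w) = opapply (fun x z => \sum_y P x y * Q y z) w.
Proof.
apply/funext => x; rewrite /opapply; under eq_bigr => y _ do rewrite big_distrr /=.
rewrite exchange_big /=; apply: eq_bigr => z _; rewrite big_distrl /=.
by apply: eq_bigr => y _; rewrite mulrA.
Qed.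

Lemma tor_circ (lam : 'I_n -> int) (v : I -> C) :
  (forall i z, `|z : C| = 1 -> opapply (rho (circ i z)) v = fun x => z ^ lam i * v x) ->
  has_weight lam v.
Proof.
move=> h t ht.
suff H m : opapply (rho (tor (fun i => if (i < m)%N then t i else 1))) v =
    fun x => (\prod_(i : 'I_n | (i < m)%N) t i ^ lam i) * v x.
  have := H n; rewrite (_ : (fun i : 'I_n => if (i < n)%N then t i else 1) = t); last first.
    by apply/funext => i; rewrite ltn_ord.
  move=> ->; apply/funext => x; congr (_ * _); apply: eq_bigl => i; exact: ltn_ord.
elim: m => [|m IH].
  rewrite (_ : (fun i : 'I_n => if (i < 0)%N then t i else 1) = fun=> 1) //.
  rewrite tor1 (opapply_rep1 hrho); apply/funext => x; rewrite big_pred0 ?mul1r //.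
have [mn|nm] := ltnP m n; last first.
  have e (i : 'I_n) : (i < m.+1)%N = (i < m)%N.
    by rewrite !(leq_trans (ltn_ord i)) // (leq_trans nm).
  rewrite (_ : (fun i : 'I_n => if (i < m.+1)%N then t i else 1) = fun i : 'I_n => if (i < m)%N then t i else 1).
    by rewrite IH; apply/funext => x; congr (_ * _); apply: eq_bigl => i; rewrite e.
  by apply/funext => i; rewrite e.
pose o := Ordinal mn.
have ts (s : nat) : is_torus_elt (fun i : 'I_n => if (i < s)%N then t i else 1).
  by move=> i; case: ifP => // _; exact: normr1.
have -> : tor (fun i : 'I_n => if (i < m.+1)%N then t i else 1) =
    circ o (t o) *m tor (fun i : 'I_n => if (i < m)%N then t i else 1).
  rewrite /circ mul_tor; congr tor; apply/funext => i; rewrite ltnS leq_eqVlt.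
  have [->|io] := eqVneq i o; first by rewrite /= eqxx ltnn mulr1.
  by rewrite (_ : (i == m :> nat) = false) ?mul1r //; apply: contra_neqF io => /eqP e; exact: val_inj.
rewrite (opapply_repM hrho); [|apply/UB_unitary/circ_UB/ht|exact: tor_unitary].
rewrite IH opapplyZ h //; apply/funext => x.
rewrite [in RHS](bigD1 o) //= [LHS]mulrCA -mulrA; congr (_ * (_ * _)); apply: eq_bigl => i.
rewrite [in RHS]ltnS [in RHS]leq_eqVlt; have [->|io] := eqVneq i o; first by rewrite andbF; exact: ltnn.
by rewrite (_ : (i == m :> nat) = false) ?andbT //; apply: contra_neqF io => /eqP e; exact: val_inj.
Qed.

(** Composite of the circle projections; a later factor does not spoil an earlier one because each
    commutes with the torus. The clause on coweights allows a vector to be projected without losing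
    its pairing with a given covector. *)
Lemma weight_projection (lam : 'I_n -> int) : exists P : I -> I -> C,
  [/\ forall w, has_weight lam (opapply P w),
      forall t w, is_torus_elt t -> opapply (rho (tor t)) (opapply P w) = opapply P (opapply (rho (tor t)) w),
      forall c w, has_coweight lam c -> pairing c (opapply P w) = pairing c w &
      forall v, has_weight lam v -> opapply P v = v].
Proof.
suff [P [h1 h2 h3 h4]] : exists P : I -> I -> C,
  [/\ forall i z w, i \in enum 'I_n -> `|z| = 1 ->
        opapply (rho (circ i z)) (opapply P w) = fun x => z ^ lam i * opapply P w x,
      forall t w, is_torus_elt t -> opapply (rho (tor t)) (opapply P w) = opapply P (opapply (rho (tor t)) w),
      forall c w, has_coweight lam c -> pairing c (opapply P w) = pairing c w &
      forall v, has_weight lam v -> opapply P v = v].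
  by exists P; split=> // w; apply: tor_circ => i z z1; apply: h1; rewrite ?mem_enum.
elim: (enum 'I_n) => [|i s [P [h1 h2 h3 h4]]].
  exists (fun x y => (x == y)%:R); rewrite -(rep1 hrho).
  split=> // [t w _|c w _|v _]; by rewrite !(opapply_rep1 hrho).
have [Q [g1 g2 g3 g4]] := circle_projection lam i.
exists (fun x z => \sum_y Q x y * P y z); split=> [j z w|t w ht|c w hc|v hv]; rewrite -!opapply_comp.
- rewrite in_cons => /orP[/eqP ->|js] z1; first exact: g1.
  by rewrite /circ g2 ?h1 ?opapplyZ //; exact: circ_torus.
- by rewrite g2 // h2.
- by rewrite g3 // h3.
- by rewrite h4 // g4.
Qed.

End WeightProjection.

Section HighestWeight.
Variables (R : realType) (n : nat) (mu : {set 'I_n} -> probability (MxMeas R n) R).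
Hypothesis hmu : forall B : {set 'I_n}, haar_prob (UB B) (mu B).
Local Notation C := R[i].
Variables (I : finType) (rho : 'M[C]_n -> I -> I -> C).
Hypothesis hrho : is_rep rho.
Hypothesis irr : irreducible rho.

Definition raise (lam : 'I_n -> int) (p q : 'I_n) (m : nat) (i : 'I_n) : int :=
  lam i + (m * (i == p))%:Z - (m * (i == q))%:Z.

Lemma prod_raise (t : 'I_n -> C) lam p q m : (forall i, t i != 0) ->
  \prod_i t i ^ raise lam p q m i = (\prod_i t i ^ lam i) * (t p / t q) ^+ m.
Proof.
move=> t0; have one (r : 'I_n) (s : 'I_n -> C) : \prod_i s i ^+ (m * (i == r)) = s r ^+ m.
  rewrite (bigD1 r) //= eqxx muln1 big1 ?mulr1 // => i /negPf ->.
  by rewrite muln0 expr0.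
rewrite exprMn -(one p t) -(one q (fun i => (t i)^-1)) -!big_split /=.
apply: eq_bigr => i _; rewrite /raise !expfzDr // -exprnP -exprnN exprVn.
by rewrite mulrA.
Qed.

(** The integers [c i] would be the partial sums of the difference of the two weights. They vanish
    before [p], and the next one would be -m < 0. *)
Lemma raise_not_dominated lam (p q : 'I_n) m : (p < q)%N -> (0 < m)%N -> ~ dominated (raise lam p q m) lam.
Proof.
move=> pq m0 [c [_ hc]].
have d (i : 'I_n) : lam i - raise lam p q m i = (m * (i == q))%:Z - (m * (i == p))%:Z.
  by rewrite /raise; ring.
have z (i : nat) : (i < p)%N -> c i = 0%N.
  elim: i => [|i IH] ip.
    have := hc (Ordinal (leq_trans ip (ltnW (ltn_ord p)))); rewrite d /=.
    have -> : (Ordinal (leq_trans ip (ltnW (ltn_ord p))) == q) = false.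
      by apply/negP => /eqP /(congr1 (@nat_of_ord n)) /= e; lia.
    have -> : (Ordinal (leq_trans ip (ltnW (ltn_ord p))) == p) = false.
      by apply/negP => /eqP /(congr1 (@nat_of_ord n)) /= e; lia.
    by rewrite !muln0; lia.
  have := hc (Ordinal (leq_trans ip (ltnW (ltn_ord p)))); rewrite d /= IH; last exact: ltnW.
  have -> : (Ordinal (leq_trans ip (ltnW (ltn_ord p))) == q) = false.
    by apply/negP => /eqP /(congr1 (@nat_of_ord n)) /= e; lia.
  have -> : (Ordinal (leq_trans ip (ltnW (ltn_ord p))) == p) = false.
    by apply/negP => /eqP /(congr1 (@nat_of_ord n)) /= e; lia.
  by rewrite !muln0; lia.
have := hc p; rewrite d eqxx muln1.
have -> : (p == q) = false by apply/negP => /eqP e; rewrite e ltnn in pq.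
rewrite muln0; case E: (val p) => [|p']; first by lia.
by rewrite (z p') ?E //; lia.
Qed.

Lemma regular_elem_poly (F : 'M[C]_n -> C) (p q : 'I_n) : p != q -> regular F ->
  exists P : {poly C}, forall x, F (elem x p q) = P.[x].
Proof.
move=> pq rF.
have [|P [k hP]] := @regular_curve R n 1 (fun x => elem x p q) F _ rF.
  apply: (@ratcurveP _ _ _ _ (fun x => elem (- x) p q)) => [x _|i j|i j]; first exact: elemK.
    apply: (@eq_ratfun _ _ (fun x => (1%:M : 'M[C]_n) i j + x * (delta_mx p q : 'M[C]_n) i j)) => [x _|].
      by rewrite !mxE.
    by apply: ratfunD; [exact: ratfun_c|apply: ratfunM; [exact: ratfun_id|exact: ratfun_c]].
  apply: (@eq_ratfun _ _ (fun x => (1%:M : 'M[C]_n) i j + x * - (delta_mx p q : 'M[C]_n) i j)) => [x _|].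
    by rewrite !mxE mulrN mulNr.
  by apply: ratfunD; [exact: ratfun_c|apply: ratfunM; [exact: ratfun_id|exact: ratfun_c]].
exists P => x; rewrite -hP ?hornerC ?oner_eq0 //.
by rewrite expr1n mulr1.
Qed.

(** Rescaling the variable by [r] multiplies the coefficient of degree m by r^m. With [r] a ratio of
    two torus coordinates, this is how the coefficients of a one-parameter orbit acquire weights. *)
Lemma poly_scale_eq (J : finType) (a : J -> C) (P : J -> {poly C}) (Q : {poly C}) s r :
  (forall x, \sum_b a b * (P b).[x] = s * Q.[x * r]) ->
  forall m, \sum_b a b * (P b)`_m = s * r ^+ m * Q`_m.
Proof.
move=> h m; pose Q' := \poly_(i < size Q) (Q`_i * r ^+ i).
have e : \sum_b a b *: P b = s *: Q'.
  apply/eqP; rewrite -subr_eq0; apply/eqP; apply: (zdense_polyP (@zdense_setT R)) => x _.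
  rewrite hornerD hornerN hornerZ horner_sum.
  under eq_bigr => b _ do rewrite hornerZ.
  rewrite h /Q' horner_poly horner_coef; apply/eqP; rewrite subr_eq0; apply/eqP; congr (_ * _).
  by apply: eq_bigr => i _; rewrite exprMn; ring.
have := congr1 (fun p : {poly C} => p`_m) e; rewrite coef_sum coefZ.
under eq_bigr => b _ do rewrite coefZ.
move=> ->; rewrite /Q' coef_poly; case: ltnP => [_|h']; first by ring.
by rewrite nth_default // !mulr0.
Qed.

Lemma poly_const_eq (P : {poly C}) x : (forall m, (0 < m)%N -> P`_m = 0) -> P.[x] = P.[0].
Proof.
move=> h; have -> : P = (P`_0)%:P by apply/polyP => -[|m]; rewrite coefC //= h.
by rewrite !hornerC.
Qed.

Lemma tor_mul_elem (t : 'I_n -> C) x (p q : 'I_n) : (forall i, t i != 0) ->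
  tor t *m elem x p q = elem (x * (t p / t q)) p q *m tor t.
Proof.
move=> t0; apply/matrixP => i j; rewrite mul_elemE elem_mulE !tor_entry; congr (_ + _).
rewrite [q == j]eq_sym; case: (eqVneq i p) => [->|_]; case: (eqVneq j q) => [e|_];
  rewrite ?e ?mulr1n ?mulr0n ?mulr0 ?mul0r //; by field.
Qed.

Variables (mw : 'I_n -> int).
Hypothesis hw : highest_weight rho mw.

Lemma raise_weight0 (p q : 'I_n) m (v : I -> C) : (p < q)%N -> (0 < m)%N ->
  has_weight rho (raise mw p q m) v -> v = fun=> 0.
Proof.
move=> pq m0 hv; apply: contrapT => v0; case: hw => _ /(_ (raise mw p q m)) h.
by apply: (raise_not_dominated pq m0 (h _)); exists v.
Qed.

(** A nonzero coweight pairs nontrivially with some vector, and [weight_projection] would turn this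
    vector into a nonzero one of the same weight. *)
Lemma raise_coweight0 (p q : 'I_n) m (c : I -> C) : (p < q)%N -> (0 < m)%N ->
  has_coweight rho (raise mw p q m) c -> c = fun=> 0.
Proof.
move=> pq m0 hc; have [P [h1 _ h3 _]] := weight_projection hmu hrho (raise mw p q m).
apply/funext => x; pose w (y : I) : C := (y == x)%:R.
have e : pairing c w = c x.
  by rewrite /pairing (bigD1 x) //= /w eqxx mulr1 big1 ?addr0 // => y /negPf ->; rewrite mulr0.
rewrite -e -(h3 c w hc) (raise_weight0 pq m0 (h1 w)) /pairing big1 // => y _.
by rewrite mulr0.
Qed.

Variable r : 'M[C]_n -> I -> I -> C.
Hypothesis rreg : forall x y, regular (fun A => r A x y).
Hypothesis rrho : forall A, unitary A -> r A = rho A.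
Hypothesis rM : forall A B, A \in unitmx -> B \in unitmx -> forall x z,
  r (A *m B) x z = \sum_y r A x y * r B y z.

Lemma opapply_extM A B v : A \in unitmx -> B \in unitmx ->
  opapply (r (A *m B)) v = opapply (r A) (opapply (r B) v).
Proof.
move=> uA uB; rewrite opapply_comp; congr opapply; apply/funext => x; apply/funext => z; exact: rM.
Qed.

Lemma elem0 (p q : 'I_n) : elem 0 p q = 1%:M :> 'M[C]_n.
Proof. by rewrite /elem scale0r addr0. Qed.

Lemma ext1 v : opapply (r 1%:M) v = v.
Proof. by rewrite rrho ?(opapply_rep1 hrho) //; exact: unitary1. Qed.

(** The orbit of [v] under the transvections is polynomial in [x]. Conjugation by the torus gives
    its coefficient of degree m the weight [mw] + m (e_p - e_q), which is impossible for m > 0, so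
    only the constant term is left. *)
Lemma highest_fixed v x (p q : 'I_n) : has_weight rho mw v -> (p < q)%N ->
  opapply (r (elem x p q)) v = v.
Proof.
move=> hv pq; have npq : p != q by apply: contraTneq pq => ->; rewrite ltnn.
have /choice [P hP] : forall a, exists P : {poly C}, forall x, opapply (r (elem x p q)) v a = P.[x].
  move=> a; apply: (regular_elem_poly (F := fun A => opapply (r A) v a)) npq _.
  by apply: regular_sum => y _; apply: regularM => //; exact: regular_c.
have wm m : has_weight rho (raise mw p q m) (fun a => (P a)`_m).
  move=> t ht; have t0 i : t i != 0 by apply: unit_neq0; exact: ht.
  have ut := tor_unitary ht; have utt := unitary_unit ut.
  apply/funext => a; rewrite prod_raise // /opapply.
  apply: poly_scale_eq => y; rewrite -hP.
  transitivity (opapply (r (tor t *m elem y p q)) v a).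
    rewrite opapply_extM ?elem_unit // rrho // [RHS]/opapply; apply: eq_bigr => b _.
    by rewrite hP.
  by rewrite tor_mul_elem // opapply_extM ?elem_unit // [r (tor t)]rrho // hv // opapplyZ.
apply/funext => a; rewrite hP poly_const_eq => [|m m0].
  by rewrite -hP elem0 ext1.
exact: (congr1 (@^~ a) (raise_weight0 pq m0 (wm m))).
Qed.

(** Dual to [highest_fixed]: the coefficients are now covectors of weight [mw] + m (e_q - e_p),
    which is above [mw] because q < p. *)
Lemma lowest_cofixed c w x (p q : 'I_n) : has_coweight rho mw c -> (q < p)%N ->
  pairing c (opapply (r (elem x p q)) w) = pairing c w.
Proof.
move=> hc qp; have npq : p != q by apply: contraTneq qp => ->; rewrite ltnn.
have /choice [P hP] : forall b, exists P : {poly C}, forall x, \sum_a c a * r (elem x p q) a b = P.[x].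
  move=> b; apply: (regular_elem_poly (F := fun A => \sum_a c a * r A a b)) npq _.
  by apply: regular_sum => y _; exact: regularZ.
have hP' y w' : pairing c (opapply (r (elem y p q)) w') = \sum_b (P b).[y] * w' b.
  by rewrite pairing_opapply; apply: eq_bigr => b _; rewrite hP.
have wm m : has_coweight rho (raise mw q p m) (fun b => (P b)`_m).
  move=> t ht w'; have t0 i : t i != 0 by apply: unit_neq0; exact: ht.
  have ut := tor_unitary ht; have utt := unitary_unit ut.
  rewrite prod_raise // /pairing.
  transitivity (\sum_b opapply (rho (tor t)) w' b * (P b)`_m).
    by apply: eq_bigr => b _; rewrite mulrC.
  transitivity ((\prod_i t i ^ mw i) * (t q / t p) ^+ m * (\sum_b w' b *: P b)`_m); last first.
    by congr (_ * _); rewrite coef_sum; apply: eq_bigr => b _; rewrite coefZ mulrC.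
  apply: poly_scale_eq => y.
  transitivity (pairing c (opapply (r (elem y p q *m tor t)) w')).
    rewrite opapply_extM ?elem_unit // [r (tor t)]rrho // hP'.
    by apply: eq_bigr => b _; rewrite mulrC.
  have -> : elem y p q *m tor t = tor t *m elem (y * (t q / t p)) p q.
    rewrite tor_mul_elem //; congr (elem _ _ _ *m _); field; by rewrite !t0.
  rewrite opapply_extM ?elem_unit // [r (tor t)]rrho // hc // hP'; congr (_ * _).
  by rewrite horner_sum; apply: eq_bigr => b _; rewrite hornerZ mulrC.
rewrite hP' /pairing; apply: eq_bigr => b _; rewrite poly_const_eq => [|m m0].
  have <- := hP b 0; rewrite elem0 rrho; last exact: unitary1.
  rewrite (rep1 hrho) (bigD1 b) //= eqxx mulr1 big1 ?addr0 // => a /negPf ab.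
  by rewrite ab mulr0.
exact: (congr1 (@^~ b) (raise_coweight0 qp m0 (wm m))).
Qed.

End HighestWeight.

Section HighestCoefficient.
Variables (R : realType) (n : nat) (mu : {set 'I_n} -> probability (MxMeas R n) R).
Hypothesis hmu : forall B : {set 'I_n}, haar_prob (UB B) (mu B).
Local Notation C := R[i].
Variables (I : finType) (rho : 'M[C]_n -> I -> I -> C) (j : nat).
Hypothesis hrho : irrep_of_hw rho (@hw_j n j).
Variables i0 i1 : 'I_n.
Hypothesis i0E : val i0 = 0%N.
Hypothesis i1E : val i1 = n.-1.
Hypothesis i01 : i0 != i1.

(* The highest weight determines this coefficient on N^- T N, hence everywhere by density. *)
Theorem highest_coefficient : exists c v : I -> C, pairing c v = 1 /\
  forall A, unitary A -> pairing c (opapply (rho A) v) = A i0 i0 ^+ j * invmx A i1 i1 ^+ j.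
Proof.
have [hrep irr hw] := hrho; have [[v [v0 hv]] _] := hw.
have [r [rreg rrho rM]] := rep_extension hmu hrep irr.
have [P [h1 h2 _ h4]] := weight_projection hmu hrep (@hw_j n j).
have [x vx] : exists x, v x != 0.
  by apply: contrapT => /forallNP h; apply: v0; apply/funext => x; apply/eqP/negP => /negP/(h x).
(* [c0] reads one nonzero coordinate of [v], normalized; composing it with the projection [P] makes
   it a coweight and keeps its value 1 on [v]. *)
pose c0 y : C := (y == x)%:R / v x; pose c y := \sum_z c0 z * P z y.
have cE w : pairing c w = pairing c0 (opapply P w) by rewrite pairing_opapply.
have c0E w : pairing c0 w = w x / v x.
  rewrite /pairing (bigD1 x) //= /c0 eqxx mul1r mulrC big1 ?addr0 // => y /negPf ->.
  by rewrite !mul0r.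
have cv : pairing c v = 1 by rewrite cE h4 // c0E divff.
have hc : has_coweight rho (@hw_j n j) c.
  by move=> t ht w; rewrite !cE -h2 // h1 // pairingZ.
exists c, v; split=> // A uA; rewrite -rrho //.
apply/eqP; rewrite -subr_eq0; apply/eqP.
pose E (A : 'M[C]_n) := pairing c (opapply (r A) v) - A i0 i0 ^+ j * invmx A i1 i1 ^+ j.
have rE : regular E.
  apply: regularB.
    apply: regular_sum => y _; apply: regularZ; apply: regular_sum => z _.
    by apply: regularM => //; exact: regular_c.
  by apply: regularM; apply: regularX; [exact: regular_entry|exact: regular_inv].
apply: (@gauss_dense R n (fun F => F = E) _ _ _ _ A (unitary_unit uA) E erefl) => {A uA}.
- by move=> _ ->.
- move=> A p q z uA qp H _ ->; rewrite -[RHS](H E erefl) /E.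
  have npq : p != q by apply: contraTneq qp => ->; rewrite ltnn.
  (* A lower transvection on the left changes row p of A and column q of its inverse. As [i0] is the
     first index and [i1] the last, the two entries occurring in [E] are untouched. *)
  have p0 : i0 == p = false by apply/negP => /eqP /(congr1 val); rewrite i0E /= => e; lia.
  have q1 : i1 == q = false by apply/negP => /eqP /(congr1 val); rewrite i1E /= => e; have := ltn_ord p; lia.
  rewrite (opapply_extM rM) ?elem_unit // (lowest_cofixed hmu hrep hw rreg rrho rM) //.
  rewrite invmx_mul ?elem_unit // (elem_inv z npq).2 elem_mulE mul_elemE p0 q1.
  by rewrite !mul0r mulr0 !addr0.
- move=> A p q z uA pq H _ ->; rewrite -[RHS](H E erefl) /E.
  have npq : p != q by apply: contraTneq pq => ->; rewrite ltnn.
  have q0 : i0 == q = false by apply/negP => /eqP /(congr1 val); rewrite i0E /= => e; lia.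
  have p1 : i1 == p = false by apply/negP => /eqP /(congr1 val); rewrite i1E /= => e; have := ltn_ord q; lia.
  rewrite (opapply_extM rM) ?elem_unit // (highest_fixed hrep hw rreg rrho rM) //.
  rewrite invmx_mul ?elem_unit // (elem_inv z npq).2 elem_mulE mul_elemE q0 p1.
  by rewrite !mul0r mulr0 !addr0.
- move=> t t0 _ ->; apply: torus_dense => // s hs; rewrite /E.
  have s0 i : s i != 0 by apply: unit_neq0; exact: hs.
  rewrite rrho; last exact: tor_unitary.
  rewrite hc // cv mulr1 (tor_inv s0).2 !tor_entry !eqxx !mulr1n.
  apply/eqP; rewrite subr_eq0; apply/eqP.
  rewrite (bigD1 i0) //= (bigD1 i1) 1?eq_sym //= big1 => [|i /andP[ii0 ii1]].
    rewrite mulr1 /hw_j i0E i1E !eqxx.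
    have -> : (n.-1 == 0)%N = false.
      by apply/negP => /eqP e; case/eqP: i01; apply: val_inj; rewrite i0E i1E e.
    by rewrite -exprnP -exprnN exprVn.
  rewrite /hw_j -i0E -i1E !(inj_eq val_inj) (negPf ii0) (negPf ii1); exact: expr0z.
Qed.

End HighestCoefficient.

(** * Embeddings into mixed symmetric powers *)

Section Bihomogeneous.
Variables (R : realType) (n : nat).
Local Notation C := R[i].
Implicit Types (X Y : 'I_n -> C).

(** Elements of S_{a,b} seen as polynomial functions; the coordinates [u] stay existential so that
    products need not be expanded. *)
Definition bihom a b (F : ('I_n -> C) -> ('I_n -> C) -> C) :=
  exists u : msetk n a * msetk n b -> C, forall X Y, F X Y = \sum_p u p * (monom X p.1 * monom Y p.2).

Lemma bihom_sum a b (J : Type) (s : seq J) (F : J -> ('I_n -> C) -> ('I_n -> C) -> C) :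
  (forall j, bihom a b (F j)) -> bihom a b (fun X Y => \sum_(j <- s) F j X Y).
Proof.
move=> hF; elim: s => [|j s [u hu]].
  by exists (fun=> 0) => X Y; rewrite big_nil big1 // => p _; rewrite mul0r.
have [u' hu'] := hF j; exists (fun p => u' p + u p) => X Y.
rewrite big_cons hu hu' -big_split /=; apply: eq_bigr => p _; by rewrite mulrDl.
Qed.

Lemma bihomZ a b c F : bihom a b F -> bihom a b (fun X Y => c * F X Y).
Proof.
move=> [u hu]; exists (fun p => c * u p) => X Y; rewrite hu big_distrr /=.
by apply: eq_bigr => p _; rewrite mulrA.
Qed.

Lemma bihom_monom a b (f : msetk n a) (g : msetk n b) : bihom a b (fun X Y => monom X f * monom Y g).
Proof.
exists (fun p => (p == (f, g))%:R) => X Y; rewrite (bigD1 (f, g)) //= eqxx mul1r.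
by rewrite big1 ?addr0 // => p /negPf ->; rewrite mul0r.
Qed.

Lemma monom_cons a (i : 'I_n) (f : msetk n a) : exists f' : msetk n a.+1, forall X, X i * monom X f = monom X f'.
Proof.
have [t <-] := content_surj f; exists (content (cons_tuple i t)) => X.
rewrite -!monom_content big_ord_recl; congr (_ * _).
by apply: eq_bigr => p _; rewrite !(tnth_nth i).
Qed.

Lemma bihom_mulX a b i F : bihom a b F -> bihom a.+1 b (fun X Y => X i * F X Y).
Proof.
move=> [u hu]; have [u' hu'] : bihom a.+1 b (fun X Y => \sum_(p <- index_enum (msetk n a * msetk n b)%type)
    u p * (X i * monom X p.1 * monom Y p.2)).
  apply: bihom_sum => -[f g] /=; apply: bihomZ; have [f' hf'] := monom_cons i f.
  by have [w hw] := bihom_monom f' g; exists w => X Y; rewrite hf' -hw.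
exists u' => X Y; rewrite -hu' hu big_distrr /=; apply: eq_bigr => p _; ring.
Qed.

Lemma bihom_mulY a b i F : bihom a b F -> bihom a b.+1 (fun X Y => Y i * F X Y).
Proof.
move=> [u hu]; have [u' hu'] : bihom a b.+1 (fun X Y => \sum_(p <- index_enum (msetk n a * msetk n b)%type)
    u p * (monom X p.1 * (Y i * monom Y p.2))).
  apply: bihom_sum => -[f g] /=; apply: bihomZ; have [g' hg'] := monom_cons i g.
  by have [w hw] := bihom_monom f g'; exists w => X Y; rewrite hg' -hw.
exists u' => X Y; rewrite -hu' hu big_distrr /=; apply: eq_bigr => p _; ring.
Qed.

Lemma bihom_ext a b F F' : (forall X Y, F X Y = F' X Y) -> bihom a b F -> bihom a b F'.
Proof. by move=> e [u hu]; exists u => X Y; rewrite -e hu. Qed.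

Lemma bihom_dot m : bihom m m (fun X Y => (\sum_i X i * Y i) ^+ m).
Proof.
elim: m => [|m IH].
  have [u hu] := @bihom_monom 0 0 (content [tuple]) (content [tuple]).
  by exists u => X Y; rewrite -hu -!monom_content !big_ord0 mulr1 expr0.
apply: (@bihom_ext _ _ (fun X Y => \sum_(i <- index_enum 'I_n) X i * (Y i * (\sum_i X i * Y i) ^+ m))).
  by move=> X Y; rewrite exprS big_distrl /=; apply: eq_bigr => i _; rewrite mulrA.
by apply: bihom_sum => i; apply: bihom_mulX; apply: bihom_mulY.
Qed.

(** The factor X_{i0}^j Y_{i1}^j has weight j (e_{i0} - e_{i1}); the invariant sum of the X_i Y_i,
    the trace element of V (x) V*, raises the degrees to [k] without changing the weight. *)
Lemma bihom_highest (i0 i1 : 'I_n) j k : (j <= k)%N ->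
  bihom k k (fun X Y => X i0 ^+ j * (Y i1 ^+ j * (\sum_i X i * Y i) ^+ (k - j))).
Proof.
move=> jk; rewrite -{1 2}(subnKC jk); move: (k - j)%N => m.
have hY l : bihom m (l + m) (fun X Y => Y i1 ^+ l * (\sum_i X i * Y i) ^+ m).
  elim: l => [|l IH]; first by apply: bihom_ext (bihom_dot m) => X Y; rewrite expr0 mul1r.
  by apply: bihom_ext (bihom_mulY i1 IH) => X Y; rewrite exprS mulrA.
suff H l b F : bihom m b F -> bihom (l + m) b (fun X Y => X i0 ^+ l * F X Y) by apply: H.
move=> hF; elim: l => [|l IH]; first by apply: bihom_ext hF => X Y; rewrite expr0 mul1r.
by apply: bihom_ext (bihom_mulX i0 IH) => X Y; rewrite exprS mulrA.
Qed.

(* S_{k,m} as a space of bihomogeneous functions: A acts by X -> A^T X, Y -> A^-1 Y. *)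
Lemma Skm_eval k m (A : 'M[C]_n) (u : msetk n k * msetk n m -> C) X Y :
  \sum_p opapply (@Skm R n k m A) u p * (monom X p.1 * monom Y p.2) =
  \sum_p u p * (monom (fun i => \sum_l A l i * X l) p.1 * monom (fun i => \sum_l invmx A i l * Y l) p.2).
Proof.
rewrite /opapply; under eq_bigr => p _ do rewrite big_distrl /=.
rewrite exchange_big /=; apply: eq_bigr => q _.
transitivity (u q * \sum_p (symk A p.1 q.1 * monom X p.1) * (symk (invmx A)^T p.2 q.2 * monom Y p.2)).
  by rewrite big_distrr /=; apply: eq_bigr => p _; rewrite /Skm; ring.
congr (_ * _); rewrite -(pair_big xpredT xpredT (fun f g => (symk A f q.1 * monom X f) * (symk (invmx A)^T g q.2 * monom Y g))) /=.
rewrite -big_distrlr /= !symk_monom; congr (_ * monom _ _); apply/funext => i.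
by apply: eq_bigr => l _; rewrite mxE.
Qed.

End Bihomogeneous.

Section Intertwiners.
Variables (R : realType) (n : nat) (mu : {set 'I_n} -> probability (MxMeas R n) R).
Hypothesis hmu : forall B : {set 'I_n}, haar_prob (UB B) (mu B).
Local Notation C := R[i].
Local Notation T := (MxMeas R n).
Local Notation G := (UB [set: 'I_n]%SET : set T).
Local Notation muT := (mu [set: 'I_n]%SET).
Let mG : measurable G := measurable_UB [set: 'I_n]%SET.
Let muG : muT G = 1%E := haar1 (hmu _).

Definition mapply (I K : finType) (L : K -> I -> C) (w : I -> C) : K -> C := fun x => \sum_y L x y * w y.

Definition intertwines (I K : finType) (sg : 'M[C]_n -> K -> K -> C) (rho : 'M[C]_n -> I -> I -> C)
  (L : K -> I -> C) := forall A, unitary A -> forall x y, \sum_z sg A x z * L z y = \sum_z L x z * rho A z y.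

Lemma intertwinesP (I K : finType) (sg : 'M[C]_n -> K -> K -> C) (rho : 'M[C]_n -> I -> I -> C) L :
  intertwines sg rho L -> forall A, unitary A -> forall w, opapply (sg A) (mapply L w) = mapply L (opapply (rho A) w).
Proof.
move=> hL A uA w; apply/funext => x; rewrite /opapply /mapply.
under eq_bigr => y _ do rewrite big_distrr /=.
under [RHS]eq_bigr => y _ do rewrite big_distrr /=.
rewrite exchange_big [RHS]exchange_big /=; apply: eq_bigr => z _.
transitivity ((\sum_y sg A x y * L y z) * w z).
  by rewrite big_distrl /=; apply: eq_bigr => y _; rewrite mulrA.
by rewrite hL // big_distrl /=; apply: eq_bigr => y _; rewrite mulrA.
Qed.

Lemma Skm_is_rep k m : is_rep (@Skm R n k m).
Proof.
split=> [x y|A B uA uB x z|x y]; first exact: Skm1.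
  by rewrite Skm_mul ?unitary_unit.
have [[m1 _] [m2 _]] := tame_regular [set: 'I_n]%SET (@regular_Skm R n k m x y).
by rewrite -UBT.
Qed.

Variables (I K : finType) (sg : 'M[C]_n -> K -> K -> C) (rho : 'M[C]_n -> I -> I -> C).
Hypothesis hsg : is_rep sg.
Hypothesis hrho : is_rep rho.

(** The Haar average of sg(X) E_ab rho(X^-1), with E_ab an elementary matrix. *)
Definition avg_intertwiner a b x y : C :=
  cint muT G (fun X : T => sg X x a * rho (invmx (X : 'M[C]_n)) b y).

Let t x a b y : tame G (fun X : T => sg X x a * rho (invmx (X : 'M[C]_n)) b y).
Proof. by apply: tameM; [exact: (rep_tame hmu hsg)|exact: (rep_tameV hmu hrho)]. Qed.

Lemma avg_intertwines a b : intertwines sg rho (avg_intertwiner a b).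
Proof.
move=> A uA x y; have GA : G A by rewrite UBT.
transitivity (cint muT G (fun X : T => sg (A *m (X : 'M[C]_n)) x a * rho (invmx (X : 'M[C]_n)) b y)).
  rewrite (cint_ext _ (g := fun X : T => \sum_z sg A x z * (sg X z a * rho (invmx (X : 'M[C]_n)) b y))).
    rewrite cint_sum //; last by move=> z; apply: tameM => //; exact: tame_cst.
    by apply: eq_bigr => z _; rewrite cintZ //; exact: t.
  move=> X /UB_unitary uX; rewrite (repM hsg) // big_distrl /=; apply: eq_bigr => z _; by rewrite mulrA.
transitivity (cint muT G (fun X : T => \sum_z rho A z y *
    (sg (A *m (X : 'M[C]_n)) x a * rho (invmx (A *m (X : 'M[C]_n))) b z))).
  apply: cint_ext => X /UB_unitary uX.
  have -> : invmx (X : 'M[C]_n) = invmx (A *m (X : 'M[C]_n)) *m A.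
    by rewrite invmx_mul ?unitary_unit // mulmxKV // unitary_unit.
  rewrite (repM hrho) //; last exact/unitaryV/unitary_mul.
  by rewrite big_distrr /=; apply: eq_bigr => z _; ring.
have tt z := tame_translate (hmu _) GA (t x a b z).
rewrite cint_sum //; last by move=> z; apply: tameM; [exact: tame_cst|exact (tt z)].
apply: eq_bigr => z _; rewrite cintZ //.
by rewrite mulrC; congr (_ * _); exact: (cint_translate (hmu _) GA (t x a b z)).
Qed.

End Intertwiners.

Section Embedding.
Variables (R : realType) (n : nat) (mu : {set 'I_n} -> probability (MxMeas R n) R).
Hypothesis hmu : forall B : {set 'I_n}, haar_prob (UB B) (mu B).
Local Notation C := R[i].
Local Notation T := (MxMeas R n).
Local Notation G := (UB [set: 'I_n]%SET : set T).
Local Notation muT := (mu [set: 'I_n]%SET).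
Let mG : measurable G := measurable_UB [set: 'I_n]%SET.
Let muG : muT G = 1%E := haar1 (hmu _).
Variables (I : finType) (rho : 'M[C]_n -> I -> I -> C) (j k : nat).
Hypothesis hrho : irrep_of_hw rho (@hw_j n j).
Hypothesis jk : (j <= k)%N.
Variables i0 i1 : 'I_n.
Hypothesis i0E : val i0 = 0%N.
Hypothesis i1E : val i1 = n.-1.
Hypothesis i01 : i0 != i1.

Let hrep : is_rep rho. Proof. by case: hrho. Qed.
Let irr : irreducible rho. Proof. by case: hrho. Qed.

Let tV b y : tame G (fun X : T => rho (invmx (X : 'M[C]_n)) b y).
Proof. exact: (rep_tameV hmu hrep). Qed.

(** Otherwise the covectors c for which c(rho(X) v) is orthogonal to the coefficients of rho(X^-1)
    form a nonzero invariant space, hence the whole dual; then v, the integral of rho(X^-1) rho(X)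
    v, is 0. *)
Lemma highest_not_orthogonal : exists b y, cint muT G (fun X : T =>
  ((X : 'M[C]_n) i0 i0 ^+ j * invmx (X : 'M[C]_n) i1 i1 ^+ j) * rho (invmx (X : 'M[C]_n)) b y) != 0.
Proof.
have [c0 [v [cv hc0]]] := highest_coefficient hmu hrho i0E i1E i01.
apply: contrapT => H.
have {}H b y : cint muT G (fun X : T => pairing c0 (opapply (rho X) v) * rho (invmx (X : 'M[C]_n)) b y) = 0.
  apply: contrapT => /eqP nz; apply: H; exists b, y; rewrite (cint_ext _ (g := fun X : T => pairing c0 (opapply (rho X) v) * rho (invmx (X : 'M[C]_n)) b y)) //.
  by move=> X /UB_unitary uX; rewrite hc0.
have tP c : tame G (fun X : T => pairing c (opapply (rho X) v)).
  by apply: tame_sum => x; apply: tameM; [exact: tame_cst|exact: (tame_opapply hmu hrep)].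
pose W c := forall b y, cint muT G (fun X : T => pairing c (opapply (rho X) v) * rho (invmx (X : 'M[C]_n)) b y) = 0.
have Wlin : lin_subspace W.
  split=> [b y|a c c' hc hc' b y].
    rewrite -[RHS](cint_cst mG muG 0); apply: cint_ext => X _.
    by rewrite /pairing big1 ?mul0r // => x _; rewrite mul0r.
  have t1 c1 : tame G (fun X : T => pairing c1 (opapply (rho X) v) * rho (invmx (X : 'M[C]_n)) b y).
    exact: tameM.
  transitivity (cint muT G (fun X : T => a * (pairing c (opapply (rho X) v) * rho (invmx (X : 'M[C]_n)) b y) +
     pairing c' (opapply (rho X) v) * rho (invmx (X : 'M[C]_n)) b y)).
    apply: cint_ext => X _; rewrite mulrA -mulrDl; congr (_ * _).
    by rewrite /pairing big_distrr -big_split /=; apply: eq_bigr => x _; ring.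
  rewrite cintD //; last by apply: tameM; [exact: tame_cst|exact: t1].
  by rewrite cintZ // hc hc' mulr0 addr0.
have Wact c A : unitary A -> W c -> W (fun y => pairing c (fun x => rho A x y)).
  move=> uA hc b y; have GA : G A by rewrite UBT.
  have t1 z : tame G (fun X : T => pairing c (opapply (rho X) v) * rho (invmx (X : 'M[C]_n)) b z).
    exact: tameM.
  have tt z := tame_translate (hmu _) GA (t1 z).
  transitivity (cint muT G (fun X : T => \sum_z rho A z y *
     (pairing c (opapply (rho (A *m (X : 'M[C]_n))) v) * rho (invmx (A *m (X : 'M[C]_n))) b z))).
    apply: cint_ext => X /UB_unitary uX.
    have -> : invmx (X : 'M[C]_n) = invmx (A *m (X : 'M[C]_n)) *m A.
      by rewrite invmx_mul ?unitary_unit // mulmxKV // unitary_unit.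
    rewrite (repM hrep) //; last exact/unitaryV/unitary_mul.
    rewrite (opapply_repM hrep) // big_distrr /= [pairing c (opapply (rho A) _)]pairing_opapply.
    by apply: eq_bigr => z _; rewrite mulrA [in RHS]mulrC -!mulrA; congr (_ * _); rewrite mulrC.
  rewrite cint_sum //; last by move=> z; apply: tameM; [exact: tame_cst|exact (tt z)].
  apply: big1 => z _; rewrite cintZ //.
  by rewrite (cint_translate (hmu _) GA (t1 z)) hc mulr0.
have c00 : c0 <> fun=> 0.
  move=> e; move: cv; rewrite e /pairing big1 => [/eqP|x _]; last by rewrite mul0r.
  by rewrite eq_sym oner_eq0.
have Wall := irreducible_functionals irr Wlin Wact (ex_intro2 _ _ c0 H c00).
have v0 : v = fun=> 0.
  apply/funext => x; transitivity (\sum_z cint muT G (fun X : T =>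
      pairing (fun y => (y == z)%:R) (opapply (rho X) v) * rho (invmx (X : 'M[C]_n)) x z)); last first.
    by apply: big1 => z _; exact: (Wall (fun y => (y == z)%:R)).
  rewrite -cint_sum //; last by move=> z; exact: tameM.
  rewrite -[LHS](cint_cst mG muG); apply: cint_ext => X /UB_unitary uX.
  transitivity (opapply (rho (invmx (X : 'M[C]_n))) (opapply (rho X) v) x).
    by rewrite -(opapply_repM hrep) ?mulVmx ?unitary_unit ?(opapply_rep1 hrep) //; exact: unitaryV.
  rewrite [LHS]/opapply; apply: eq_bigr => z _; rewrite mulrC; congr (_ * _).
  by rewrite /pairing (bigD1 z) //= eqxx mul1r big1 ?addr0 // => y /negPf ->; rewrite mul0r.
move: cv; rewrite v0 /pairing big1 => [/eqP|x _]; first by rewrite eq_sym oner_eq0.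
by rewrite /opapply mulr0.
Qed.

Theorem embedding_exists : exists L : msetk n k * msetk n k -> I -> C,
  intertwines (@Skm R n k k) rho L /\ exists x y, L x y != 0.
Proof.
have [b [y nz]] := highest_not_orthogonal.
apply: contrapT => noL.
have z x a : cint muT G (fun X : T => @Skm R n k k X x a * rho (invmx (X : 'M[C]_n)) b y) = 0.
  apply: contrapT => /eqP nz'; apply: noL; exists (avg_intertwiner mu (@Skm R n k k) rho a b).
  split; first by apply: (avg_intertwines hmu) => //; exact: Skm_is_rep.
  by exists x, y.
have [u hu] := bihom_highest R i0 i1 jk.
have tS x a : tame G (fun X : T => @Skm R n k k X x a) by exact (@tame_regular R n [set: 'I_n]%SET _ (@regular_Skm R n k k x a)).
pose cf m : C := cint muT G (fun X : T => (X : 'M[C]_n) i0 i0 ^+ j *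
  (invmx (X : 'M[C]_n) i1 i1 ^+ (j - m) * invmx (X : 'M[C]_n) i1 i0 ^+ m) * rho (invmx (X : 'M[C]_n)) b y).
have tcf m : tame G (fun X : T => (X : 'M[C]_n) i0 i0 ^+ j *
  (invmx (X : 'M[C]_n) i1 i1 ^+ (j - m) * invmx (X : 'M[C]_n) i1 i0 ^+ m) * rho (invmx (X : 'M[C]_n)) b y).
  apply: tameM => //; apply: (@tame_regular R n [set: 'I_n]%SET (fun A => A i0 i0 ^+ j * (invmx A i1 i1 ^+ (j - m) * invmx A i1 i0 ^+ m))).
  apply: regularM; first by apply: regularX; exact: regular_entry.
  by apply: regularM; apply: regularX; exact: regular_inv.
have ring1 (a1 a2 a3 a4 : C) e : a1 * (a2 * (a3 * a4) *+ e) = a1 * (a2 * a4) * (a3 *+ e).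
  by rewrite !mulrnAr; congr (_ *+ _); ring.
have ring2 (a1 a2 : C) e : (a1 *+ e) * a2 = (a2 *+ e) * a1 by rewrite !mulrnAl mulrC.
(* A polynomial in an auxiliary parameter s whose constant term is the integral of
   [highest_not_orthogonal]. The terms with m > 0 come from expanding the j-th power of (A^-1)_{i1
   i1} + s (A^-1)_{i1 i0}. *)
pose p : {poly C} := \poly_(m < j.+1) (cf m *+ 'C(j, m)).
have p0 : p = 0.
  have dX := @zdense_nroot R _ 'X (negbT (polyX_eq0 _)) (@zdense_setT R).
  apply: (zdense_polyP dX) => s [_].
  rewrite hornerX => s0.
  (* Evaluating at e_{i0} and e_{i1} alone would make the sum of the X_i Y_i vanish and lose the
     vector when j < k. With the extra s e_{i0} this sum equals s for every A, so s^(k - j) can be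
     divided out before the constant term is read. *)
  pose X0 (i : 'I_n) : C := (i == i0)%:R; pose Y0 (i : 'I_n) : C := (i == i1)%:R + s * (i == i0)%:R.
  have delta (F : 'I_n -> C) (a : 'I_n) : \sum_l F l * (l == a)%:R = F a.
    by rewrite (bigD1 a) //= eqxx mulr1 big1 ?addr0 // => l /negPf ->; rewrite mulr0.
  have deltaY (F : 'I_n -> C) : \sum_l F l * Y0 l = F i1 + s * F i0.
    rewrite -(delta F i1) -(delta F i0) big_distrr -big_split /=; apply: eq_bigr => l _.
    by rewrite /Y0; ring.
  have hX (X : 'M[C]_n) : X \in unitmx ->
      \sum_q opapply (@Skm R n k k X) u q * (monom X0 q.1 * monom Y0 q.2) =
      s ^+ (k - j) * \sum_(m < j.+1) (X i0 i0 ^+ j * (invmx X i1 i1 ^+ (j - m) * invmx X i1 i0 ^+ m)) * (s ^+ m *+ 'C(j, m)).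
    move=> uX; rewrite Skm_eval -hu.
    have -> : \sum_i (\sum_l X l i * X0 l) * (\sum_l invmx X i l * Y0 l) = s.
      transitivity (\sum_i X i0 i * (invmx X i i1 + s * invmx X i i0)).
        by apply: eq_bigr => i _; rewrite delta deltaY.
      transitivity ((X *m invmx X) i0 i1 + s * (X *m invmx X) i0 i0).
        rewrite !mxE big_distrr -big_split /=; apply: eq_bigr => i _; ring.
      by rewrite mulmxV // !mxE (negPf i01) eqxx add0r mulr1.
    rewrite delta deltaY mulrA mulrC; congr (_ * _); rewrite exprDn big_distrr /=.
    by apply: eq_bigr => m _; rewrite exprMn; exact: ring1.
  have : cint muT G (fun X : T => s ^+ (k - j) * \sum_(m < j.+1) (s ^+ m *+ 'C(j, m)) *
      ((X : 'M[C]_n) i0 i0 ^+ j * (invmx (X : 'M[C]_n) i1 i1 ^+ (j - m) * invmx (X : 'M[C]_n) i1 i0 ^+ m) * rho (invmx (X : 'M[C]_n)) b y)) = 0.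
    transitivity (cint muT G (fun X : T => \sum_q \sum_a (monom X0 q.1 * monom Y0 q.2 * u a) *
        (@Skm R n k k X q a * rho (invmx (X : 'M[C]_n)) b y))).
      apply: cint_ext => X /UB_unitary uX; transitivity ((\sum_q opapply (@Skm R n k k X) u q * (monom X0 q.1 * monom Y0 q.2)) * rho (invmx (X : 'M[C]_n)) b y).
        rewrite hX ?unitary_unit // -mulrA; congr (_ * _); rewrite big_distrl /=.
        by apply: eq_bigr => m _; rewrite -[RHS]mulrA [RHS]mulrCA.
      rewrite big_distrl /=; apply: eq_bigr => q _; rewrite /opapply !big_distrl /=.
      by apply: eq_bigr => a _; ring.
    have tz q a : tame G (fun X : T => (monom X0 q.1 * monom Y0 q.2 * u a) * (@Skm R n k k X q a * rho (invmx (X : 'M[C]_n)) b y)).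
      by apply: tameM; [exact: tame_cst|exact: tameM].
    rewrite cint_sum //; last by move=> q; apply: tame_sum => a; exact: tz.
    apply: big1 => q _; rewrite cint_sum //; apply: big1 => a _.
    by rewrite cintZ ?z ?mulr0 //; exact: tameM.
  rewrite cintZ //; last by apply: tame_sum => m; apply: tameM; [exact: tame_cst|exact: tcf].
  move/eqP; rewrite mulf_eq0 expf_eq0 (negPf s0) andbF /= => /eqP.
  rewrite cint_sum //; last by move=> m; apply: tameM; [exact: tame_cst|exact: tcf].
  move=> <-; rewrite /p horner_poly; apply: eq_bigr => m _.
  by rewrite cintZ; [exact: ring2|exact: mG|exact: tcf].
have := coef0 C 0; rewrite -p0 /p coef_poly /= bin0 mulr1n /cf => e.
case/eqP: nz; rewrite -[RHS]e; apply: cint_ext => X _.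
by rewrite subn0 expr0 mulr1.
Qed.

End Embedding.

(** * Schur's lemma *)

Section Schur.
Variables (R : realType) (n : nat).
Local Notation C := R[i].

Lemma mapply_lin (I K : finType) (L : K -> I -> C) a u v :
  mapply L (fun x => a * u x + v x) = fun x => a * mapply L u x + mapply L v x.
Proof.
apply/funext => x; rewrite /mapply big_distrr -big_split /=; apply: eq_bigr => y _; ring.
Qed.

Lemma mapplyZ (I K : finType) (L : K -> I -> C) a u : mapply L (fun x => a * u x) = fun x => a * mapply L u x.
Proof.
by apply/funext => x; rewrite /mapply big_distrr /=; apply: eq_bigr => y _; rewrite mulrCA.
Qed.

Lemma mapply0 (I K : finType) (L : K -> I -> C) : mapply L (fun=> 0) = fun=> 0.
Proof. by apply/funext => x; rewrite /mapply big1 // => y _; rewrite mulr0. Qed.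

Lemma mapply_delta (I K : finType) (L : K -> I -> C) y : mapply L (fun z => (z == y)%:R) = L^~ y.
Proof.
apply/funext => x; rewrite /mapply (bigD1 y) //= eqxx mulr1 big1 ?addr0 // => z /negPf ->.
by rewrite mulr0.
Qed.

Variables (I K : finType) (sg : 'M[C]_n -> K -> K -> C) (rho : 'M[C]_n -> I -> I -> C).
Variable L : K -> I -> C.
Hypothesis hL : intertwines sg rho L.

Lemma irreducible_injective : irreducible rho -> (exists x y, L x y != 0) ->
  forall w, mapply L w = (fun=> 0) -> w = fun=> 0.
Proof.
move=> [_ irr] [x [y xy]].
have lin : lin_subspace [set w | mapply L w = fun=> 0].
  split=> [|a u v /= hu hv]; first exact: mapply0.
  by rewrite mapply_lin hu hv; apply/funext => z; rewrite mulr0 addr0.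
case: (irr _ lin) => [A uA w /= hw|//|all]; first by rewrite -(intertwinesP hL) // hw; exact: mapply0.
have /= := all (fun z => (z == y)%:R); rewrite mapply_delta => /(congr1 (@^~ x)) /= e.
by rewrite e eqxx in xy.
Qed.

Lemma irreducible_surjective : irreducible sg -> (exists x y, L x y != 0) ->
  forall v, exists w, mapply L w = v.
Proof.
move=> [_ irr] [x [y xy]].
have lin : lin_subspace [set v | exists w, mapply L w = v].
  split=> [|a u v [w <-] [w' <-]]; first by exists (fun=> 0); exact: mapply0.
  by exists (fun z => a * w z + w' z); exact: mapply_lin.
case: (irr _ lin) => [A uA v [w <-]|h|//].
  by exists (opapply (rho A) w); rewrite (intertwinesP hL).
have /(congr1 (@^~ x)) /= := h (L^~ y) (ex_intro _ _ (mapply_delta L y)) => e.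
by rewrite e eqxx in xy.
Qed.

End Schur.

Section HighestWeightSchur.
Variables (R : realType) (n : nat).
Local Notation C := R[i].

Lemma dominated_hw (i0 : 'I_n) i j : val i0 = 0%N -> dominated (@hw_j n i) (@hw_j n j) -> (i <= j)%N.
Proof.
move=> i0E [c [_ /(_ i0)]]; rewrite /hw_j i0E eqxx /=; lia.
Qed.

(** A nonzero intertwiner between irreducible representations is bijective, so each highest weight
    occurs in the other representation. Each then dominates the other, and the first coordinates
    coincide. *)
Lemma hw_schur (i0 : 'I_n) (I K : finType) (sg : 'M[C]_n -> K -> K -> C) (rho : 'M[C]_n -> I -> I -> C) i j L :
  val i0 = 0%N -> irrep_of_hw sg (@hw_j n i) -> irrep_of_hw rho (@hw_j n j) ->
  intertwines sg rho L -> (exists x y, L x y != 0) -> i = j.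
Proof.
move=> i0E [_ irs [[v [v0 hv]] domv]] [_ irr [[u [u0 hu]] domu]] hL L0.
apply/eqP; rewrite eqn_leq; apply/andP; split.
  have [w wv] := irreducible_surjective hL irs L0 v.
  apply: (dominated_hw i0E); apply: domu; exists w; split=> [w0|t ht].
    by apply: v0; rewrite -wv w0 mapply0.
  have ut := tor_unitary ht.
  have inj := irreducible_injective hL irr L0.
  have : (fun x => -1 * opapply (rho (tor t)) w x + (\prod_l t l ^ @hw_j n i l) * w x) = fun=> 0.
    apply: inj; rewrite mapply_lin mapplyZ -(intertwinesP hL) // wv hv //; apply/funext => x.
    by rewrite mulN1r addNr.
  move=> /funeqP e; apply/funext => x; have := e x; rewrite mulN1r addrC => /eqP.
  by rewrite subr_eq0 => /eqP ->.
apply: (dominated_hw i0E); apply: domv; exists (mapply L u); split=> [e|t ht].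
  exact/u0/(irreducible_injective hL irr L0).
rewrite (intertwinesP hL) ?hu //; last exact: tor_unitary.
by rewrite mapplyZ.
Qed.

End HighestWeightSchur.

(** * The orbit of the corner monomial separates functionals *)

Section ScalarExtension.
Variables (R : realType) (n k : nat).
Local Notation C := R[i].
Hypothesis k1 : (1 <= k)%N.
Variable i0 : 'I_n.
Hypothesis i0E : val i0 = 0%N.

Lemma monomZ a (x : 'I_n -> C) (f : msetk n k) : monom (fun i => a * x i) f = a ^+ k * monom x f.
Proof.
have [t <-] := content_surj f; rewrite -!monom_content big_split /=.
by rewrite prodr_const card_ord.
Qed.

(** Apart from column [i0], which is x, the columns of A are e_j - y_j x, which y annihilates;
    x_{i0} != 0 makes all of them a basis. *)
Lemma frame_exists (x y : 'I_n -> C) : x i0 != 0 -> \sum_i y i * x i = 1 ->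
  exists A : 'M[C]_n, [/\ A \in unitmx, forall i, A i i0 = x i & forall i, invmx A i0 i = y i].
Proof.
move=> x0 xy.
pose A : 'M[C]_n := \matrix_(i, j) (if j == i0 then x i else (i == j)%:R - y j * x i).
pose B : 'M[C]_n := \matrix_(i, j) (if i == i0 then y j else (i == j)%:R - (x i / x i0) * (j == i0)%:R).
have delta (F : 'I_n -> C) (a : 'I_n) : \sum_l (l == a)%:R * F l = F a.
  by rewrite (bigD1 a) //= eqxx mul1r big1 ?addr0 // => l /negPf ->; rewrite mul0r.
have BA : B *m A = 1%:M.
  apply/matrixP => i j; rewrite !mxE.
  have [->|ii] := eqVneq i i0.
    rewrite (eq_bigr (fun l => y l * (if j == i0 then x l else (l == j)%:R - y j * x l))); last first.
      by move=> l _; rewrite !mxE eqxx.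
    have [e|ji] := eqVneq j i0; first by rewrite xy.
    transitivity (\sum_l (l == j)%:R * y l - y j * \sum_l y l * x l).
      by rewrite big_distrr -sumrB /=; apply: eq_bigr => l _; ring.
    by rewrite delta xy mulr1 subrr.
  transitivity (A i j - x i / x i0 * A i0 j).
    rewrite -(delta (fun l => A l j) i) -(delta (fun l => A l j) i0) big_distrr -sumrB /=.
    by apply: eq_bigr => l _; rewrite [B _ _]mxE (negPf ii) [i == l]eq_sym; ring.
  rewrite !mxE; have [->|ji] := eqVneq j i0; first by rewrite divfK // subrr (negPf ii).
  by rewrite mulr0n; field.
have AB := mulmx1C BA; have [uA iA] := invmx_eq AB.
exists A; split=> // i; first by rewrite mxE eqxx.
by rewrite iA mxE eqxx.
Qed.

Lemma bihom_free (u : msetk n k * msetk n k -> C) :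
  (forall x y, x i0 != 0 -> \sum_i y i * x i != 0 -> \sum_p u p * (monom x p.1 * monom y p.2) = 0) ->
  u = fun=> 0.
Proof.
move=> hu.
have step (z : C) : z != 0 -> (fun g => \sum_f u (f, g) * monom (@kron R n k z) f) = fun=> 0.
  move=> z0; pose x := @kron R n k z; have x0 : x i0 != 0 by rewrite /x /kron expf_neq0.
  (* Since k >= 1, the exponent (k+1)^i equals 1 only at [i0], so the coefficient of degree 1 is
     x_{i0}, which is nonzero. *)
  pose q : {poly C} := \sum_i x i *: 'X^(k.+1 ^ i).
  have qE w : q.[w] = \sum_i @kron R n k w i * x i.
    by rewrite horner_sum; apply: eq_bigr => i _; rewrite hornerZ hornerXn mulrC.
  have q0 : q != 0.
    apply/negP => /eqP q0; case/eqP: x0; have := coef0 C 1; rewrite -q0 coef_sum.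
    rewrite (bigD1 i0) //= coefZ coefXn i0E expn0 eqxx mulr1 big1 ?addr0 // => i ii.
    rewrite coefZ coefXn; case: eqP => [e|]; last by rewrite mulr0.
    case/eqP: ii; apply: val_inj; rewrite i0E /=; case: (nat_of_ord i) e => // m.
    rewrite expnS => e; have := expn_gt0 k.+1 m; nia.
  apply: (monom_free_dense (zdense_nroot q0 (@zdense_setT R))) => w [_]; rewrite qE => qw.
  rewrite -[RHS](hu x (@kron R n k w) x0 qw).
  transitivity (\sum_f \sum_g u (f, g) * (monom x f * monom (@kron R n k w) g)); last first.
    by rewrite pair_big /=; apply: eq_bigr => -[].
  rewrite exchange_big /=; apply: eq_bigr => g _; rewrite big_distrl /=.
  by apply: eq_bigr => f _; rewrite mulrA.
apply/funext => -[f g].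
have dX := @zdense_nroot R _ 'X (negbT (polyX_eq0 _)) (@zdense_setT R).
have e : (fun f => u (f, g)) = fun=> 0.
  apply: (monom_free_dense dX) => z [_]; rewrite hornerX => z0.
  exact: (congr1 (@^~ g) (step z z0)).
exact: (congr1 (@^~ f) e).
Qed.

(** By density A may be any invertible matrix, and [frame_exists] then reaches every pair with
    x_{i0} != 0 and y.x = 1. Homogeneity in y extends this to y.x != 0, which is enough to determine
    a bihomogeneous polynomial. *)
Lemma column_separates (u : msetk n k * msetk n k -> C) :
  (forall A : 'M[C]_n, unitary A ->
    \sum_p u p * (monom (fun i => A i i0) p.1 * monom (fun i => invmx A i0 i) p.2) = 0) ->
  u = fun=> 0.
Proof.
move=> hu.
have rF : regular (fun A : 'M[C]_n => \sum_p u p * (monom (fun i => A i i0) p.1 * monom (fun i => invmx A i0 i) p.2)).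
  apply: regular_sum => p _; apply: regularZ; apply: regularM; apply: regular_prod => i _; apply: regularX.
    exact: regular_entry.
  exact: regular_inv.
have {}hu := unitary_dense rF hu.
apply: bihom_free => x y x0; set s := \sum_i _ => s0.
have [|A [uA hA hB]] := @frame_exists x (fun i => s^-1 * y i) x0.
  by under eq_bigr => i _ do rewrite -mulrA; rewrite -big_distrr /= mulVf.
have := hu A uA; rewrite (_ : (fun i => A i i0) = x); last exact/funext.
rewrite (_ : (fun i => invmx A i0 i) = fun i => s^-1 * y i); last exact/funext.
move=> e; apply: (mulfI (expf_neq0 k (invr_neq0 s0))); rewrite mulr0 -[RHS]e big_distrr /=.
by apply: eq_bigr => p _; rewrite monomZ; ring.
Qed.

Lemma row_separates (u : msetk n k * msetk n k -> C) :
  (forall A : 'M[C]_n, unitary A ->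
    \sum_p u p * (monom (fun i => A i0 i) p.1 * monom (fun i => invmx A i i0) p.2) = 0) ->
  u = fun=> 0.
Proof.
move=> hu; apply: column_separates => A uA.
have uAT : unitary A^T.
  have /(congr1 trmx) := mulmx1C uA; rewrite trmx_mul trmxK trmx1 => e.
  by rewrite /unitary -map_trmx trmxK.
rewrite -[RHS](hu _ uAT); apply: eq_bigr => p _; congr (_ * (_ * _)).
  by apply: eq_bigr => i _; rewrite mxE.
by apply: eq_bigr => i _; rewrite -trmx_inv mxE.
Qed.

Definition corner : msetk n k := content [tuple i0 | _ < k].

Lemma corner_at : val corner i0 = k :> nat.
Proof.
rewrite contentE count_mem_card -[RHS]card_ord; apply: eq_card => p.
by rewrite !inE tnth_mktuple eqxx.
Qed.

Lemma cornerP (f : msetk n k) : val f i0 = k :> nat -> f = corner.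
Proof.
have out (g : msetk n k) i : val g i0 = k :> nat -> i != i0 -> val g i = 0%N :> nat.
  move=> gk ii; have := msetk_sum g; rewrite (bigD1 i0) //= gk => /eqP.
  rewrite -[X in _ == X]addn0 eqn_add2l sum_nat_eq0 => /forall_inP h.
  exact/eqP/h.
move=> fk; apply: msetk_eqP => i; have [->|ii] := eqVneq i i0; first by rewrite fk corner_at.
by rewrite (out f i fk ii) (out corner i corner_at ii).
Qed.

Lemma symk_corner_col (M : 'M[C]_n) g : symk M g corner = (nwords g)%:R * monom (fun i => M i i0) g.
Proof.
rewrite /corner symkE /nwords -sum1_card natr_sum big_distrl /=; apply: eq_bigr => t /eqP <-.
by rewrite mul1r -monom_content; apply: eq_bigr => p _; rewrite tnth_mktuple.
Qed.

Lemma nwords_corner : nwords corner = 1%N.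
Proof.
rewrite /nwords -[RHS](card1 [tuple i0 | _ < k]); apply: eq_card => t; rewrite !inE.
apply/eqP/eqP => [e|->//]; apply: eq_from_tnth => p; rewrite tnth_mktuple.
have : count_mem i0 t = size t by rewrite size_tuple -contentE e corner_at.
move=> /eqP; rewrite -all_count => /allP h; exact/eqP/h/mem_tnth.
Qed.

Lemma symk_corner_row (M : 'M[C]_n) f : symk M corner f = monom (fun i => M i0 i) f.
Proof.
have f0 : ((nwords f)%:R : C) != 0 by rewrite pnatr_eq0 -lt0n nwords_gt0.
apply: (mulfI f0); rewrite symk_tr symk_corner_col nwords_corner mul1r; congr (_ * monom _ _).
by apply/funext => i; rewrite mxE.
Qed.

End ScalarExtension.

(** * Vectors of the image invariant under U(1) x U(n-1) *)

Section Spherical.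
Variables (R : realType) (n k : nat) (mu : {set 'I_n} -> probability (MxMeas R n) R).
Hypothesis hmu : forall B : {set 'I_n}, haar_prob (UB B) (mu B).
Local Notation C := R[i].
Local Notation T := (MxMeas R n).
Hypothesis k1 : (1 <= k)%N.
Variable i0 : 'I_n.
Hypothesis i0E : val i0 = 0%N.
Variables (I : finType) (rho : 'M[C]_n -> I -> I -> C) (L : msetk n k * msetk n k -> I -> C).
Hypothesis hrho : is_rep rho.
Hypothesis hL : intertwines (@Skm R n k k) rho L.
Hypothesis L0 : exists x y, L x y != 0.

Local Notation F := (corner k i0).
Local Notation B1 := (~: [set i0]%SET)%SET.

Lemma agree_compl1 (g f : msetk n k) : agree B1 g f = (val g i0 == val f i0).
Proof.
apply/agreeP/eqP => [h|h j]; first by apply: h; rewrite !inE eqxx.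
by rewrite !inE negbK => /eqP ->.
Qed.

(* Average over the stabilizer U(1) x U(n-1) of the first basis line. *)
Lemma spherical_vector : exists (w : I -> C) (be : nat -> C), be k != 0 /\
  forall g g', mapply L w (g, g') = if g == g' then (nwords g)%:R * be (val g i0) else 0.
Proof.
(* Otherwise the coordinate (F, F) vanishes on the image of [L], hence along every orbit in it, and
   [row_separates] makes [L] zero. *)
have [w0 ev0] : exists w0, mapply L w0 (F, F) != 0.
  apply: contrapT => /forallNP h; have [[x1 x2] [y xy]] := L0.
  suff : (fun p => L p y) = fun=> 0 by move=> /(congr1 (@^~ (x1, x2))) /= e; rewrite e eqxx in xy.
  apply: (row_separates k1 i0E) => A uA.
  have := h (opapply (rho A) (fun z => (z == y)%:R)); rewrite -(intertwinesP hL) // mapply_delta.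
  move=> /negP; rewrite negbK => /eqP e; rewrite -[RHS]e /opapply; apply: eq_bigr => p _.
  rewrite /Skm /= !symk_corner_row [LHS]mulrC; congr (_ * _ * _).
  by apply: eq_bigr => i _; rewrite mxE.
(* The coordinate (F, F) is a covector of weight 0, so it survives the projection onto weight 0,
   which makes the vector diagonal. *)
have [P [h1 _ h3 _]] := weight_projection hmu hrho (fun=> 0).
pose w1 := opapply P w0; pose v1 := mapply L w1.
have t1 (t : 'I_n -> C) : \prod_i t i ^ 0 = 1 by rewrite big1 // => i _; exact: expr0z.
have v1inv : TorInv (@Skm R n k k) v1.
  move=> t ht; rewrite /v1 (intertwinesP hL) ?h1 //; last exact: tor_unitary.
  by congr mapply; apply/funext => x; rewrite t1 mul1r.
have [v1diag _] := TorInv_Skm v1; have {}v1diag := v1diag v1inv.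
have v1F : v1 (F, F) != 0.
  suff -> : v1 (F, F) = mapply L w0 (F, F) by [].
  apply: (h3 (L (F, F)) w0) => t ht w; have ut := tor_unitary ht.
  have t0 i : t i != 0 by apply: unit_neq0; exact: ht.
  rewrite t1 mul1r; change (mapply L (opapply (rho (tor t)) w) (F, F) = mapply L w (F, F)).
  rewrite -(intertwinesP hL) // /opapply (bigD1 (F, F)) //= Skm_tor // eqxx mulr1n.
  rewrite big1 ?addr0 => [|p /negPf pF]; last by rewrite Skm_tor // eq_sym pF mulr0n mul0r.
  rewrite -big_split big1 ?mul1r // => i _ /=; rewrite exprVn divff // expf_neq0 //.
have mB := @measurable_UB R n B1; have m1 := haar1 (hmu B1).
pose w2 (y : I) := cint (mu B1) (UB B1) (fun X : T => opapply (rho X) w1 y).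
(* For B the complement of {i0}, agreeing off B means having the same multiplicity at [i0]; by
   [avg_Skm] the average depends on nothing else, up to [nwords g]. *)
pose be m := \sum_(f : msetk n k | val f i0 == m :> nat)
  v1 (f, f) / ((nwords f)%:R * #|finset (fun h => agree B1 h f)|%:R).
have w2E g g' : mapply L w2 (g, g') = if g == g' then (nwords g)%:R * be (val g i0) else 0.
  transitivity (cint (mu B1) (UB B1) (fun X : T => opapply (@Skm R n k k X) v1 (g, g'))).
    transitivity (cint (mu B1) (UB B1) (fun X : T => pairing (L (g, g')) (opapply (rho X) w1))).
      by rewrite -(cint_pairing hmu) // => y; exact: (tame_opapply hmu hrho).
    apply: cint_ext => X /UB_unitary uX.
    exact: (congr1 (@^~ (g, g')) (esym (intertwinesP hL uX w1))).
  transitivity (\sum_f v1 (f, f) * cint (mu B1) (UB B1) (fun X : T => @Skm R n k k X (g, g') (f, f))).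
    have tS f : tame (UB B1) (fun X : T => @Skm R n k k X (g, g') (f, f)).
      exact (@tame_regular R n B1 _ (@regular_Skm R n k k (g, g') (f, f))).
    rewrite (cint_ext _ (g := fun X : T => \sum_f v1 (f, f) * @Skm R n k k X (g, g') (f, f))).
      rewrite cint_sum //; last by move=> f; apply: tameM => //; exact: tame_cst.
      by apply: eq_bigr => f _; rewrite cintZ.
    move=> X _; rewrite /opapply.
    transitivity (\sum_f \sum_f' @Skm R n k k X (g, g') (f, f') * v1 (f, f')).
      by rewrite pair_big /=; apply: eq_bigr => -[].
    apply: eq_bigr => f _; rewrite (bigD1 f) //= big1 ?addr0 1?mulrC // => f' ff'.
    by rewrite v1diag ?mulr0 // eq_sym.
  rewrite /be big_distrr /= (eq_bigr _ (fun f _ => congr1 _ (avg_Skm (hmu B1) g g' f))).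
  case: (g == g') => /=; last by rewrite big1 // => f _; rewrite mulr0.
  rewrite [RHS]big_mkcond /=; apply: eq_bigr => f _; rewrite agree_compl1 eq_sym.
  by rewrite (inj_eq val_inj); case: ifP => _; [rewrite mulrCA|rewrite mulr0].
exists w2, be; split=> //.
(* Multiplicity [k] at [i0] leaves only the corner, so this value is v1(F, F) up to a nonzero
   factor. *)
rewrite /be (big_pred1 F) => [|f]; last first.
  apply/eqP/eqP => [/(cornerP)->//|->]; exact: corner_at.
rewrite mulf_neq0 // invr_eq0 mulf_neq0 // pnatr_eq0 -lt0n ?nwords_gt0 //.
by apply/card_gt0P; exists F; rewrite inE; apply/agreeP.
Qed.

End Spherical.

(** * The sum of the embeddings is an isomorphism *)

Section DirectSum.
Variables (R : realType) (n k : nat) (mu : {set 'I_n} -> probability (MxMeas R n) R).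
Hypothesis hmu : forall B : {set 'I_n}, haar_prob (UB B) (mu B).
Local Notation C := R[i].
Local Notation T := (MxMeas R n).
Local Notation G := (UB [set: 'I_n]%SET : set T).
Local Notation muT := (mu [set: 'I_n]%SET).
Hypothesis k1 : (1 <= k)%N.
Variable i0 : 'I_n.
Hypothesis i0E : val i0 = 0%N.
Variables (d : 'I_k.+1 -> nat) (rho : forall j : 'I_k.+1, 'M[C]_n -> 'I_(d j) -> 'I_(d j) -> C).
Arguments rho : clear implicits.
Hypothesis hrho : forall j : 'I_k.+1, irrep_of_hw (rho j) (@hw_j n j).
Variable L : forall j : 'I_k.+1, msetk n k * msetk n k -> 'I_(d j) -> C.
Arguments L : clear implicits.
Hypothesis hL : forall j, intertwines (@Skm R n k k) (rho j) (L j).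
Hypothesis L0 : forall j, exists x y, L j x y != 0.

Let hrep j : is_rep (rho j). Proof. by case: (hrho j). Qed.
Let irr j : irreducible (rho j). Proof. by case: (hrho j). Qed.
Let mG : measurable G := measurable_UB [set: 'I_n]%SET.
Let muG : muT G = 1%E := haar1 (hmu _).

Local Notation D := {j : 'I_k.+1 & 'I_(d j)}.

Definition sum_map (x : msetk n k * msetk n k) (p : D) : C := L (tag p) x (tagged p).

Lemma sum_mapE (w : D -> C) : mapply sum_map w =
  fun x => \sum_j mapply (L j) (fun a => w (Tagged (fun j => 'I_(d j)) a)) x.
Proof.
apply/funext => x; rewrite /mapply /sum_map.
rewrite (sig_big_dep xpredT (fun=> xpredT) (fun j a => L j x a * w (Tagged (fun j => 'I_(d j)) a))) /=.
by apply: eq_bigr => -[j a].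
Qed.

Lemma dsum_apply A (w : D -> C) j (a : 'I_(d j)) :
  opapply (dsum rho A) w (Tagged (fun j => 'I_(d j)) a) =
  opapply (rho j A) (fun a => w (Tagged (fun j => 'I_(d j)) a)) a.
Proof.
rewrite /opapply /dsum.
transitivity (\sum_(q : D) (if j == tag q then rho j A a (tagged_as (Tagged (fun j => 'I_(d j)) a) q) else 0) *
   w (Tagged (fun j => 'I_(d j)) (tagged q))).
  by apply: eq_bigr => -[j' b].
rewrite -(sig_big_dep xpredT (fun=> xpredT) (fun j' b => (if j == j' then
    rho j A a (tagged_as (Tagged (fun j => 'I_(d j)) a) (Tagged (fun j => 'I_(d j)) b)) else 0) * w (Tagged (fun j => 'I_(d j)) b))) /=.
rewrite (bigD1 j) //= [X in _ + X]big1 ?addr0 => [|j' jj']; last first.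
  by apply: big1 => b _; rewrite eq_sym (negPf jj') mul0r.
by apply: eq_bigr => b _; rewrite eqxx tagged_asE.
Qed.

Lemma sum_map_intertwines A : unitary A -> forall w,
  opapply (@Skm R n k k A) (mapply sum_map w) = mapply sum_map (opapply (dsum rho A) w).
Proof.
move=> uA w; rewrite !sum_mapE; apply/funext => x.
rewrite /opapply; under eq_bigr => y _ do rewrite big_distrr /=.
rewrite exchange_big /=; apply: eq_bigr => j _.
transitivity (opapply (@Skm R n k k A) (mapply (L j) (fun a => w (Tagged (fun j => 'I_(d j)) a))) x); first by [].
rewrite (intertwinesP (@hL j)) //; congr (mapply (L j) _ x); apply/funext => a.
by rewrite -dsum_apply.
Qed.

(** Averaging [w] against a coefficient of rho_i(X^-1) isolates the component i: the result [E j]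
    intertwines rho_i with rho_j, so it vanishes for j != i by [hw_schur]. Since [w] is mapped to 0,
    so is [E i] under L_i, which is injective; hence [E i] = 0, although its trace is a coordinate
    of [w] chosen nonzero. *)
Lemma sum_map_injective w : mapply sum_map w = (fun=> 0) -> w = fun=> 0.
Proof.
move=> w0; suff H : forall i : 'I_k.+1, (fun a : 'I_(d i) => w (Tagged (fun j => 'I_(d j)) a)) = fun=> 0.
  by apply/funext => -[i a]; exact: (congr1 (@^~ a) (H i)).
move=> i; pose wc j (a : 'I_(d j)) := w (Tagged (fun j => 'I_(d j)) a).
apply/funext => b; apply/eqP; apply: contraT => wb.
pose E j z y := \sum_a wc j a * avg_intertwiner mu (rho j) (rho i) a b z y.
have t j z a y : tame G (fun X : T => rho j X z a * rho i (invmx (X : 'M[C]_n)) b y).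
  by apply: tameM; [exact: (rep_tame hmu (hrep j))|exact: (rep_tameV hmu (hrep i))].
have Eint j : intertwines (rho j) (rho i) (E j).
  move=> A uA z y; rewrite /E.
  under eq_bigr => l _ do rewrite big_distrr /=.
  under [RHS]eq_bigr => l _ do rewrite big_distrl /=.
  rewrite exchange_big [RHS]exchange_big /=; apply: eq_bigr => a _.
  transitivity (wc j a * \sum_l rho j A z l * avg_intertwiner mu (rho j) (rho i) a b l y).
    by rewrite big_distrr /=; apply: eq_bigr => l _; ring.
  rewrite (avg_intertwines hmu (hrep j) (hrep i)) // big_distrr /=.
  by apply: eq_bigr => l _; ring.
have E0 j : j != i -> forall z y, E j z y = 0.
  move=> ji z y; apply/eqP; apply: contraT => nz; case/eqP: ji; apply: val_inj.
  by apply: (hw_schur i0E (hrho j) (hrho i) (Eint j)); exists z, y.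
have LE x y : mapply (L i) (E i ^~ y) x = 0.
  transitivity (\sum_j mapply (L j) (E j ^~ y) x).
    rewrite (bigD1 i) //= big1 ?addr0 // => j ji.
    by rewrite /mapply big1 // => z _; rewrite E0 ?mulr0.
  transitivity (cint muT G (fun X : T => \sum_j \sum_z \sum_a (L j x z * wc j a) *
      (rho j X z a * rho i (invmx (X : 'M[C]_n)) b y))).
    have tc j z a : tame G (fun X : T => (L j x z * wc j a) * (rho j X z a * rho i (invmx (X : 'M[C]_n)) b y)).
      by apply: tameM; [exact: tame_cst|exact: t].
    rewrite cint_sum //; last by move=> j; apply: tame_sum => z; apply: tame_sum => a; exact: tc.
    apply: eq_bigr => j _; rewrite cint_sum //; last by move=> z; apply: tame_sum => a; exact: tc.
    apply: eq_bigr => z _; rewrite cint_sum // /E big_distrr /=; apply: eq_bigr => a _.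
    by rewrite cintZ // /avg_intertwiner mulrA.
  rewrite -[RHS](cint_cst mG muG 0); apply: cint_ext => X /UB_unitary uX.
  transitivity (mapply sum_map (opapply (dsum rho X) w) x * rho i (invmx (X : 'M[C]_n)) b y); last first.
    by rewrite -sum_map_intertwines // w0 /opapply big1 ?mul0r // => p _; rewrite mulr0.
  rewrite sum_mapE big_distrl /=; apply: eq_bigr => j _; rewrite /mapply big_distrl /=.
  apply: eq_bigr => z _; rewrite dsum_apply /opapply big_distrr big_distrl /=.
  by apply: eq_bigr => a _; rewrite /wc; ring.
have inj := irreducible_injective (@hL i) (irr i) (L0 i).
have Ei0 y : E i ^~ y = fun=> 0 by apply: inj; apply/funext => x; exact: LE.
(* In the trace the two representations contract to rho_i(X^-1 X) = 1, so the integrand is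
   constant. *)
have : \sum_y E i y y = wc i b.
  transitivity (cint muT G (fun X : T => \sum_y \sum_a wc i a * (rho i X y a * rho i (invmx (X : 'M[C]_n)) b y))).
    have tc y a : tame G (fun X : T => wc i a * (rho i X y a * rho i (invmx (X : 'M[C]_n)) b y)).
      by apply: tameM; [exact: tame_cst|exact: t].
    rewrite cint_sum //; last by move=> y; apply: tame_sum => a; exact: tc.
    apply: eq_bigr => y _; rewrite cint_sum // /E; apply: eq_bigr => a _.
    by rewrite cintZ.
  rewrite -[RHS](cint_cst mG muG); apply: cint_ext => X /UB_unitary uX.
  rewrite exchange_big /=.
  transitivity (opapply (rho i (invmx (X : 'M[C]_n) *m (X : 'M[C]_n))) (wc i) b).
    rewrite /opapply; apply: eq_bigr => a _; rewrite (repM (hrep i)) //; last exact: unitaryV.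
    by rewrite big_distrl /=; apply: eq_bigr => y _; ring.
  by rewrite mulVmx ?unitary_unit // (opapply_rep1 (hrep i)).
rewrite big1 => [|y _]; last exact: (congr1 (@^~ y) (Ei0 y)).
by move=> e; rewrite /wc in e; rewrite -e eqxx in wb.
Qed.

(** The values of the k+1 spherical vectors form a square matrix [M]. A row vector killed by [M]
    gives a combination with zero image, hence a zero combination, whereas no [w j] is zero because
    [be j k] is not. So [M] is invertible, and a combination supported at multiplicity [k]
    exists. *)
Lemma corner_in_image : exists w, mapply sum_map w = fun p => (p == (corner k i0, corner k i0))%:R.
Proof.
pose sph j := cid (spherical_vector hmu k1 i0E (hrep j) (@hL j) (L0 j)).
pose w j := sval (sph j); pose be j := sval (cid (svalP (sph j))).
have be0 j : be j k != 0 by have [] := svalP (cid (svalP (sph j))).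
have wE j g g' : mapply (L j) (w j) (g, g') = if g == g' then (nwords g)%:R * be j (val g i0) else 0.
  by have [_] := svalP (cid (svalP (sph j))); exact.
pose M : 'M[C]_k.+1 := \matrix_(j, m) be j m.
pose comb (c : 'rV[C]_k.+1) (p : D) := c 0 (tag p) * w (tag p) (tagged p).
have combE c g g' : mapply sum_map (comb c) (g, g') =
    if g == g' then (nwords g)%:R * (c *m M) 0 (val g i0) else 0.
  rewrite sum_mapE.
  transitivity (\sum_j c 0 j * mapply (L j) (w j) (g, g')).
    apply: eq_bigr => j _; rewrite /mapply big_distrr /=; apply: eq_bigr => a _.
    by rewrite /comb /= mulrCA.
  rewrite (eq_bigr _ (fun j _ => congr1 _ (wE j g g'))).
  case: (g == g'); last by rewrite big1 // => j _; rewrite mulr0.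
  by rewrite mxE big_distrr /=; apply: eq_bigr => j _; rewrite mxE mulrCA.
have uM : M \in unitmx.
  rewrite -row_free_unit -kermx_eq0; apply/rowV0P => c /sub_kermxP cM.
  have c0 : comb c = fun=> 0.
    apply: sum_map_injective; apply/funext => -[g g']; rewrite combE cM mxE mulr0.
    by case: ifP.
  apply/rowP => j; rewrite mxE; apply/eqP; apply: contraT => cj.
  have wj : w j = fun=> 0.
    apply/funext => a; have := congr1 (@^~ (Tagged (fun j => 'I_(d j)) a)) c0.
    by rewrite /comb /= => /eqP; rewrite mulf_eq0 (negPf cj) => /eqP.
  have := wE j (corner k i0) (corner k i0); rewrite wj mapply0 eqxx corner_at nwords_corner mul1r => e.
  by have := be0 j; rewrite -e eqxx.
exists (comb (delta_mx 0 ord_max *m invmx M)); apply/funext => -[g g'].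
rewrite combE mulmxKV // mxE eqxx /= xpair_eqE.
have cor : (val g i0 == ord_max) = (g == corner k i0).
  apply/eqP/eqP => [e|->]; first by apply: cornerP; rewrite e.
  by apply: val_inj; rewrite /= corner_at.
rewrite cor; have [<-|gg'] := eqVneq g g'.
  rewrite andbb; case: eqP => [->|_]; last by rewrite mulr0.
  by rewrite nwords_corner mul1r.
case: eqP => //= gF; case: eqP => // g'F; by rewrite gF g'F eqxx in gg'.
Qed.

(** A functional that vanishes on the image vanishes on the orbit of the corner monomial. There it
    is a bihomogeneous polynomial in a column of A and a row of A^-1, up to factors [nwords], and
    [column_separates] applies. *)
Lemma sum_map_surjective v : exists w, mapply sum_map w = v.
Proof.
pose W : set (msetk n k * msetk n k -> C) := [set v | exists w, mapply sum_map w = v].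
have Wlin : lin_subspace W.
  split=> [|a u u' [w <-] [w' <-]]; first by exists (fun=> 0); exact: mapply0.
  by exists (fun z => a * w z + w' z); exact: mapply_lin.
apply: (separating_full Wlin) => l hl.
have [w wF] := corner_in_image.
pose u p := l p * ((nwords p.1)%:R * (nwords p.2)%:R).
have u0 : u = fun=> 0.
  apply: (column_separates k1 i0E) => A uA.
  have := hl _ (ex_intro _ _ (esym (sum_map_intertwines uA w))).
  rewrite wF /pairing => e; rewrite -[RHS]e; apply: eq_bigr => p _.
  have -> : opapply (@Skm R n k k A) (fun p => (p == (corner k i0, corner k i0))%:R) p =
      @Skm R n k k A p (corner k i0, corner k i0).
    exact: (congr1 (@^~ p) (mapply_delta (@Skm R n k k A) (corner k i0, corner k i0))).
  rewrite /Skm /= !symk_corner_col /u.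
  have -> : monom (fun i => (invmx A)^T i i0) p.2 = monom (fun i => invmx A i0 i) p.2.
    by apply: eq_bigr => i _; rewrite mxE.
  ring.
apply/funext => p; have /eqP := congr1 (@^~ p) u0; rewrite /u /= !mulf_eq0 !pnatr_eq0.
by rewrite !(gtn_eqF (nwords_gt0 _)) !orbF => /eqP.
Qed.

Lemma intertwines_Lop (w : {set 'I_n} -> R) (u : D -> C) :
  opapply (Lop w mu (@Skm R n k k)) (mapply sum_map u) = mapply sum_map (opapply (Lop w mu (dsum rho)) u).
Proof.
have td B (p q : D) : tame (UB B) (fun X : T => dsum rho X p q).
  rewrite /dsum; case: (tag p == tag q); last exact: tame_cst.
  exact: (rep_tame hmu (hrep (tag p))).
have tS B x y : tame (UB B) (fun X : T => @Skm R n k k X x y).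
  exact (@tame_regular R n B _ (@regular_Skm R n k k x y)).
have LE (J : finType) (r : 'M[C]_n -> J -> J -> C) (v : J -> C) x :
    (forall B x y, tame (UB B) (fun X : T => r X x y)) ->
    opapply (Lop w mu r) v x = \sum_B real_complex R (w B) *
      (v x - cint (mu B) (UB B) (fun X : T => opapply (r X) v x)).
  move=> tr; rewrite /opapply /Lop; under eq_bigr => y _ do rewrite big_distrl /=.
  rewrite exchange_big /=; apply: eq_bigr => B _.
  rewrite cint_sum; [|exact: measurable_UB|exact: haar1 (hmu B)|]; last first.
    by move=> y; apply: tameM => //; exact: tame_cst.
  transitivity (\sum_y real_complex R (w B) * ((x == y)%:R * v y - cint (mu B) (UB B) (fun X : T => r X x y) * v y)).
    by apply: eq_bigr => y _; rewrite -mulrBl mulrA.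
  rewrite -big_distrr sumrB /=; congr (_ * (_ - _)).
    rewrite (bigD1 x) //= eqxx mul1r big1 ?addr0 // => y /negPf yx; by rewrite eq_sym yx mul0r.
  apply: eq_bigr => y _; rewrite mulrC -cintZ //; last exact: measurable_UB.
  by apply: cint_ext => X _; rewrite mulrC.
apply/funext => x; rewrite LE // /mapply.
transitivity (\sum_p sum_map x p * \sum_B real_complex R (w B) *
    (u p - cint (mu B) (UB B) (fun X : T => opapply (dsum rho X) u p))); last first.
  by apply: eq_bigr => p _; rewrite LE.
under [RHS]eq_bigr => p _ do rewrite big_distrr /=.
rewrite exchange_big /=; apply: eq_bigr => B _.
transitivity (real_complex R (w B) * \sum_p (sum_map x p * u p -
   sum_map x p * cint (mu B) (UB B) (fun X : T => opapply (dsum rho X) u p))); last first.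
  by rewrite big_distrr /=; apply: eq_bigr => p _; ring.
rewrite sumrB; congr (_ * (_ - _)).
have tdu p : tame (UB B) (fun X : T => opapply (dsum rho X) u p).
  by apply: tame_sum => q; apply: tameM => //; exact: tame_cst.
transitivity (cint (mu B) (UB B) (fun X : T => pairing (sum_map x) (opapply (dsum rho X) u))); last first.
  exact: (esym (cint_pairing hmu (sum_map x) tdu)).
apply: cint_ext => X /UB_unitary uX; exact: (congr1 (@^~ x) (sum_map_intertwines uX u)).
Qed.

(** The conjugation is the inverse of [sum_map]. It is linear because [sum_map] is linear and
    injective, and it matches torus invariants because [sum_map] is an injective intertwiner. *)
Theorem Skm_dsum (w : {set 'I_n} -> R) :
  conj_on (TorInv (@Skm R n k k)) (Lop w mu (@Skm R n k k)) (TorInv (dsum rho)) (Lop w mu (dsum rho)).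
Proof.
have /choice [Phi JPhi] := sum_map_surjective.
have inj u v : mapply sum_map u = mapply sum_map v -> u = v.
  move=> e; have := @sum_map_injective (fun x => -1 * u x + v x).
  rewrite mapply_lin e => h; have {}h : (fun x => -1 * u x + v x) = fun=> 0.
    by apply: h; apply/funext => x; rewrite mulN1r addNr.
  apply/funext => x; have /eqP := congr1 (@^~ x) h; rewrite /= mulN1r addrC subr_eq0.
  by move=> /eqP.
have inv u t : is_torus_elt t -> opapply (@Skm R n k k (tor t)) (mapply sum_map u) = mapply sum_map u <->
    opapply (dsum rho (tor t)) u = u.
  move=> ht; rewrite sum_map_intertwines; last exact: tor_unitary.
  by split=> [/inj|->].
exists Phi; split.
- by move=> a u v; apply: inj; rewrite mapply_lin !JPhi.
- by move=> u hu t ht; apply/inv => //; rewrite JPhi; exact: hu.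
- by move=> u v _ _ e; rewrite -(JPhi u) e JPhi.
- move=> v hv; exists (mapply sum_map v); last by apply: inj; rewrite JPhi.
  by move=> t ht; apply/inv => //; exact: hv.
- by move=> u _; apply: inj; rewrite JPhi -intertwines_Lop JPhi.
Qed.

End DirectSum.

Lemma conj_on_trans (R : realType) (I J K : finType) (W : set (I -> R[i])) (W' : set (J -> R[i]))
    (W'' : set (K -> R[i])) L L' L'' :
  conj_on W L W' L' -> conj_on W' L' W'' L'' -> conj_on W L W'' L''.
Proof.
move=> [f [flin fW finj fsur fL]] [g [glin gW ginj gsur gL]].
exists (g \o f); split=> [a u v|u /fW/gW//|u v Wu Wv /ginj e|v /gsur[u /fsur[x Wx <-] <-]|u Wu] /=.
- by rewrite flin glin.
- by apply: finj => //; apply: e; exact: fW.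
- by exists x.
- by rewrite fL // gL //; exact: fW.
Qed.

Unset Implicit Arguments.

Theorem theorem1p13 (R : realType) (n k : nat) (hn : (2 <= n)%N) (hk : (1 <= k)%N)
  (w : {set 'I_n} -> R)
  (mu : {set 'I_n} -> probability (MxMeas R n) R)
  (hmu : forall B : {set 'I_n}, haar_prob (UB B) (mu B))
  (d : 'I_k.+1 -> nat)
  (rho : forall j : 'I_k.+1, 'M[R[i]]_n -> 'I_(d j) -> 'I_(d j) -> R[i])
  (hrho : forall j : 'I_k.+1, irrep_of_hw (rho j) (@hw_j n j)) :
  [/\ conj_on [set: msetk n k -> R[i]] (@LKMP R n w k)
              (TorInv (@Skm R n k k)) (Lop w mu (@Skm R n k k)),
      conj_on (TorInv (@Skm R n k k)) (Lop w mu (@Skm R n k k))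
              (TorInv (dsum rho)) (Lop w mu (dsum rho)) &
      conj_on [set: msetk n k -> R[i]] (@LKMP R n w k)
              (TorInv (dsum rho)) (Lop w mu (dsum rho))].
Proof.
have n0 : (0 < n)%N by apply: leq_trans hn.
have n1 : (n.-1 < n)%N by rewrite prednK.
pose i0 := Ordinal n0; pose i1 := Ordinal n1.
(* n >= 2 separates the first index from the last, as the highest coefficient requires. *)
have i01 : i0 != i1 by rewrite -val_eqE /= eq_sym -lt0n -subn1 subn_gt0.
have jk (j : 'I_k.+1) : (j <= k)%N by rewrite -ltnS ltn_ord.
pose L j := cid (embedding_exists hmu (hrho j) (jk j) (erefl : val i0 = 0%N) (erefl : val i1 = n.-1) i01).
have hL j : intertwines (@Skm R n k k) (rho j) (sval (L j)) by case: (svalP (L j)).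
have L0 j : exists x y, sval (L j) x y != 0 by case: (svalP (L j)).
have KS := KMP_Skm k w hmu.
have SD := Skm_dsum hmu hk (erefl : val i0 = 0%N) hrho hL L0 w.
split=> //; exact: conj_on_trans KS SD.
Qed.
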